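(* Every cw1-expansive homeomorphism $f\colon S\to S$ of a compact surface $S$ is expansive.
   Context: $S$ carries a metric $\operatorname{dist}$ compatible with its topology. A continuum is a compact connected set. $f$ is cw1-expansive if there is $\delta>0$ such that whenever $A,B\subset S$ are continua with $\operatorname{diam}(f^n(A))\le\delta$ for all $n\ge0$ and $\operatorname{diam}(f^n(B))\le\delta$ for all $n\le 0$, the set $A\cap B$ has at most one point. $f$ is expansive if there is $\delta>0$ such that $\operatorname{dist}(f^n(x),f^n(y))<\delta$ for all $n\in\mathbb Z$ implies $x=y$. Surfaces are assumed to have empty boundary. *)

(* Defs.v *)
From HB Require Import structures.
From mathcomp Require Import all_boot all_order all_algebra.
From mathcomp Require Import all_classical all_reals.
From mathcomp Require Import ereal topology normedtype.
Set Implicit Arguments.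
Unset Strict Implicit.
Unset Printing Implicit Defensive.
Import Order.TTheory GRing.Theory Num.Theory.
Import numFieldNormedType.Exports.

Local Open Scope classical_set_scope.
Local Open Scope ring_scope.

Definition homeomorphic_subsets (T U : topologicalType)
    (A : set T) (B : set U) : Prop :=
  exists (h : T -> U) (k : U -> T),
    [/\ set_fun A B h, set_fun B A k,
        {in A, cancel h k} & {in B, cancel k h}] /\
    {within A, continuous h} /\ {within B, continuous k}.

(* Every point has a neighbourhood homeomorphic to an open subset of the
   plane, so there are no boundary points. *)
Definition locally_planar (R : realType) (T : topologicalType) : Prop :=
  forall x : T, exists (U : set T) (V : set 'rV[R]_2),
    [/\ open U, U x, open V & homeomorphic_subsets U V].

(* A compact metric space is Hausdorff and second countable, so these two
   axioms of a manifold need not be listed.  Connectedness is not required. *)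
Definition compact_surface (R : realType) (S : metricType R) : Prop :=
  compact [set: S] /\ locally_planar R S.

Definition continuum (T : topologicalType) (A : set T) : Prop :=
  compact A /\ connected A.

(* The value is extended real so that the supremum always exists;
   diam set0 = -oo. *)
Definition diam (R : realType) (S : metricType R) (A : set S) : \bar R :=
  ereal_sup [set (mdist x y)%:E | x in A & y in A].

(* f^-1 is the two-sided inverse carried by the structure {splitbij _ >-> _};
   any bijection of T can be equipped with this structure. *)
Definition homeomorphism (T U : topologicalType)
    (f : {splitbij [set: T] >-> [set: U]}) : Prop :=
  continuous f /\ continuous f^-1%FUN.

(* f^n for an integer n; Negz m stands for - (m + 1). *)
Definition iterz (T : Type) (f : {splitbij [set: T] >-> [set: T]})
    (n : int) : T -> T :=
  match n with
  | Posz m => iter m f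
  | Negz m => iter m.+1 f^-1%FUN
  end.

Definition cw1_expansive (R : realType) (S : metricType R)
    (f : {splitbij [set: S] >-> [set: S]}) : Prop :=
  exists2 delta : R, 0 < delta &
    forall A B : set S, continuum A -> continuum B ->
      (forall n : int, 0 <= n -> (diam (iterz f n @` A) <= delta%:E)%E) ->
      (forall n : int, n <= 0 -> (diam (iterz f n @` B) <= delta%:E)%E) ->
      is_subset1 (A `&` B).

Definition expansive (R : realType) (S : metricType R)
    (f : {splitbij [set: S] >-> [set: S]}) : Prop :=
  exists2 delta : R, 0 < delta &
    forall x y : S,
      (forall n : int, mdist (iterz f n x) (iterz f n y) < delta) -> x = y.

(* Main.v *)
(* Call a set stable (unstable) if its forward (backward) iterates all stay small; the hypothesis
   says that a stable and an unstable continuum meet in at most one point.  Every point lies on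
   stable continua of a definite size, so in a small disc lying on a common stable
   continuum is a closed equivalence relation whose classes are connected and reach the boundary
   circle.  By unicoherence of the disc, and since two chains joining linked pairs of points of
   the circle must cross, any two classes are separated by a third one.

   Suppose now that distinct points have arbitrarily close orbits.  Join them by a small set that
   is irreducible with respect to connectedness modulo tiny stable continua, and iterate forward
   until it becomes large.  In the limit the endpoints merge and the set becomes an unstable
   continuum, two points of which are separated by a stable class; cutting the set along this
   class contradicts irreducibility.  Limits of sets are taken along a free ultrafilter on the
   natural numbers. *)

From HB Require Import structures.
From mathcomp Require Import all_boot all_order all_algebra.
From mathcomp Require Import all_classical all_reals.
From mathcomp Require Import ereal topology normedtype.
From mathcomp Require Import ring lra zify.
Require Import Defs.
Set Implicit Arguments.
Unset Strict Implicit.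
Unset Printing Implicit Defensive.
Import Order.TTheory GRing.Theory Num.Theory.
Import numFieldNormedType.Exports.
Local Open Scope classical_set_scope.
Local Open Scope ring_scope.

(** * Ultralimits and chains *)

(** The obstacle is that the hypothesis compares one stable with one unstable continuum, whereas a
    set joining two points with close orbits is neither. A stable class may meet such a set in many
    points, so irreducibility among continua would lead to no contradiction. By [pull_back],
    however, these points lie on common short stable continua. This is why irreducibility is taken
    modulo [stably_related]: the intersection with the class then counts as one point. Sets
    connected only in this sense become genuinely connected in the limit, because forward iteration
    contracts stable continua uniformly ([contraction]), so that the iterates are chain-connected at
    scales tending to zero.

    Stable classes need not be arcwise connected, so the plane topology is done with chains of
    points rather than curves. Two chains span a grid, the grid carries four labels with opposite
    ones never adjacent, and the labels lift to integers. Unicoherence and the crossing of chains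
    both say that the boundary labels of a full grid cannot wind. *)

Definition omega : set_system nat :=
  projT1 (cid (ultraFilterLemma (@eventually_filter))).

#[global] Instance omega_ultra : UltraFilter omega.
Proof. by rewrite /omega; case: cid => G []. Qed.

#[global] Instance omega_proper : ProperFilter omega.
Proof. exact: ultra_proper. Qed.

Lemma omega_ge (N : nat) : \forall k \near omega, (N <= k)%N.
Proof.
rewrite /omega; case: cid => G [GU sG] /=; apply: sG.
exact: nbhs_infty_ge.
Qed.

Lemma omegaN (P : nat -> Prop) :
  ~ (\forall k \near omega, P k) -> \forall k \near omega, ~ P k.
Proof. by move=> nP; have [//|] := in_ultra_setVsetC P omega_ultra. Qed.

Lemma omega_ex (P : nat -> Prop) : (\forall k \near omega, P k) -> exists k, P k.
Proof. exact: filter_ex. Qed.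

Section ultralimit.
Variable R : realType.

Lemma omega_small (e : R) : 0 < e -> \forall k \near omega, k.+1%:R^-1 < e.
Proof.
move=> e0; near=> k.
rewrite invf_plt ?posrE//; near: k.
have [N _ NP] := @nbhs_infty_gtr R e^-1.
by apply: filterS (omega_ge N) => k Nk; apply: lt_trans (NP _ Nk) _; rewrite ltr_nat.
Unshelve. all: by end_near. Qed.

(** A cluster point of an ultrafilter is a limit: a neighbourhood outside [omega] would have its
    complement in [omega]. Compactness arguments below therefore need no subsequences. *)
Lemma ucvg_ex (T : topologicalType) (E : set T) (a : nat -> T) : compact E ->
  (\forall k \near omega, E (a k)) -> exists2 z, E z & a @ omega --> z.
Proof.
move=> cE Ea; have [z [Ez cz]] := cE (a @ omega) _ Ea.
exists z => // B Bz /=; apply: contrapT => /omegaN nB.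
by have [y [/= nBy By]] := cz (~` B) B nB Bz.
Qed.

Lemma ucvg_closed (T : topologicalType) (E : set T) (a : nat -> T) z :
  closed E -> a @ omega --> z -> (\forall k \near omega, E (a k)) -> E z.
Proof. by move=> cE az Ea; exact: (closed_cvg _ cE Ea _ az). Qed.

Definition closed_rel (T : topologicalType) (r : T -> T -> Prop) :=
  forall (a b : nat -> T) p q, a @ omega --> p -> b @ omega --> q ->
    (\forall k \near omega, r (a k) (b k)) -> r p q.

Section pseudometric.
Variable T : pseudoMetricType R.
Implicit Types (A B P Q : set T) (x y z : T) (e : R).

Lemma ucvg_ball (a : nat -> T) z e : 0 < e -> a @ omega --> z ->
  \forall k \near omega, ball z e (a k).
Proof. by move=> e0 az; apply: az; apply: nbhsx_ballx. Qed.

Lemma ucvg_ball_close (a b : nat -> T) z : a @ omega --> z ->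
  (\forall k \near omega, ball (a k) k.+1%:R^-1 (b k)) -> b @ omega --> z.
Proof.
move=> az ab B /nbhs_ballP[e /= e0 eB]; have e20 : 0 < e / 2 by rewrite divr_gt0.
suff : \forall k \near omega, B (b k) by [].
near=> k; apply: eB; rewrite (splitr e); apply: (@ball_triangle _ _ (a k)).
  by near: k; exact: (ucvg_ball e20 az).
apply: (@le_ball _ _ _ k.+1%:R^-1); last by near: k.
by apply: ltW; near: k; exact: omega_small.
Unshelve. all: by end_near. Qed.

Lemma closed_ucvg (E : set T) :
  (forall (a : nat -> T) z, (forall k, E (a k)) -> a @ omega --> z -> E z) -> closed E.
Proof.
move=> H z zE.
have ex (k : nat) : exists w, E w /\ ball z k.+1%:R^-1 w.
  by have [w Hw] := zE _ (nbhsx_ballx z k.+1%:R^-1 ltac:(by rewrite invr_gt0)); exists w.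
have [a aH] := choice ex.
apply: (H a); first by move=> k; have [] := aH k.
apply: (@ucvg_ball_close (fun=> z)); first exact: cvg_cst.
by apply: nearW => k; have [] := aH k.
Qed.

(** The upper and lower topological limits along [omega] coincide, since a set of indices that meets
    every member of an ultrafilter belongs to it. For nonempty sets in a compact metric space this
    is the Hausdorff limit of the closures. *)
Definition ulimset (A : nat -> set T) : set T :=
  [set z | forall e, 0 < e -> \forall k \near omega, exists2 y, A k y & ball z e y].

Lemma ulimset_closed (A : nat -> set T) : closed (ulimset A).
Proof.
move=> z zA e e0; have e20 : 0 < e / 2 by rewrite divr_gt0.
have [w [Aw zw]] := zA _ (nbhsx_ballx z _ e20).
apply: filterS (Aw _ e20) => k [y Ay wy]; exists y => //.
by rewrite (splitr e); apply: ball_triangle zw wy.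
Qed.

Lemma ulimset_seq (A : nat -> set T) (a : nat -> T) z :
  (\forall k \near omega, A k (a k)) -> a @ omega --> z -> ulimset A z.
Proof.
move=> Aa az e e0; near=> k; exists (a k); first by near: k.
by near: k; apply: ucvg_ball.
Unshelve. all: by end_near. Qed.

Inductive reach (A : set T) (e : R) (x : T) : T -> Prop :=
| reach0 : A x -> reach A e x x
| reachS y z : reach A e x y -> A z -> ball y e z -> reach A e x z.

Lemma reach_in A e x y : reach A e x y -> A y.
Proof. by case. Qed.

Lemma reach_sub A B e e' x y : A `<=` B -> e <= e' -> reach A e x y -> reach B e' x y.
Proof.
move=> AB ee'; elim=> [/AB Bx|{}y z _ xy /AB Bz yz]; first exact: reach0.
by apply: reachS xy Bz _; apply: le_ball yz.
Qed.

Lemma reach_trans A e x y z : reach A e x y -> reach A e y z -> reach A e x z.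
Proof. by move=> xy; elim=> // {}z w _ yz Aw zw; exact: reachS zw. Qed.

Lemma reach_sym A e x y : reach A e x y -> reach A e y x.
Proof.
elim=> [|{}y z rxy ryx Az yz]; first exact: reach0.
apply: reach_trans ryx; apply: reachS (reach0 _ Az) _ _; first exact: reach_in rxy.
exact: ball_sym.
Qed.

Lemma reach_exit A B e x y : reach A e x y -> B x -> ~ B y ->
  exists z w, [/\ reach (A `&` B) e x z, A w, ~ B w & ball z e w].
Proof.
move=> rxy Bx nBy; apply: contrapT => nex.
suff : reach (A `&` B) e x y by move=> /reach_in[].
elim: rxy {nBy} => [Ax|{}y z _ rxy Az yz]; first by apply: reach0.
have [Bz|nBz] := pselect (B z); first exact: reachS yz.
by exfalso; apply: nex; exists y, z.
Qed.

(** For compact sets, connectedness amounts to this condition at all scales [e > 0]. One scale at a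
    time, it also applies to sets that are only approximately connected, and its chains index the
    grids below. *)
Definition econn e A := forall x y, A x -> A y -> reach A e x y.

Lemma connected_econn e A : 0 < e -> connected A -> econn e A.
Proof.
move=> e0 cA x y Ax Ay.
suff -> : reach A e x = A by [].
have rA z : reach A e x z -> A z by exact: reach_in.
apply: cA.
- by exists x; apply: reach0.
- exists (\bigcup_(z in reach A e x) (ball z e)°).
    by apply: bigcup_open => z _; exact: open_interior.
  apply/seteqP; split => [z xz|z [Az [w xw wz]]].
    split; first exact: rA; exists z => //.
    by apply: nbhsx_ballx.
  by apply: reachS xw Az _; exact: interior_subset.
- exists (closure (reach A e x)); first exact: closed_closure.
  apply/seteqP; split => [z xz|z [Az]].
    by split; [exact: rA|exact: subset_closure].
  move=> /(_ _ (nbhsx_ballx z _ e0))[w [xw zw]].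
  by apply: reachS xw Az _; exact: ball_sym.
Qed.

(** Padding with the end point from [N] on gives a total sequence, so that grids are indexed by all
    pairs of naturals and conditions on neighbours have no boundary cases. *)
Lemma reach_seq A e x y : 0 < e -> reach A e x y ->
  exists (c : nat -> T) (N : nat), [/\ c 0%N = x, forall i, (N <= i)%N -> c i = y,
    forall i, A (c i) & forall i, ball (c i) e (c i.+1)].
Proof.
move=> e0; elim=> [Ax|{}y z _ [c [N [c0 cN cA cb]]] Az yz].
  by exists (fun=> x), 0%N; split => // _; apply: ballxx.
exists (fun i => if (i <= N)%N then c i else z), N.+1; split.
- by [].
- by move=> i; case: ltnP.
- by move=> i; case: ifP.
- move=> i; case: (ltnP i N) => [iN|Ni]; first by rewrite ltnW.
  case: ifP => _; last exact: ballxx.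
  by rewrite cN.
Qed.

Hypothesis hT : hausdorff_space T.

Lemma compact_apart P Q : compact P -> compact Q -> P `&` Q = set0 ->
  exists2 s, 0 < s & forall p q, P p -> Q q -> ~ ball p s q.
Proof.
move=> cP cQ PQ0; apply: contrapT => nex.
have H k : exists pq : T * T, [/\ P pq.1, Q pq.2 & ball pq.1 k.+1%:R^-1 pq.2].
  apply: contrapT => nk; apply: nex; exists k.+1%:R^-1; first by rewrite invr_gt0.
  by move=> p q Pp Qq pq; apply: nk; exists (p, q).
have [c cH] := choice H.
have [p Pp cp] : exists2 z, P z & (fst \o c) @ omega --> z.
  by apply: ucvg_ex cP _; near=> k; have [] := cH k.
have [q Qq cq] : exists2 z, Q z & (snd \o c) @ omega --> z.
  by apply: ucvg_ex cQ _; near=> k; have [] := cH k.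
suff pq : p = q by have : set0 p by rewrite -PQ0; split; rewrite // pq.
apply: hT => // A B /nbhs_ballP[e1 /= e10 e1A] /nbhs_ballP[e2 /= e20 e2B].
near omega => k; exists (c k).2; split; last first.
  by apply: e2B; near: k; exact: ucvg_ball cq.
apply: e1A; rewrite (splitr e1); apply: (@ball_triangle _ _ (c k).1).
  by near: k; apply: ucvg_ball cp; rewrite divr_gt0.
have [_ _] := cH k; apply: le_ball; apply: ltW; near: k.
by apply: omega_small; rewrite divr_gt0.
Unshelve. all: by end_near. Qed.

Hypothesis cT : compact [set: T].

Lemma closedT_compact P : closed P -> compact P.
Proof. by move=> cP; apply: subclosed_compact cP cT _. Qed.

(** If the limit split into [B] and [Q] at distance [s], chains with steps [s / 3] from near [B] to
    near [Q] would leave the [s / 3]-neighbourhood [W] of [B]. The limit of the first points outside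
    [W] cannot lie in [B], and it is too close to [B] to lie in [Q]. *)
Lemma ulimset_connected (A : nat -> set T) :
  (forall e, 0 < e -> \forall k \near omega, econn e (A k)) -> connected (ulimset A).
Proof.
move=> Aconn B [p Bp] [O oO BO] [C cC BC].
apply/seteqP; split => [z|q Lq]; first by rewrite BO => -[].
apply: contrapT => nBq.
have cL := @ulimset_closed A.
have cB : closed B by rewrite BC; exact: closedI.
pose Q := ulimset A `&` ~` O.
have cQ : closed Q by apply: closedI => //; exact: open_closedC.
have Qq : Q q by split => // Oq; apply: nBq; rewrite BO.
have BQ0 : B `&` Q = set0.
  by rewrite BO; apply/seteqP; split => // z [[_ Oz] [_ /(_ Oz)]].
have [s s0 sP] := compact_apart (closedT_compact cB) (closedT_compact cQ) BQ0.
have s30 : 0 < s / 3 by rewrite divr_gt0.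
pose W : set T := [set z | exists2 b, B b & ball b (s / 3) z].
have Lp : ulimset A p by move: Bp; rewrite BO => -[].
have exw k : exists zw : T * T,
    [/\ econn (s / 3) (A k), exists2 y, A k y & ball p (s / 3) y &
        exists2 y, A k y & ball q (s / 3) y] ->
    [/\ A k zw.2, W zw.1, ~ W zw.2 & ball zw.1 (s / 3) zw.2].
  have [[H1 [a Aa pa] [b Ab qb]]|nH] := pselect ([/\ econn (s / 3) (A k),
    exists2 y, A k y & ball p (s / 3) y & exists2 y, A k y & ball q (s / 3) y]);
    last by exists (p, p) => ?; exfalso; exact: nH.
  have Wa : W a by exists p.
  have nWb : ~ W b.
    move=> [c Bc cb]; apply: (sP c q Bc Qq); apply: (@le_ball _ _ _ (s / 3 + s / 3)).
      by lra.
    by apply: ball_triangle cb _; exact: ball_sym.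
  have [z [w [/reach_in[_ Wz] Aw nWw zw]]] := reach_exit (H1 _ _ Aa Ab) Wa nWb.
  by exists (z, w).
have [c cH] := choice exw.
have cE : \forall k \near omega, [/\ A k (c k).2, W (c k).1, ~ W (c k).2 &
    ball (c k).1 (s / 3) (c k).2].
  near=> k; apply: cH; split.
  - by near: k; exact: Aconn.
  - by near: k; exact: Lp.
  - by near: k; exact: Lq.
have [z _ cz] : exists2 z, [set: T] z & (snd \o c) @ omega --> z.
  by apply: ucvg_ex cT _; near=> k.
have Lz : ulimset A z.
  by apply: ulimset_seq cz; apply: filterS cE => k [].
have cz3 := ucvg_ball s30 cz.
have [k [[Ak Wk nWk kk] zk]] := omega_ex (filterI cE cz3).
have nBz : ~ B z by move=> Bz; apply: nWk; exists z.
have Qz : Q z by split => // Oz; apply: nBz; rewrite BO.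
have [b Bb bk] := Wk; apply: (sP b z Bb Qz).
apply: (@le_ball _ _ _ (s / 3 + s / 3 + s / 3)); first by lra.
by apply: ball_triangle (ball_sym zk); apply: ball_triangle bk kk.
Unshelve. all: by end_near. Qed.
End pseudometric.
End ultralimit.

(** * Boundary bumping, connectedness modulo a relation, and irreducible sets *)

Section bumping.
Variables (R : realType) (T : metricType R).
Implicit Types (A B E P Q : set T) (x y z : T).

Lemma mballE x (e : R) y : ball x e y = (mdist x y < e) :> Prop.
Proof. by rewrite ballEmdist. Qed.

(* [metric_triangle] and [metric_sym] restated at a [realType], so that [lra] recognizes
   the distances as the same atoms. *)
Lemma mdist_tri x y z : mdist x z <= mdist x y + mdist y z.
Proof. exact: metric_triangle. Qed.

Lemma mdist_sym x y : mdist x y = mdist y x.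
Proof. exact: metric_sym. Qed.

Lemma ucvg_mdist (a : nat -> T) z (e : R) : 0 < e -> a @ omega --> z ->
  \forall k \near omega, mdist z (a k) < e.
Proof.
move=> e0 az; have := ucvg_ball e0 az.
by apply: filterS => k; rewrite mballE.
Qed.

Lemma ucvg_close (a b : nat -> T) z : a @ omega --> z ->
  (\forall k \near omega, mdist (a k) (b k) < k.+1%:R^-1) -> b @ omega --> z.
Proof.
move=> az ab; apply: ucvg_ball_close az _.
by apply: filterS ab => k; rewrite mballE.
Qed.

Lemma ucvg_mdist_le (a b : nat -> T) x y (c : R) : a @ omega --> x -> b @ omega --> y ->
  (\forall k \near omega, mdist (a k) (b k) <= c) -> mdist x y <= c.
Proof.
move=> ax bY abc; apply/ler_addgt0Pr => e e0; have e20 : 0 < e / 2 by rewrite divr_gt0.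
near omega => k.
have xa : mdist x (a k) < e / 2 by near: k; exact: ucvg_mdist.
have yb : mdist y (b k) < e / 2 by near: k; exact: ucvg_mdist.
have ab : mdist (a k) (b k) <= c by near: k.
have := mdist_tri x (a k) y; have := mdist_tri (a k) (b k) y.
rewrite (mdist_sym (b k) y); lra.
Unshelve. all: by end_near. Qed.

Lemma ucvg_mdist_ge (a b : nat -> T) x y (c : R) : a @ omega --> x -> b @ omega --> y ->
  (\forall k \near omega, c <= mdist (a k) (b k)) -> c <= mdist x y.
Proof.
move=> ax bY abc; apply/ler_addgt0Pr => e e0; have e20 : 0 < e / 2 by rewrite divr_gt0.
near omega => k.
have xa : mdist x (a k) < e / 2 by near: k; exact: ucvg_mdist.
have yb : mdist y (b k) < e / 2 by near: k; exact: ucvg_mdist.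
have ab : c <= mdist (a k) (b k) by near: k.
have := mdist_tri (a k) x (b k); have := mdist_tri x y (b k).
rewrite (mdist_sym (a k) x); lra.
Unshelve. all: by end_near. Qed.

Hypothesis cT : compact [set: T].

Let hT := @metric_hausdorff R T.

Lemma ucvgT_ex (a : nat -> T) : exists z, a @ omega --> z.
Proof. by have [|z _ az] := @ucvg_ex T setT a cT; [exact: nearW|exists z]. Qed.

Lemma reach_reach A (e : R) x z : reach A e x z -> reach (reach A e x) e x z.
Proof.
elim=> [Ax|{}z w xz IH Aw zw]; first by apply: reach0; exact: reach0.
exact: reachS IH (reachS xz Aw zw) zw.
Qed.

(** The continuum is the limit of the sets of points reachable from [x] by ever finer chains inside
    the part of [A] in [O]. The points where such chains leave [O] accumulate at a point of the
    limit outside [O]. *)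
Lemma boundary_bumping A O x : compact A -> connected A -> open O -> A x -> O x ->
  ~ A `<=` O ->
  exists B, [/\ compact B, connected B, B `<=` A `&` closure O, B x & ~ B `<=` O].
Proof.
move=> cA kA oO Ax Ox nAO.
have clA : closed A by exact: compact_closed.
have [y Ay nOy] : exists2 y, A y & ~ O y.
  by apply: contrapT => H; apply: nAO => y Ay; apply: contrapT => nOy; apply: H; exists y.
have i0 k : 0 < k.+1%:R^-1 :> R by rewrite invr_gt0.
have ex k : exists zw : T * T, [/\ reach (A `&` O) k.+1%:R^-1 x zw.1, A zw.2, ~ O zw.2 &
    ball zw.1 k.+1%:R^-1 zw.2].
  have [z [w H]] := reach_exit (connected_econn (i0 k) kA Ax Ay) Ox nOy.
  by exists (z, w).
have [c cH] := choice ex.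
pose D k := reach (A `&` O) k.+1%:R^-1 x.
have subD z : ulimset D z -> closure (A `&` O) z.
  move=> Dz B /nbhs_ballP[e /= e0 eB].
  have [k [w Dw zw]] := omega_ex (Dz e e0).
  by exists w; split; [exact: reach_in Dw|exact: eB].
exists (ulimset D); split.
- by apply: closedT_compact => //; exact: ulimset_closed.
- apply: ulimset_connected => // e e0; near=> k => z w Dz Dw.
  apply: (@reach_sub _ _ (D k) _ k.+1%:R^-1) => //.
    by apply: ltW; near: k; exact: omega_small.
  by apply: reach_trans (reach_reach Dw); apply: reach_sym; exact: reach_reach.
- by move=> z /subD/closureI[/clA Az Oz].
- move=> e e0; apply: nearW => k; exists x; last exact: ballxx.
  exact: reach0.
- have [w cw] := ucvgT_ex (snd \o c).
  move=> /(_ w) H.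
  have cw1 : (fst \o c) @ omega --> w.
    apply: ucvg_close cw _; apply: nearW => k /=; have [_ _ _] := cH k.
    by rewrite mballE mdist_sym.
  have : ulimset D w by apply: ulimset_seq cw1; apply: nearW => k; have [] := cH k.
  move/H; apply: (ucvg_closed (open_closedC oO) cw).
  by apply: nearW => k; have [] := cH k.
Unshelve. all: by end_near. Qed.

(* Connectedness of the image of [A] under the identification of [r]-related points. *)
Definition rconn (r : T -> T -> Prop) A := forall P Q, closed P -> closed Q ->
  A = P `|` Q -> P !=set0 -> Q !=set0 -> exists p q, [/\ P p, Q q & r p q].

Lemma closed_rel_eq : closed_rel (@eq T).
Proof.
move=> a b p q ap bq ab; apply: mdist_positivity; apply/eqP.
rewrite eq_le mdist_ge0 andbT; apply: (ucvg_mdist_le ap bq).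
by apply: filterS ab => k ->; rewrite mdistxx.
Qed.

Lemma connected_rconn r A : (forall x, r x x) -> connected A -> rconn r A.
Proof.
move=> rr cA P Q cP cQ AE P0 [q Qq]; apply: contrapT => nr.
have PQ0 z : P z -> ~ Q z by move=> Pz Qz; apply: nr; exists z, z.
suff PA : P = A by apply: (PQ0 q) => //; rewrite PA AE; right.
apply: cA => //.
- exists (~` Q); first exact: closed_openC.
  apply/seteqP; split => [z Pz|z []]; first by split; [rewrite AE; left|exact: PQ0].
  by rewrite AE => -[].
- by exists P => //; rewrite AE; apply/seteqP; split => [z Pz|z []//]; split => //; left.
Qed.

Lemma rconn_connected A : closed A -> rconn eq A -> connected A.
Proof.
move=> clA rA B [b Bb] [O oO BO] [C cC BC].
apply/seteqP; split => [z|z Az]; first by rewrite BO => -[].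
apply: contrapT => nBz.
have [|||||p [q [[Ap Cp] [_ nOq] pq]]] := rA (A `&` C) (A `&` ~` O).
- exact: closedI.
- by apply: closedI => //; exact: open_closedC.
- rewrite -setIUr; apply/seteqP; split => [w Aw|w []//]; split => //.
  have [Ow|] := pselect (O w); last by right.
  by left; have : B w; [by rewrite BO|rewrite BC => -[]].
- by exists b; rewrite -BC.
- by exists z; split => // Oz; apply: nBz; rewrite BO.
- suff : O q by exact: nOq.
  rewrite -pq.
  have : B p by rewrite BC.
  by rewrite BO => -[].
Qed.

Lemma rel_apart r P Q : closed_rel r -> compact P -> compact Q ->
  (forall p q, P p -> Q q -> ~ r p q) ->
  exists2 s : R, 0 < s & forall p q p' q', P p -> Q q -> mdist p p' < s -> mdist q q' < s ->
    ~ r p' q'.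
Proof.
move=> cr cP cQ PQ; apply: contrapT => nex.
have ex (k : nat) : exists w : (T * T) * (T * T), [/\ P w.1.1, Q w.1.2,
    mdist w.1.1 w.2.1 < k.+1%:R^-1, mdist w.1.2 w.2.2 < k.+1%:R^-1 & r w.2.1 w.2.2].
  apply: contrapT => nk; apply: nex; exists k.+1%:R^-1; first by rewrite invr_gt0.
  by move=> p q p' q' Pp Qq pp' qq' rr; apply: nk; exists ((p, q), (p', q')).
have [c cH] := choice ex.
have [p Pp cp] : exists2 z, P z & (fun k => (c k).1.1) @ omega --> z.
  by apply: ucvg_ex cP _; apply: nearW => k; have [] := cH k.
have [q Qq cq] : exists2 z, Q z & (fun k => (c k).1.2) @ omega --> z.
  by apply: ucvg_ex cQ _; apply: nearW => k; have [] := cH k.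
apply: (PQ p q Pp Qq).
apply: (cr (fun k => (c k).2.1) (fun k => (c k).2.2)).
- by apply: ucvg_close cp _; apply: nearW => k; have [] := cH k.
- by apply: ucvg_close cq _; apply: nearW => k; have [] := cH k.
- by apply: nearW => k; have [] := cH k.
Qed.

(** Zorn's lemma is applied to the open sets removed from [E], so that a union of removed sets
    corresponds to a decreasing intersection. A splitting of the intersection into unrelated parts
    thickens to open sets [U] and [V] with no related pair, and these already split some member of
    the chain. *)
Lemma rconn_minimal r E x y : (forall x, r x x) -> closed_rel r -> closed E ->
  rconn r E -> E x -> E y ->
  exists A, [/\ closed A, A `<=` E, A x, A y & rconn r A] /\
    forall B, closed B -> B `<=` A -> B x -> B y -> rconn r B -> A `<=` B.
Proof.
move=> rr cr cE kE Ex Ey.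
pose PP : set (set T) := [set C | [/\ open C, ~ C x, ~ C y & rconn r (E `\` C)]].
have [F FP Ftot|C [[oC nCx nCy kC] maxC]] := @Zorn_bigcup T PP; last first.
  have clEC : closed (E `\` C) by apply: closedI => //; exact: open_closedC.
  exists (E `\` C); split; first by split => // z [].
  move=> B cB BA Bx By kB z [Ez nCz]; apply: contrapT => nBz.
  apply: (maxC (~` B)).
    split; last by move=> CB; apply: nCz; exact: CB.
    by move=> w Cw Bw; have [] := BA _ Bw.
  split; [exact: closed_openC|by apply|by apply|].
  rewrite setDE setCK setIidr//.
  by move=> w /BA[].
split.
- by apply: bigcup_open => C /FP[].
- by move=> [C /FP[]].
- by move=> [C /FP[]].
have [F0|/set0P[C0 FC0]] := eqVneq F set0.
  by rewrite F0 bigcup_set0 setD0.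
set N := \bigcup_(X in F) X.
move=> P Q cP cQ EN P0 Q0; apply: contrapT => nr.
have [|s s0 sP] := rel_apart cr (closedT_compact cT cP) (closedT_compact cT cQ).
  by move=> p q Pp Qq rpq; apply: nr; exists p, q.
pose U := \bigcup_(p in P) (ball p s)°; pose V := \bigcup_(q in Q) (ball q s)°.
have oU : open U by apply: bigcup_open => *; exact: open_interior.
have oV : open V by apply: bigcup_open => *; exact: open_interior.
have PU : P `<=` U by move=> p Pp; exists p => //; apply: nbhsx_ballx.
have QV : Q `<=` V by move=> p Pp; exists p => //; apply: nbhsx_ballx.
have nUV u v : U u -> V v -> ~ r u v.
  move=> [p Pp /interior_subset]; rewrite mballE => pu [q Qq /interior_subset].
  by rewrite mballE => qv; exact: sP pu qv.
have [C FC EC] : exists2 C, F C & E `\` C `<=` U `|` V.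
  apply: contrapT => nex.
  (* The parts not covered by [U] and [V] would form a filter base; a cluster point would belong to
     the intersection [E] minus [N] and yet lie outside [U] and [V]. *)
  pose G := filter_from F (fun C => (E `\` C) `\` (U `|` V)).
  have GF : ProperFilter G.
    apply: filter_from_proper.
      apply: filter_from_filter; first by exists C0.
      move=> C1 C2 FC1 FC2; have [H|H] := Ftot _ _ FC1 FC2; [exists C2|exists C1] => //.
        by move=> z [[Ez nz] nUVz]; split; split=> //; split=> // /H.
      by move=> z [[Ez nz] nUVz]; split; split=> //; split=> // /H.
    move=> C FC; apply/set0P/eqP => E0; apply: nex; exists C => // z Ez.
    apply: contrapT => nz; suff : set0 z by [].
    by rewrite -E0.
  have [|z [_ Gz]] := cT GF; first exact: filterT.
  have zC C : F C -> ((E `\` C) `\` (U `|` V)) z.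
    move=> FC; have : closed ((E `\` C) `\` (U `|` V)).
      apply: closedI; last by apply: open_closedC; exact: openU.
      by apply: closedI => //; apply: open_closedC; have [] := FP _ FC.
    apply => B Bz; apply: Gz => //; by exists C.
  have [[Ez _] nUVz] := zC _ FC0.
  have : (E `\` N) z by split => // -[C FC Cz]; have [[_ /(_ Cz)]] := zC _ FC.
  by rewrite EN => -[/PU|/QV] ?; apply: nUVz; [left|right].
have [oC _ _ kC] := FP _ FC.
have clEC : closed (E `\` C) by apply: closedI => //; exact: open_closedC.
have [|||||p [q [[Ep nVp] [Eq nUq] rpq]]] := kC ((E `\` C) `\` V) ((E `\` C) `\` U).
- by apply: closedI => //; exact: open_closedC.
- by apply: closedI => //; exact: open_closedC.
- rewrite -setDIr; apply/seteqP; split => [z Ez|z []//]; split => // -[Vz Uz].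
  exact: nUV Uz Vz (rr z).
- have [p Pp] := P0; exists p; split; last by move=> Vp; exact: nUV (PU _ Pp) Vp (rr p).
  have : (E `\` N) p by rewrite EN; left.
  by move=> [Ep nNp]; split => // Cp; apply: nNp; exists C.
- have [p Pp] := Q0; exists p; split; last by move=> Up; exact: nUV Up (QV _ Pp) (rr p).
  have : (E `\` N) p by rewrite EN; right.
  by move=> [Ep nNp]; split => // Cp; apply: nNp; exists C.
- have [|Up] := EC _ Ep; last by [].
  by move=> Up; have [Uq|Vq] := EC _ Eq => //; exact: nUV Up Vq rpq.
Qed.

(* If [T1 `&` T2] is contracted to a point by [r] and is the only passage from [T1] to [T2],
   then [T1] alone already joins any two of its points. *)
Lemma rconn_cut r A T1 T2 x y : (forall z, r z z) -> (forall z w, r z w -> r w z) ->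
  (forall B, closed B -> B `<=` A -> B x -> B y -> rconn r B -> A `<=` B) ->
  rconn r A -> closed T1 -> closed T2 -> A = T1 `|` T2 -> T1 x -> T1 y ->
  (forall z w, T1 z -> T2 z -> T1 w -> T2 w -> r z w) ->
  (forall z w, T1 z -> T2 w -> r z w -> T2 z) -> A `<=` T1.
Proof.
move=> rr rs minA kA c1 c2 AE T1x T1y kap cross.
have TA : T1 `<=` A by move=> z ?; rewrite AE; left.
apply: minA => // P Q cP cQ T1E [p0 Pp0] [q0 Qq0]; apply: contrapT => nr.
have nPQ z w : P z -> Q w -> ~ r z w by move=> Pz Qw rzw; apply: nr; exists z, w.
have PT z : P z -> T1 z by move=> ?; rewrite T1E; left.
have QT z : Q z -> T1 z by move=> ?; rewrite T1E; right.
(* The common points of [T1] and [T2] are mutually related, so they all lie in [P] or all in [Q].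
   Adding [T2] to that side turns a splitting of [T1] into one of [A]. *)
have [[p [Pp T2p]]|nP] := pselect (P `&` T2 !=set0).
  have QT2 q : Q q -> ~ T2 q.
    by move=> Qq T2q; apply: (nPQ _ _ Pp Qq); apply: kap => //; [exact: PT|exact: QT].
  have [|||||q [w [Qq PTw rqw]]] := kA Q (P `|` T2) => //.
  - exact: closedU.
  - by rewrite AE T1E setUA [Q `|` P]setUC.
  - by exists q0.
  - by exists p; left.
  - case: PTw => [Pw|T2w]; first exact: nPQ Pw Qq (rs _ _ rqw).
    by apply: (QT2 q) => //; apply: cross T2w rqw; exact: QT.
have [|||||p [w [Pp QTw rpw]]] := kA P (Q `|` T2) => //.
- exact: closedU.
- by rewrite AE T1E setUA.
- by exists p0.
- by exists q0; left.
- case: QTw => [Qw|T2w]; first exact: nPQ Pp Qw rpw.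
  by apply: nP; exists p; split => //; apply: cross T2w rpw; exact: PT.
Qed.

Lemma continuum_minimal E x y : compact E -> connected E -> E x -> E y ->
  exists A, [/\ compact A, connected A, A `<=` E, A x & A y] /\
    forall B, closed B -> B `<=` A -> B x -> B y -> rconn eq B -> A `<=` B.
Proof.
move=> cE kE Ex Ey.
have [A [[cA AE Ax Ay kA] mA]] := rconn_minimal (fun z => erefl z) closed_rel_eq
    (compact_closed hT cE) (connected_rconn (fun z => erefl z) kE) Ex Ey.
exists A; split => //; split => //; first exact: closedT_compact.
exact: rconn_connected.
Qed.

End bumping.

(** * Labelled grids *)

Section grid.
Local Open Scope int_scope.

Definition opposite (a b : int) := (a - b == 2) || (b - a == 2).

(** The representative of [b - a] modulo 4 in {-1, 0, 1}, which exists when the labels are not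
    opposite. *)
Let step (a b : int) : int :=
  if b - a == 3 then -1 else if a - b == 3 then 1 else b - a.

Let stepP (a b : int) : 0 <= a < 4 -> 0 <= b < 4 -> ~~ opposite a b ->
  -1 <= step a b <= 1 /\ exists m, a + step a b = b + 4 * m.
Proof.
rewrite /step /opposite => a4 b4 H.
case: (boolP (b - a == 3)) => H1; first by split=> //; exists (-1); lia.
case: (boolP (a - b == 3)) => H2; first by split=> //; exists 1; lia.
by split; [lia|exists 0; lia].
Qed.

(** The difference of the two sides is a multiple of 4 and at most 3 in absolute value: a triangle
    without opposite labels has winding number zero. *)
Let step_add (a b e : int) : 0 <= a < 4 -> 0 <= b < 4 -> 0 <= e < 4 -> ~~ opposite a b ->
  ~~ opposite b e -> ~~ opposite a e -> step a b + step b e = step a e.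
Proof.
move=> a4 b4 e4 /(stepP a4 b4)[+ [k +]] /(stepP b4 e4)[+ [m +]] /(stepP a4 e4)[+ [n +]].
move: (step a b) (step b e) (step a e) => s t u; clear; lia.
Qed.

(* The labels stand for the four quarters of a circle, and [l] is a lift to its universal cover. *)
Lemma grid_lift (c : nat -> nat -> int) :
  (forall i j, 0 <= c i j < 4) ->
  (forall i j, [&& ~~ opposite (c i j) (c i.+1 j), ~~ opposite (c i j) (c i j.+1),
     ~~ opposite (c i j) (c i.+1 j.+1), ~~ opposite (c i.+1 j) (c i j.+1),
     ~~ opposite (c i.+1 j) (c i.+1 j.+1) & ~~ opposite (c i j.+1) (c i.+1 j.+1)]) ->
  exists l : nat -> nat -> int, [/\ forall i j, exists m, l i j = c i j + 4 * m,
    forall i j, `|l i.+1 j - l i j| <= 1 & forall i j, `|l i j.+1 - l i j| <= 1].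
Proof.
move=> c4 nopp.
pose l0 := fix F i := if i is i'.+1 then F i' + step (c i' 0%N) (c i 0%N) else c 0%N 0%N.
pose l i := fix F j := if j is j'.+1 then F j' + step (c i j') (c i j) else l0 i.
have lj i j : l i j.+1 = l i j + step (c i j) (c i j.+1) by [].
(* [l] is defined along the column [j = 0] and then along rows. That it also grows by [step] in the
   other direction is path independence around a unit square, cut into two triangles by its
   diagonal. *)
have li i j : l i.+1 j = l i j + step (c i j) (c i.+1 j).
  elim: j => [//|j IH]; rewrite !lj IH.
  have /and5P[ab ad ae bd /andP[be de]] := nopp i j.
  by rewrite -!addrA !step_add.
have st i j i' j' : ~~ opposite (c i j) (c i' j') ->
    -1 <= step (c i j) (c i' j') <= 1 /\
    exists m, c i j + step (c i j) (c i' j') = c i' j' + 4 * m by exact: stepP.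
have cong i j : exists m, l i j = c i j + 4 * m.
  elim: i j => [|i IH] j.
    elim: j => [|j [m IH]]; first by exists 0; rewrite /=; lia.
    have /and5P[_ /st[_ [m' H]] _ _ _] := nopp 0%N j.
    by exists (m + m'); rewrite lj IH; lia.
  have /and5P[/st[_ [m' H]] _ _ _ _] := nopp i j; have [m Hm] := IH j.
  by exists (m + m'); rewrite li Hm; lia.
exists l; split => // i j.
  by rewrite li; have /and5P[/st[H _] _ _ _ _] := nopp i j; lia.
by rewrite lj; have /and5P[_ /st[H _] _ _ _] := nopp i j; lia.
Qed.

(* A lift that never steps between the residues [r] and [r + 1] stays in one period. *)
Lemma lift_window (r : int) (u c : nat -> int) (m : int) (N : nat) :
  (forall i, exists m, u i = c i + 4 * m) -> (forall i, 0 <= c i < 4) ->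
  (forall i, `|u i.+1 - u i| <= 1) ->
  (forall i, ~~ ((4 %| c i - r)%Z && (4 %| c i.+1 - r - 1)%Z)) ->
  (forall i, ~~ ((4 %| c i.+1 - r)%Z && (4 %| c i - r - 1)%Z)) ->
  4 * m + r + 1 <= u 0%N <= 4 * m + r + 4 ->
  4 * m + r + 1 <= u N <= 4 * m + r + 4.
Proof.
move=> cong c4 st f1 f2 u0; elim: N => [//|N IH].
have [a Ha] := cong N; have [b Hb] := cong N.+1.
move: (c4 N) (c4 N.+1) (st N) (f1 N) (f2 N) IH; rewrite Ha Hb.
move: (c N) (c N.+1) => x y; lia.
Qed.

Lemma mod4_eq (a r s : int) : 0 <= a < 4 -> (4 %| a - r)%Z -> 0 <= s < 4 -> (4 %| s - r)%Z ->
  a = s.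
Proof. lia. Qed.

(* A boundary labelling that winds once around the circle does not extend to the grid. *)
Lemma grid_winding (c : nat -> nat -> int) (N M : nat) :
  (forall i j, 0 <= c i j < 4) ->
  (forall i j, [&& ~~ opposite (c i j) (c i.+1 j), ~~ opposite (c i j) (c i j.+1),
     ~~ opposite (c i j) (c i.+1 j.+1), ~~ opposite (c i.+1 j) (c i j.+1),
     ~~ opposite (c i.+1 j) (c i.+1 j.+1) & ~~ opposite (c i j.+1) (c i.+1 j.+1)]) ->
  (forall j j', (j' == j.+1) || (j == j'.+1) -> c 0%N j = 3 -> c 0%N j' = 0 -> False) ->
  (forall i i', (i' == i.+1) || (i == i'.+1) -> c i 0%N = 2 -> c i' 0%N = 3 -> False) ->
  (forall j j', (j' == j.+1) || (j == j'.+1) -> c N j = 2 -> c N j' = 1 -> False) ->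
  (forall i i', (i' == i.+1) || (i == i'.+1) -> c i M = 1 -> c i' M = 0 -> False) ->
  c 0%N 0%N = 1 -> c N 0%N = 0 -> c N M = 3 -> c 0%N M = 2 -> False.
Proof.
move=> c4 /(grid_lift c4)[l [cong li lj]] noL noB noR noT c00 cN0 cNM c0M.
have res i j (r s : int) := @mod4_eq (c i j) r s (c4 i j).
have [m Hm] := cong 0%N 0%N; rewrite c00 in Hm.
have WL : 4 * (m - 1) + 3 + 1 <= l 0%N M <= 4 * (m - 1) + 3 + 4.
  apply: (@lift_window 3 (l 0%N) (c 0%N) _ _ (cong 0%N) (c4 0%N) (lj 0%N)); last by rewrite Hm; lia.
    move=> j; apply/negP => /andP[H1 H2]; apply: (noL j j.+1); rewrite ?eqxx//.
      exact: (res _ _ _ 3 H1).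
    by apply: (res _ _ (3 + 1) 0) => //; rewrite opprD addrA.
  move=> j; apply/negP => /andP[H1 H2]; apply: (noL j.+1 j); rewrite ?eqxx ?orbT//.
    exact: (res _ _ _ 3 H1).
  by apply: (res _ _ (3 + 1) 0) => //; rewrite opprD addrA.
have WB : 4 * (m - 1) + 2 + 1 <= l N 0%N <= 4 * (m - 1) + 2 + 4.
  apply: (@lift_window 2 (l^~ 0%N) (c^~ 0%N) _ _ (cong^~ 0%N) (c4^~ 0%N) (li^~ 0%N));
    last by rewrite Hm; lia.
    move=> j; apply/negP => /andP[H1 H2]; apply: (noB j j.+1); rewrite ?eqxx//.
      exact: (res _ _ _ 2 H1).
    by apply: (res _ _ (2 + 1) 3) => //; rewrite opprD addrA.
  move=> j; apply/negP => /andP[H1 H2]; apply: (noB j.+1 j); rewrite ?eqxx ?orbT//.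
    exact: (res _ _ _ 2 H1).
  by apply: (res _ _ (2 + 1) 3) => //; rewrite opprD addrA.
have [m2 Hm2] := cong N 0%N; rewrite cN0 in Hm2.
have WR : 4 * (m - 1) + 1 + 1 <= l N M <= 4 * (m - 1) + 1 + 4.
  apply: (@lift_window 1 (l N) (c N) _ _ (cong N) (c4 N) (lj N)); last by move: WB; rewrite Hm2; lia.
    move=> j; apply/negP => /andP[H1 H2]; apply: (noR j.+1 j); rewrite ?eqxx ?orbT//.
      by apply: (res _ _ (1 + 1) 2) => //; rewrite opprD addrA.
    exact: (res _ _ _ 1 H1).
  move=> j; apply/negP => /andP[H1 H2]; apply: (noR j j.+1); rewrite ?eqxx//.
    by apply: (res _ _ (1 + 1) 2) => //; rewrite opprD addrA.
  exact: (res _ _ _ 1 H1).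
have [m1 Hm1] := cong 0%N M; rewrite c0M in Hm1.
have WT : 4 * m + 0 + 1 <= l N M <= 4 * m + 0 + 4.
  apply: (@lift_window 0 (l^~ M) (c^~ M) _ _ (cong^~ M) (c4^~ M) (li^~ M));
    last by move: WL; rewrite Hm1; lia.
    move=> j; apply/negP => /andP[H1 H2]; apply: (noT j.+1 j); rewrite ?eqxx ?orbT//.
      by apply: (res _ _ (0 + 1) 1) => //; rewrite opprD addrA.
    exact: (res _ _ _ 0 H1).
  move=> j; apply/negP => /andP[H1 H2]; apply: (noT j j.+1); rewrite ?eqxx//.
    by apply: (res _ _ (0 + 1) 1) => //; rewrite opprD addrA.
  exact: (res _ _ _ 0 H1).
have [m3 Hm3] := cong N M; rewrite cNM in Hm3.
by move: WR WT; rewrite Hm3; lia.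
Qed.
End grid.

(** * Unicoherence of the disc *)

Section disc.
Variable R : realType.
Notation pt := (R * R)%type.

Definition disc : set pt := [set z | z.1 ^+ 2 + z.2 ^+ 2 <= 1].
Definition circ : set pt := [set z | z.1 ^+ 2 + z.2 ^+ 2 = 1].

Lemma circ_disc : circ `<=` disc.
Proof. by move=> z; rewrite /circ /disc /= => ->. Qed.

Lemma ptE (z : pt) : z = (z.1, z.2). Proof. by case: z. Qed.

Lemma pball (z w : pt) e : ball z e w <-> `|z.1 - w.1| < e /\ `|z.2 - w.2| < e.
Proof. by []. Qed.

Lemma sqnorm_continuous : continuous (fun z : pt => z.1 ^+ 2 + z.2 ^+ 2).
Proof.
move=> z; apply: cvgD.
  by apply: (@cvgM _ _ _ _ fst fst); exact: cvg_fst.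
by apply: (@cvgM _ _ _ _ snd snd); exact: cvg_snd.
Qed.

Lemma closed_disc : closed disc.
Proof.
have -> : disc = (fun z : pt => z.1 ^+ 2 + z.2 ^+ 2) @^-1` [set x | x <= 1] by [].
by apply: preimage_closed; [move=> z _; exact: sqnorm_continuous|exact: closed_le].
Qed.

Lemma closed_circ : closed circ.
Proof.
have -> : circ = (fun z : pt => z.1 ^+ 2 + z.2 ^+ 2) @^-1` [set x | x = 1] by [].
by apply: preimage_closed; [move=> z _; exact: sqnorm_continuous|exact: closed_eq].
Qed.

Lemma disc_coord z : disc z -> [/\ -1 <= z.1, z.1 <= 1, -1 <= z.2 & z.2 <= 1].
Proof. by rewrite /disc /= !expr2 => H; split; nra. Qed.

Lemma compact_disc : compact disc.
Proof.
have cI := compact_setX (@segment_compact R (-1) 1) (@segment_compact R (-1) 1).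
apply: subclosed_compact closed_disc cI _ => z /disc_coord[a b c d].
by split => /=; rewrite in_itv /=; apply/andP.
Qed.

Lemma pt_hausdorff : hausdorff_space pt.
Proof. exact: norm_hausdorff. Qed.

Definition seg (t : R) (z w : pt) : pt :=
  ((1 - t) * z.1 + t * w.1, (1 - t) * z.2 + t * w.2).

Lemma seg_disc t z w : 0 <= t <= 1 -> disc z -> disc w -> disc (seg t z w).
Proof.
case: z w => [a b] [c d] /andP[t0 t1]; rewrite /disc /seg /= => Hz Hw.
have : 0 <= t * (1 - t) * ((a - c) ^+ 2 + (b - d) ^+ 2).
  by apply: mulr_ge0; [apply: mulr_ge0 => //; lra|rewrite addr_ge0 ?sqr_ge0].
have := ler_wpM2l t0 Hw.
have : (1 - t) * (a ^+ 2 + b ^+ 2) <= (1 - t) * 1 by rewrite ler_wpM2l// subr_ge0.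
nra.
Qed.

Lemma seg_ball t t' z w z' w' (e b : R) : 0 <= t <= 1 -> 0 < e ->
  disc z' -> disc w' -> `|t - t'| <= b ->
  ball z e z' -> ball w e w' -> ball (seg t z w) (e + 2 * b) (seg t' z' w').
Proof.
move=> t01 e0 /disc_coord[z1 z2 z3 z4] /disc_coord[w1 w2 w3 w4] tb.
move=> /pball[zz1 zz2] /pball[ww1 ww2].
have aux (x y x' y' : R) : -1 <= x' <= 1 -> -1 <= y' <= 1 -> `|x - x'| < e -> `|y - y'| < e ->
    `|((1 - t) * x + t * y) - ((1 - t') * x' + t' * y')| < e + 2 * b.
  move=> x'1 y'1 xx yy.
  have -> : ((1 - t) * x + t * y) - ((1 - t') * x' + t' * y') =
      ((1 - t) * (x - x') + t * (y - y')) + (t - t') * (y' - x') by ring.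
  apply: le_lt_trans (ler_normD _ _) _; apply: ltr_leD.
    apply: le_lt_trans (ler_normD _ _) _; rewrite !normrM.
    have [t0 t1] := andP t01.
    rewrite (ger0_norm t0) (ger0_norm (_ : 0 <= 1 - t)) ?subr_ge0//.
    move: xx yy; move: `|x - x'| `|y - y'| => u v uv vv.
    have [->|tn0] := eqVneq t 0; first lra.
    have tp : 0 < t by rewrite lt_def tn0.
    have : t * v < t * e by rewrite ltr_pM2l.
    have : (1 - t) * u <= (1 - t) * e by rewrite ler_wpM2l ?subr_ge0// ltW.
    lra.
  rewrite normrM mulrC; apply: ler_pM => //.
  by rewrite ler_norml; apply/andP; split; lra.
by apply/pball; split; apply: aux => //; apply/andP.
Qed.

(** A chain in [X] and a chain in [Y], both from [x] to [y], are interpolated linearly in the convex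
    disc. The labels record membership in [X] and nearness to [P], arranged in a 4-cycle. Along the
    chain in [X] the lift rises by 1, from label 0 to 1; along the chain in [Y] it falls by 3,
    through 3 and 2. The other two sides of the grid are constant, which is impossible. *)
Lemma disc_unicoherent (X Y P Q : set pt) x y :
  X `|` Y = disc -> closed X -> closed Y -> closed P -> closed Q -> P `&` Q = set0 ->
  X `&` Y `<=` P `|` Q -> P x -> Q y -> X x -> Y x -> X y -> Y y ->
  (forall e, 0 < e -> econn e X) -> (forall e, 0 < e -> econn e Y) -> False.
Proof.
move=> XY cX cY cP cQ PQ0 XYPQ Px Qy Xx Yx Xy Yy kX kY.
have XD z : X z -> disc z by rewrite -XY; left.
have YD z : Y z -> disc z by rewrite -XY; right.
have [s s0 sP] : exists2 s : R, 0 < s & forall p q, (P `&` disc) p -> (Q `&` disc) q -> ~ ball p s q.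
  apply: (compact_apart pt_hausdorff).
  - by rewrite setIC; apply: compact_closedI => //; exact: compact_disc.
  - by rewrite setIC; apply: compact_closedI => //; exact: compact_disc.
  - by apply/seteqP; split => // z [[Pz _] [Qz _]]; rewrite -PQ0.
have s20 : 0 < s / 2 by rewrite divr_gt0.
pose nearP v := exists2 p, (P `&` disc) p & ball p (s / 2) v.
have Pnear p : P p -> disc p -> nearP p by move=> Pp Dp; exists p => //; exact: ballxx.
have Qnear p : Q p -> disc p -> ~ nearP p.
  move=> Qp Dp [q Pq qp]; apply: (sP q p) => //; apply: le_ball qp; lra.
(* Otherwise close pairs on which nearness to [P] differs would converge to a point of both [X] and
   [Y], hence of [P] or [Q]; but nearness to [P] is constant around such a point. *)
have [e e0 eP] : exists2 e : R, 0 < e & forall v w, X v -> Y w -> ball v e w -> (nearP v <-> nearP w).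
  apply: contrapT => nex.
  have ex (k : nat) : exists vw : pt * pt, [/\ X vw.1, Y vw.2, ball vw.1 k.+1%:R^-1 vw.2 &
      ~ (nearP vw.1 <-> nearP vw.2)].
    apply: contrapT => nk; apply: nex; exists k.+1%:R^-1; first by rewrite invr_gt0.
    by move=> v w Xv Yw vw; apply: contrapT => nn; apply: nk; exists (v, w).
  have [c cH] := choice ex.
  have [z Dz cz] : exists2 z, disc z & (fst \o c) @ omega --> z.
    by apply: ucvg_ex compact_disc _; apply: nearW => k; apply: XD; have [] := cH k.
  have cz2 : (snd \o c) @ omega --> z.
    by apply: ucvg_ball_close cz _; apply: nearW => k; have [] := cH k.
  have Xz : X z by apply: (ucvg_closed cX cz); apply: nearW => k; have [] := cH k.
  have Yz : Y z by apply: (ucvg_closed cY cz2); apply: nearW => k; have [] := cH k.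
  have [k [zk1 zk2]] := omega_ex (filterI (ucvg_ball s20 cz) (ucvg_ball s20 cz2)).
  have [_ _ _] := cH k; apply.
  have [Pz|Qz] := XYPQ z (conj Xz Yz); first by split => _; exists z.
  by split => -[p [Pp Dp] pk]; exfalso; apply: (sP p z) => //; rewrite (splitr s);
    apply: ball_triangle pk (ball_sym _).
(* A step in the grid moves a point by less than [e' + 2 * e']: the chains contribute [e'], and the
   change of the parameter, at most [e'], is multiplied by coordinate differences of at most 2. *)
pose e' := Num.min e s / 4.
have e'0 : 0 < e' by rewrite divr_gt0// lt_min e0.
have e'e : 4 * e' <= e by rewrite mulrC divfK// ge_min lexx.
have e's : 4 * e' <= s by rewrite mulrC divfK// ge_min lexx orbT.
have [xs [N [xs0 xsN xsX xsb]]] := reach_seq e'0 (kX _ e'0 _ _ Xx Xy).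
have [ys [N' [ys0 ysN ysY ysb]]] := reach_seq e'0 (kY _ e'0 _ _ Yx Yy).
have [M M0 MP] : exists2 M : nat, (0 < M)%N & M%:R^-1 <= e'.
  have [k _ kP] := @nbhs_infty_gtr R e'^-1.
  exists k.+1 => //; rewrite invf_ple ?posrE//.
  by apply: ltW; apply: kP; exact: leqnSn.
pose t (j : nat) : R := (minn j M)%:R / M%:R.
have MR : 0 < M%:R :> R by rewrite ltr0n.
have t01 j : 0 <= t j <= 1.
  rewrite divr_ge0//= ler_pdivrMr// mul1r ler_nat; exact: geq_minr.
have tt j : `|t j - t j.+1| <= e'.
  rewrite /t -mulrBl normrM [`|M%:R^-1|]ger0_norm ?invr_ge0 ?(ltW MR)//.
  apply: le_trans _ MP; rewrite -[leRHS]mul1r ler_pM2r ?invr_gt0//.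
  rewrite /minn; case: ltnP => jM; case: ltnP => jM1.
  - by rewrite distrC -natrB// subSnn normr1.
  - have -> : M = j.+1 by apply/eqP; rewrite eqn_leq jM1 jM.
    by rewrite -natr1 opprD addNKr normrN normr1.
  - by exfalso; move: jM jM1; lia.
  - by rewrite subrr normr0.
pose v i j := seg (t j) (xs i) (ys i).
have vD i j : disc (v i j) by apply: seg_disc => //; [exact: XD|exact: YD].
have vb i j i' j' : (i' == i) || (i' == i.+1) || (i == i'.+1) -> (j' == j) || (j' == j.+1) || (j == j'.+1) ->
    ball (v i j) e (v i' j').
  move=> ii jj; apply: (@le_ball _ _ _ (e' + 2 * e')); first lra.
  apply: seg_ball => //.
  - exact: XD.
  - exact: YD.
  - move: jj => /orP[/orP[]|] /eqP->; first by rewrite subrr normr0 ltW.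
      exact: tt.
    by rewrite distrC; exact: tt.
  - move: ii => /orP[/orP[]|] /eqP->; [exact: ballxx|exact: xsb|exact/ball_sym/xsb].
  - move: ii => /orP[/orP[]|] /eqP->; [exact: ballxx|exact: ysb|exact/ball_sym/ysb].
pose lab w : int := if `[< X w >] then (if `[< nearP w >] then 0 else 1)
  else (if `[< nearP w >] then 3 else 2).
have lab4 w : (0 <= lab w < 4)%R by rewrite /lab; case: ifP; case: ifP.
have labo w w' : disc w -> disc w' -> ball w e w' -> ~~ opposite (lab w) (lab w').
  rewrite -XY => XYw XYw' ww'; rewrite /lab.
  have [Xw|nXw] := asboolP (X w); have [Xw'|nXw'] := asboolP (X w').
  - by case: ifP; case: ifP.
  - have Yw' : Y w' by case: XYw'.
    have [H1 H2] := eP _ _ Xw Yw' ww'.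
    by have [nw|nw] := asboolP (nearP w); have [nw'|nw'] := asboolP (nearP w');
      rewrite //=; exfalso; [apply: nw'; exact: H1|apply: nw; exact: H2].
  - have Yw : Y w by case: XYw.
    have [H1 H2] := eP _ _ Xw' Yw (ball_sym ww').
    by have [nw|nw] := asboolP (nearP w); have [nw'|nw'] := asboolP (nearP w');
      rewrite //=; exfalso; [apply: nw'; exact: H2|apply: nw; exact: H1].
  - by case: ifP; case: ifP.
have [l [cong li lj]] := @grid_lift (fun i j => lab (v i j)) (fun i j => lab4 _)
  ltac:(by move=> i j; apply/and5P; split; [| | | |apply/andP; split];
    apply: labo => //; apply: vb; rewrite !eqxx ?orbT).
have labx : lab x = 0.
  by rewrite /lab asboolT// asboolT//; apply: Pnear => //; exact: XD.
have laby : lab y = 1.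
  by rewrite /lab asboolT// asboolF//; apply: Qnear => //; exact: XD.
have v0 j : v 0%N j = x by rewrite /v xs0 ys0 /seg [RHS]ptE; congr pair; ring.
pose NN := maxn N N'.
have vN j : v NN j = y.
  by rewrite /v xsN ?leq_maxl// ysN ?leq_maxr// /seg [RHS]ptE; congr pair; ring.
have t0 : t 0%N = 0 by rewrite /t min0n mul0r.
have tM : t M = 1 by rewrite /t minnn divff// gt_eqF.
have vb0 i : v i 0%N = xs i by rewrite /v t0 /seg [RHS]ptE; congr pair; ring.
have vtM i : v i M = ys i by rewrite /v tM /seg [RHS]ptE; congr pair; ring.
have labX w : X w -> (lab w == 0) || (lab w == 1).
  by move=> Xw; rewrite /lab asboolT//; case: ifP.
have [m Hm] := cong 0%N 0%N; rewrite v0 labx in Hm.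
(* bottom row, right column, left column and top row of the grid *)
have B := @lift_window 3 (fun i => l i 0%N) (fun i => lab (v i 0%N)) (m - 1) NN
  (fun i => cong i 0%N) (fun i => lab4 _) (fun i => li i 0%N)
  ltac:(by move=> i; rewrite /= !vb0; case/orP: (labX _ (xsX i)) => /eqP->;
    case/orP: (labX _ (xsX i.+1)) => /eqP->)
  ltac:(by move=> i; rewrite /= !vb0; case/orP: (labX _ (xsX i)) => /eqP->;
    case/orP: (labX _ (xsX i.+1)) => /eqP->)
  ltac:(by rewrite /= Hm; clear; lia).
have [m1 Hm1] := cong NN 0%N; rewrite vN laby in Hm1.
have Rt := @lift_window 0 (fun j => l NN j) (fun j => lab (v NN j)) m M
  (fun j => cong NN j) (fun j => lab4 _) (fun j => lj NN j)
  ltac:(by move=> j; rewrite /= !vN laby) ltac:(by move=> j; rewrite /= !vN laby)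
  ltac:(by move: B; rewrite /= Hm1; clear; lia).
have [m2 Hm2] := cong NN M; rewrite vN laby in Hm2.
have L := @lift_window 0 (fun j => l 0%N j) (fun j => lab (v 0%N j)) (m - 1) M
  (fun j => cong 0%N j) (fun j => lab4 _) (fun j => lj 0%N j)
  ltac:(by move=> j; rewrite /= !v0 labx) ltac:(by move=> j; rewrite /= !v0 labx)
  ltac:(by rewrite /= Hm; clear; lia).
have [m3 Hm3] := cong 0%N M; rewrite v0 labx in Hm3.
(* Points of the [Y]-chain labelled 0 or 1 lie in both [X] and [Y], the former in [P] and the latter
   in [Q]; these sets are too far apart for a single step. So the top row cannot pass directly
   between 0 and 1. *)
have ysPQ i i' : lab (ys i) = 0 -> lab (ys i') = 1 -> ball (ys i) e' (ys i') -> False.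
  rewrite /lab.
  have [Xi|nXi] := asboolP (X (ys i)); last by case: ifP.
  have [ni _|//] := asboolP (nearP (ys i)).
  have [Xi'|nXi'] := asboolP (X (ys i')); last by case: ifP.
  have [//|ni' _] := asboolP (nearP (ys i')).
  have [Pi|/Qnear Qi] := XYPQ _ (conj Xi (ysY i)); last by exfalso; apply: Qi => //; exact: XD.
  have [/Pnear Pi'|Qi'] := XYPQ _ (conj Xi' (ysY i')); first by exfalso; apply: ni'; apply: Pi'; exact: XD.
  move=> bb; apply: (sP (ys i) (ys i')); [by split=> //; exact: XD|by split=> //; exact: XD|].
  apply: le_ball bb; lra.
have top i i' : ball (ys i) e' (ys i') ->
    ~~ ((4 %| lab (ys i) - 0)%Z && (4 %| lab (ys i') - 0 - 1)%Z).
  move=> bb; apply/negP => /andP[H1]; rewrite -addrA -opprD => H2; apply: (ysPQ i i' _ _ bb).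
    exact: (@mod4_eq _ 0 0 (lab4 _) H1).
  exact: (@mod4_eq _ _ 1 (lab4 _) H2).
have TT := @lift_window 0 (fun i => l i M) (fun i => lab (v i M)) (m3 - 1) NN
  (fun i => cong i M) (fun i => lab4 _) (fun i => li i M)
  ltac:(by move=> i; rewrite /= !vtM; apply: top; exact: ysb)
  ltac:(by move=> i; rewrite /= !vtM; apply: top; apply: ball_sym; exact: ysb)
  ltac:(by rewrite /= Hm3; clear; lia).
move: Rt L TT B; rewrite /= Hm1 Hm2 Hm3; clear; lia.
Unshelve. all: by end_near. Qed.

End disc.

(** * Crossing chords *)

Section crossing.
Variable R : realType.
Notation pt := (R * R)%type.

Definition dot (u v : pt) : R := u.1 * v.1 + u.2 * v.2.
Definition det (u v : pt) : R := u.1 * v.2 - u.2 * v.1.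
Definition psub (u v : pt) : pt := (u.1 - v.1, u.2 - v.2).

Lemma circ_dot_lt1 (a b : pt) : circ a -> circ b -> a <> b -> dot a b < 1.
Proof.
case: a b => [a1 a2] [b1 b2]; rewrite /circ /dot /= => Ha Hb ab.
rewrite ltNge; apply/negP => H; apply: ab.
have E : (a1 - b1) ^+ 2 + (a2 - b2) ^+ 2 = 2 - 2 * (a1 * b1 + a2 * b2).
  by rewrite -[2](_ : 1 + 1 = _)// -[X in X + _ - _]Ha -[X in _ + X - _]Hb; ring.
have [s1 s2] := (sqr_ge0 (a1 - b1), sqr_ge0 (a2 - b2)).
have /eqP : (a1 - b1) ^+ 2 = 0 by apply/eqP; rewrite eq_le s1 andbT; lra.
have /eqP : (a2 - b2) ^+ 2 = 0 by apply/eqP; rewrite eq_le s2 andbT; lra.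
by rewrite !sqrf_eq0 !subr_eq0 => /eqP-> /eqP->.
Qed.

Lemma disc_dot (a z : pt) : disc a -> disc z -> -1 <= dot a z <= 1.
Proof.
case: a z => [a1 a2] [b1 b2]; rewrite /disc /dot /= => Ha Hb.
have := sqr_ge0 (a1 - b1); have := sqr_ge0 (a2 - b2).
have := sqr_ge0 (a1 + b1); have := sqr_ge0 (a2 + b2).
by rewrite !expr2 in Ha Hb * => *; apply/andP; split; nra.
Qed.

Lemma unit_sub (x y : R) : -1 <= x <= 1 -> -1 <= y <= 1 -> `|x - y| <= 2.
Proof.
by move=> /andP[x0 x1] /andP[y0 y1]; rewrite ler_norml; apply/andP; split; lra.
Qed.

Lemma straddle (x y d : R) : 0 <= x -> y < 0 -> `|x - y| < d -> `|x| < d /\ `|y| < d.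
Proof.
by move=> x0 y0; rewrite !ltr_norml => /andP[h1 h2]; split; apply/andP; split; lra.
Qed.

Lemma straddle2 (x y x' y' d : R) : 0 <= d -> `|x - x'| < d -> `|y - y'| < d ->
  (0 <= x) != (0 <= x') -> (0 <= y) != (0 <= y') -> `|x| + `|y| < 2 * d.
Proof.
have aux (u u' : R) : `|u - u'| < d -> (0 <= u) != (0 <= u') -> `|u| < d.
  move=> H; have [u0|u0] := leP 0 u; have [u'0|u'0] := leP 0 u' => // _.
    by have [] := straddle u0 u'0 H.
  by move: H; rewrite distrC => /(straddle u'0 u0)[].
move=> d0 xx yy /(aux _ _ xx) + /(aux _ _ yy); lra.
Qed.

Section chords.
Variables a b a1 b1 : pt.
Hypotheses (Ca : circ a) (Cb : circ b) (Ca1 : circ a1) (Cb1 : circ b1).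
Hypothesis la : 0 < det (psub b1 a1) (psub a a1).
Hypothesis lb : det (psub b1 a1) (psub b a1) < 0.
Let eu := psub b a.
Let ev := psub b1 a1.
Let D := det eu ev.

Let D_gt0 : 0 < D.
Proof. by move: la lb; rewrite /D /det /eu /ev /psub /=; lra. Qed.

Let wu : 0 < 1 - dot a b.
Proof.
rewrite subr_gt0; apply: circ_dot_lt1 => // ab.
by move: la lb; rewrite ab; lra.
Qed.

Let wv : 0 < 1 - dot a1 b1.
Proof.
rewrite subr_gt0; apply: circ_dot_lt1 => // ab.
by move: la; rewrite ab /det /psub /= !subrr !mul0r subr0 ltxx.
Qed.

(* The chords [a b] and [a1 b1] meet inside the disc, so each separates the ends of the other. *)
Let chords_cross : det eu (psub a1 a) < 0 /\ 0 < det eu (psub b1 a).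
Proof.
have D0 : D != 0 by rewrite gt_eqF.
(* [s] and [t] locate the intersection of the two lines on each chord. Comparing the two expressions
   for its squared norm gives [s * (1 - s) * (1 - dot a b) = t * (1 - t) * (1 - dot a1 b1)], so
   [0 < s < 1] forces [0 < t < 1]. *)
pose s := det ev (psub a a1) / D; pose t := - det eu (psub a1 a) / D.
have s0 : 0 < s by rewrite divr_gt0.
have s1 : s < 1.
  by rewrite ltr_pdivrMr// mul1r; move: lb; rewrite /D /det /eu /ev /psub /=; lra.
have E1 : a.1 + s * eu.1 = a1.1 + t * ev.1.
  by rewrite /s /t; apply: (mulfI D0); rewrite /eu /ev !mulrDr ![D * (_ / D * _)]mulrA
    ![D * (_ / D)]mulrCA ?divff// !mulr1 /D /eu /ev /det /psub /=; ring.
have E2 : a.2 + s * eu.2 = a1.2 + t * ev.2.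
  by rewrite /s /t; apply: (mulfI D0); rewrite /eu /ev !mulrDr ![D * (_ / D * _)]mulrA
    ![D * (_ / D)]mulrCA ?divff// !mulr1 /D /eu /ev /det /psub /=; ring.
have aux (c d : pt) r : circ c -> circ d -> (c.1 + r * (d.1 - c.1)) ^+ 2 +
    (c.2 + r * (d.2 - c.2)) ^+ 2 = 1 - 2 * (r * (1 - r)) * (1 - dot c d).
  rewrite /circ /= => Hc Hd.
  have -> : (c.1 + r * (d.1 - c.1)) ^+ 2 + (c.2 + r * (d.2 - c.2)) ^+ 2 =
    (1 - r) ^+ 2 * (c.1 ^+ 2 + c.2 ^+ 2) + r ^+ 2 * (d.1 ^+ 2 + d.2 ^+ 2) +
    2 * (r * (1 - r)) * dot c d by rewrite /dot; ring.
  by rewrite Hc Hd; ring.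
have E : s * (1 - s) * (1 - dot a b) = t * (1 - t) * (1 - dot a1 b1).
  have := aux a b s Ca Cb; rewrite -/(psub b a).1 E1.
  rewrite [a.2 + _]E2 aux// => H.
  move: H; move: (dot a b) (dot a1 b1) => x y H.
  have : 2 * (s * (1 - s)) * (1 - x) = 2 * (t * (1 - t)) * (1 - y) by lra.
  by rewrite -!mulrA => /(mulfI (_ : 2 != 0 :> R)) ->.
have tt : 0 < t * (1 - t).
  have : 0 < s * (1 - s) * (1 - dot a b) by apply: mulr_gt0 => //; apply: mulr_gt0 => //; rewrite subr_gt0.
  by rewrite E pmulr_lgt0.
have t0 : 0 < t by nra.
have t1 : t < 1 by nra.
split.
  by move: t0; rewrite pmulr_lgt0 ?invr_gt0// oppr_gt0.
move: t1; rewrite ltr_pdivrMr// mul1r.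
by rewrite /D /det /eu /ev /psub /=; lra.
Qed.

(** [P] and [Q] are coordinates in the basis [eu], [ev] scaled by [D]: by Cramer's rule, [D] times
    [F] is [P F] times [eu] plus [Q F] times [ev]. *)
Let P (F : pt) := det F ev.
Let Q (F : pt) := det eu F.

Let PQ_bound (F : pt) (r : R) : ~ (`|F.1| < r /\ `|F.2| < r) ->
  D * r <= 2 * (`|P F| + `|Q F|).
Proof.
move=> nF.
have [b1l b1u b2l b2u] := disc_coord (circ_disc Cb).
have [a1l a1u a2l a2u] := disc_coord (circ_disc Ca).
have [c1l c1u c2l c2u] := disc_coord (circ_disc Ca1).
have [d1l d1u d2l d2u] := disc_coord (circ_disc Cb1).
have aux (x y z w f : R) : `|y| <= 2 -> `|w| <= 2 -> D * f = x * y + z * w ->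
    D * `|f| <= 2 * (`|x| + `|z|).
  move=> y2 w2 E; rewrite -(ger0_norm (ltW D_gt0)) -normrM E.
  apply: le_trans (ler_normD _ _) _; rewrite !normrM.
  by rewrite mulrDr; apply: lerD; rewrite [leRHS]mulrC ler_wpM2l.
have E1 : D * F.1 = P F * eu.1 + Q F * ev.1.
  by rewrite /D /P /Q /det /eu /ev /psub /=; ring.
have E2 : D * F.2 = P F * eu.2 + Q F * ev.2.
  by rewrite /D /P /Q /det /eu /ev /psub /=; ring.
have [F1|F1] := leP r `|F.1|.
  apply: (le_trans (ler_wpM2l (ltW D_gt0) F1)); apply: aux E1 => //;
  by rewrite ler_norml /eu /ev /psub /=; apply/andP; split; lra.
have [F2|F2] := leP r `|F.2|; last by exfalso; apply: nF.
apply: (le_trans (ler_wpM2l (ltW D_gt0) F2)); apply: aux E2 => //;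
by rewrite ler_norml /eu /ev /psub /=; apply/andP; split; lra.
Qed.

Let PQ_step (F F' : pt) (e : R) : 0 < e -> `|F.1 - F'.1| < 2 * e -> `|F.2 - F'.2| < 2 * e ->
  `|P F - P F'| < 8 * e /\ `|Q F - Q F'| < 8 * e.
Proof.
move=> e0 H1 H2.
have [b1l b1u b2l b2u] := disc_coord (circ_disc Cb).
have [a1l a1u a2l a2u] := disc_coord (circ_disc Ca).
have [c1l c1u c2l c2u] := disc_coord (circ_disc Ca1).
have [d1l d1u d2l d2u] := disc_coord (circ_disc Cb1).
have aux (x y f g : R) : `|x| <= 2 -> `|y| <= 2 -> `|f| < 2 * e -> `|g| < 2 * e ->
    `|f * x - g * y| < 8 * e.
  move=> x2 y2 f2 g2; apply: le_lt_trans (ler_normB _ _) _; rewrite !normrM.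
  have : `|f| * `|x| <= `|f| * 2 by rewrite ler_wpM2l.
  have : `|g| * `|y| <= `|g| * 2 by rewrite ler_wpM2l.
  lra.
split.
  have -> : P F - P F' = (F.1 - F'.1) * ev.2 - (F.2 - F'.2) * ev.1.
    by rewrite /P /det; ring.
  by apply: aux => //; rewrite ler_norml /ev /psub /=; apply/andP; split; lra.
have -> : Q F - Q F' = (F.2 - F'.2) * eu.1 - (F.1 - F'.1) * eu.2.
  by rewrite /Q /det; ring.
by apply: aux => //; rewrite ler_norml /eu /psub /=; apply/andP; split; lra.
Qed.

(** The differences of the points of two chains fill a grid of vectors bounded away from zero,
    labelled by their quadrant in the basis [eu], [ev]. The crossing of the chords fixes the labels
    at the corners, and convexity of the disc forbids one transition on each side, so [grid_winding]
    applies. *)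
Lemma crossing (r : R) : 0 < r -> exists2 e : R, 0 < e & forall A B : set pt,
  A `<=` (@disc R) -> B `<=` (@disc R) -> (forall z w, A z -> B w -> ~ ball z r w) ->
  reach A e a b -> reach B e a1 b1 -> False.
Proof.
move=> r0; pose w := Num.min (1 - dot a b) (1 - dot a1 b1).
have w0 : 0 < w by rewrite lt_min wu wv.
have wwu : w <= 1 - dot a b by rewrite ge_min lexx.
have wwv : w <= 1 - dot a1 b1 by rewrite ge_min lexx orbT.
have w2 : w <= 2.
  by have /andP[] := disc_dot (circ_disc Ca) (circ_disc Cb); lra.
(* One step changes [p] and [q] by less than [8 * e]. Since [w <= 2] gives [64 * e <= D * r], both
   cannot change sign at once, so opposite quadrants are never adjacent. The factor [w] serves the
   sides of the grid in [nsm]. *)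
pose e := D * r * w / 128.
have e0 : 0 < e by rewrite divr_gt0// !mulr_gt0.
have e128 : 128 * e = D * r * w by rewrite mulrC divfK.
have Dr0 : 0 < D * r by rewrite mulr_gt0.
have e64 : 64 * e <= D * r.
  have : D * r * w <= D * r * 2 by rewrite ler_wpM2l// ltW.
  lra.
exists e => // A B AD BD AB rA rB.
have [xs [N [xs0 xsN xsA xsb]]] := reach_seq e0 rA.
have [ys [M [ys0 ysM ysB ysb]]] := reach_seq e0 rB.
pose F i j := psub (xs i) (ys j).
pose p i j := P (F i j); pose q i j := Q (F i j).
have big i j : D * r <= 2 * (`|p i j| + `|q i j|) by apply: PQ_bound; exact: AB.
have stp i j i' j' : (i' == i) || (i' == i.+1) || (i == i'.+1) ->
    (j' == j) || (j' == j.+1) || (j == j'.+1) ->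
    `|p i j - p i' j'| < 8 * e /\ `|q i j - q i' j'| < 8 * e.
  move=> ii jj.
  have xb : ball (xs i) e (xs i').
    by move: ii => /orP[/orP[]|] /eqP->; [exact: ballxx|exact: xsb|exact/ball_sym/xsb].
  have yb : ball (ys j) e (ys j').
    by move: jj => /orP[/orP[]|] /eqP->; [exact: ballxx|exact: ysb|exact/ball_sym/ysb].
  have [x1 x2] := (pball _ _ _).1 xb; have [y1 y2] := (pball _ _ _).1 yb.
  have aux (x y x' y' : R) : `|x - x'| < e -> `|y - y'| < e -> `|x - y - (x' - y')| < 2 * e.
    move=> xx yy; have -> : x - y - (x' - y') = (x - x') - (y - y') by ring.
    by apply: le_lt_trans (ler_normB _ _) _; lra.
  by apply: PQ_step => //; exact: aux.
(* On a side, a coordinate [t] that changes sign is below [8 * e], and the other one, of absolute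
   value [z], satisfies [w * z <= 2 * |t|]. Together they give [D * r * w <= 8 * |t| < 64 * e],
   against [e128]. *)
have nsm (i j : nat) (z t : R) : 0 <= z -> w * z <= `|t| * 2 -> `|t| < 8 * e ->
    `|p i j| + `|q i j| <= z + `|t| -> False.
  move=> z0 wz t8 pq.
  have H1 := big i j.
  have H2 : D * r * w <= 2 * (z + `|t|) * w by rewrite ler_pM2r//; lra.
  have : `|t| * w <= `|t| * 2 by rewrite ler_wpM2l.
  lra.
pose lab i j : int := if 0 <= p i j then (if 0 <= q i j then 0 else 3)
  else (if 0 <= q i j then 1 else 2).
have lab4 i j : (0 <= lab i j < 4)%R by rewrite /lab; case: ifP; case: ifP.
have labo i j i' j' : (i' == i) || (i' == i.+1) || (i == i'.+1) ->
    (j' == j) || (j' == j.+1) || (j == j'.+1) -> ~~ opposite (lab i j) (lab i' j').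
  move=> ii jj; apply/negP => opp; have [hp hq] := stp _ _ _ _ ii jj.
  have : D * r <= 2 * (`|p i j| + `|q i j|) := big i j.
  suff : `|p i j| + `|q i j| < 2 * (8 * e) by move: e64 Dr0 => ? ?; lra.
  apply: straddle2 hp hq _ _; first by rewrite mulr_ge0// ltW.
    by move: opp; rewrite /lab; case: ifP; case: ifP; case: ifP; case: ifP.
  by move: opp; rewrite /lab; case: ifP; case: ifP; case: ifP; case: ifP.
have [mu1 mu2] := chords_cross.
have lab_sgn i j : [/\ lab i j = 0 -> 0 <= p i j /\ 0 <= q i j,
    lab i j = 1 -> p i j < 0 /\ 0 <= q i j, lab i j = 2 -> p i j < 0 /\ q i j < 0 &
    lab i j = 3 -> 0 <= p i j /\ q i j < 0].
  by rewrite /lab; case: leP => H1; case: leP => H2.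
have dotD i j (c : pt) : D * dot c (F i j) = p i j * dot c eu + q i j * dot c ev.
  by rewrite /p /q /P /Q /D /dot /det /F /eu /ev /psub /=; ring.
have dotB (c : pt) : disc c -> `|dot c eu| <= 2 /\ `|dot c ev| <= 2.
  move=> Dc; have [H1 H2] := (disc_dot Dc (circ_disc Ca), disc_dot Dc (circ_disc Cb)).
  have [H3 H4] := (disc_dot Dc (circ_disc Ca1), disc_dot Dc (circ_disc Cb1)).
  have -> : dot c eu = dot c b - dot c a by rewrite /dot /eu /psub /=; ring.
  have -> : dot c ev = dot c b1 - dot c a1 by rewrite /dot /ev /psub /=; ring.
  by split; apply: unit_sub.
have absb (t c : R) : `|c| <= 2 -> `|t * c| <= `|t| * 2.
  by move=> c2; rewrite normrM ler_wpM2l.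
have supp (c z : pt) : circ c -> disc z -> 0 <= dot c (psub c z).
  move=> Cc Dz; have /andP[_ H] := disc_dot (circ_disc Cc) Dz.
  have -> : dot c (psub c z) = c.1 ^+ 2 + c.2 ^+ 2 - dot c z by rewrite /dot /psub /=; ring.
  by rewrite Cc subr_ge0.
have supp' (c z : pt) : circ c -> disc z -> dot c (psub z c) <= 0.
  move=> Cc Dz; have := supp _ _ Cc Dz.
  by rewrite /dot /psub /=; lra.
have dab : dot a eu = - (1 - dot a b).
  by rewrite -[1]Ca /dot /eu /psub /=; ring.
have dba : dot b eu = 1 - dot a b.
  by rewrite -[1]Cb /dot /eu /psub /=; ring.
have da1 : dot a1 ev = - (1 - dot a1 b1).
  by rewrite -[1]Ca1 /dot /ev /psub /=; ring.
have db1 : dot b1 ev = 1 - dot a1 b1.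
  by rewrite -[1]Cb1 /dot /ev /psub /=; ring.
(* The tangent at [a] supports the disc, so [a - ys j] has nonnegative product with [a]. Expanding
   it in the basis bounds a positive [p] by a multiple of [|q|]. The other three ends of the chords
   give the analogous bounds. *)
have HL j : p 0%N j * (1 - dot a b) <= `|q 0%N j| * 2.
  have [_ /(absb (q 0%N j))] := dotB a (circ_disc Ca).
  have := mulr_ge0 (ltW D_gt0) (supp _ _ Ca (BD _ (ysB j))).
  have -> : psub a (ys j) = F 0%N j by rewrite /F xs0.
  rewrite dotD dab ler_norml => H1 /andP[H2 H3]; lra.
have HR j : - p N j * (1 - dot a b) <= `|q N j| * 2.
  have [_ /(absb (q N j))] := dotB b (circ_disc Cb).
  have := mulr_ge0 (ltW D_gt0) (supp _ _ Cb (BD _ (ysB j))).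
  have -> : psub b (ys j) = F N j by rewrite /F xsN.
  rewrite dotD dba ler_norml => H1 /andP[H2 H3]; lra.
have HB i : - q i 0%N * (1 - dot a1 b1) <= `|p i 0%N| * 2.
  have [/(absb (p i 0%N)) + _] := dotB a1 (circ_disc Ca1).
  have := mulr_ge0_le0 (ltW D_gt0) (supp' _ _ Ca1 (AD _ (xsA i))).
  have -> : psub (xs i) a1 = F i 0%N by rewrite /F ys0.
  rewrite dotD da1 ler_norml => H1 /andP[H2 H3]; lra.
have HT i : q i M * (1 - dot a1 b1) <= `|p i M| * 2.
  have [/(absb (p i M)) + _] := dotB b1 (circ_disc Cb1).
  have := mulr_ge0_le0 (ltW D_gt0) (supp' _ _ Cb1 (AD _ (xsA i))).
  have -> : psub (xs i) b1 = F i M by rewrite /F ysM.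
  rewrite dotD db1 ler_norml => H1 /andP[H2 H3]; lra.
have noL j j' : (j' == j.+1) || (j == j'.+1) -> lab 0%N j = 3 -> lab 0%N j' = 0 -> False.
  move=> jj l3 l0; have [_ _ _ /(_ l3)[p0 q0]] := lab_sgn 0%N j.
  have [/(_ l0)[p0' q0'] _ _ _] := lab_sgn 0%N j'.
  have [_] := stp 0%N j' 0%N j isT ltac:(by rewrite -orbA orbC in jj *; rewrite jj ?orbT).
  move=> /(straddle q0' q0)[_ q8]; apply: (@nsm 0%N j (p 0%N j) (q 0%N j)) => //.
    by apply: le_trans (HL j); rewrite mulrC ler_wpM2l.
  by rewrite (ger0_norm p0).
have noR j j' : (j' == j.+1) || (j == j'.+1) -> lab N j = 2 -> lab N j' = 1 -> False.
  move=> jj l3 l0; have [_ _ /(_ l3)[p0 q0] _] := lab_sgn N j.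
  have [_ /(_ l0)[p0' q0'] _ _] := lab_sgn N j'.
  have [_] := stp N j' N j ltac:(by rewrite eqxx) ltac:(by rewrite -orbA orbC in jj *; rewrite jj ?orbT).
  move=> /(straddle q0' q0)[_ q8]; apply: (@nsm N j (- p N j) (q N j)) => //.
  - by rewrite oppr_ge0 ltW.
  - by apply: le_trans (HR j); rewrite mulrC ler_wpM2l// oppr_ge0 ltW.
  - by rewrite (ltr0_norm p0).
have noB i i' : (i' == i.+1) || (i == i'.+1) -> lab i 0%N = 2 -> lab i' 0%N = 3 -> False.
  move=> ii l3 l0; have [_ _ /(_ l3)[p0 q0] _] := lab_sgn i 0%N.
  have [_ _ _ /(_ l0)[p0' q0']] := lab_sgn i' 0%N.
  have [+ _] := stp i' 0%N i 0%N ltac:(by rewrite -orbA orbC in ii *; rewrite ii ?orbT) isT.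
  move=> /(straddle p0' p0)[_ p8]; apply: (@nsm i 0%N (- q i 0%N) (p i 0%N)) => //.
  - by rewrite oppr_ge0 ltW.
  - by apply: le_trans (HB i); rewrite mulrC ler_wpM2l// oppr_ge0 ltW.
  - by rewrite (ltr0_norm q0) addrC.
have noT i i' : (i' == i.+1) || (i == i'.+1) -> lab i M = 1 -> lab i' M = 0 -> False.
  move=> ii l3 l0; have [_ /(_ l3)[p0 q0] _ _] := lab_sgn i M.
  have [/(_ l0)[p0' q0'] _ _ _] := lab_sgn i' M.
  have [+ _] := stp i' M i M ltac:(by rewrite -orbA orbC in ii *; rewrite ii ?orbT) ltac:(by rewrite eqxx).
  move=> /(straddle p0' p0)[_ p8]; apply: (@nsm i M (q i M) (p i M)) => //.
  - by apply: le_trans (HT i); rewrite mulrC ler_wpM2l.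
  - by rewrite (ger0_norm q0) addrC.
have pq00 : lab 0%N 0%N = 1.
  have pE : p 0%N 0%N = - det ev (psub a a1).
    by rewrite /p /F xs0 ys0 /P /det /ev /psub /=; ring.
  have qE : q 0%N 0%N = - det eu (psub a1 a).
    by rewrite /q /F xs0 ys0 /Q /det /eu /psub /=; ring.
  by rewrite /lab pE qE leNgt oppr_lt0 la /= oppr_ge0 ltW.
have pqN0 : lab N 0%N = 0.
  have pE : p N 0%N = - det ev (psub b a1).
    by rewrite /p /F xsN// ys0 /P /det /ev /psub /=; ring.
  have qE : q N 0%N = - det eu (psub a1 a).
    by rewrite /q /F xsN// ys0 /Q /det /eu /psub /=; ring.
  by rewrite /lab pE qE !oppr_ge0 !ltW.
have pqNM : lab N M = 3.
  have pE : p N M = - det ev (psub b a1).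
    by rewrite /p /F xsN// ysM// /P /det /ev /psub /=; ring.
  have qE : q N M = - det eu (psub b1 a).
    by rewrite /q /F xsN// ysM// /Q /det /eu /psub /=; ring.
  by rewrite /lab pE qE oppr_ge0 ltW//= leNgt oppr_lt0 mu2.
have pq0M : lab 0%N M = 2.
  have pE : p 0%N M = - det ev (psub a a1).
    by rewrite /p /F xs0 ysM// /P /det /ev /psub /=; ring.
  have qE : q 0%N M = - det eu (psub b1 a).
    by rewrite /q /F xs0 ysM// /Q /det /eu /psub /=; ring.
  by rewrite /lab pE qE !(leNgt 0) !oppr_lt0 la mu2.
apply: (grid_winding lab4 _ noL noB noR noT pq00 pqN0 pqNM pq0M) => i j.
by apply/and5P; split; [| | | |apply/andP; split]; apply: labo; rewrite !eqxx ?orbT.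
Qed.

End chords.
End crossing.

(** * Closed decompositions of the disc *)

Section separation.
Variable R : realType.
Notation pt := (R * R)%type.

Lemma affine_cvg (a b t : R) : (fun s : R => a + s * b) @ t --> a + t * b.
Proof. by apply: cvgD; [exact: cvg_cst|apply: cvgM; [exact: cvg_id|exact: cvg_cst]]. Qed.

Lemma cvg_pt (T : Type) (F : set_system T) (FF : Filter F) (f : T -> pt) (z : pt) :
  (fun s => (f s).1) @ F --> z.1 -> (fun s => (f s).2) @ F --> z.2 -> f @ F --> z.
Proof.
move=> c1 c2; have -> : f = (fun s => ((f s).1, (f s).2)) by apply/funext => s; exact: ptE.
by rewrite [z]ptE; exact: (cvg_pair c1 c2).
Qed.

Lemma path_reach (A : set pt) (phi : R -> pt) (e : R) : 0 < e ->
  (forall t : R, 0 <= t <= 1 -> phi @ t --> phi t) ->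
  (forall t : R, 0 <= t <= 1 -> A (phi t)) -> reach A e (phi 0) (phi 1).
Proof.
move=> e0 cphi phiA.
have kI : connected (phi @` `[0, 1]).
  apply: connected_continuous_connected; first exact: segment_connected.
  by apply: continuous_in_subspaceT => t; rewrite inE /= in_itv /= => /cphi.
apply: (reach_sub _ (lexx _) (connected_econn e0 kI _ _)).
- by move=> _ [t + <-]; rewrite /= in_itv /= => /phiA.
- by exists 0 => //=; rewrite in_itv /= lexx ler01.
- by exists 1 => //=; rewrite in_itv /= lexx ler01.
Qed.

Definition arc (a b : pt) : set pt :=
  @circ R `&` [set z | 0 <= det (psub b a) (psub z a)].

Lemma closed_arc a b : closed (arc a b).
Proof.
apply: closedI; first exact: closed_circ.
have -> : [set z | 0 <= det (psub b a) (psub z a)] =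
    (fun z : pt => det (psub b a) (psub z a)) @^-1` [set x | 0 <= x] by [].
apply: preimage_closed; last exact: closed_ge.
move=> z _; rewrite /det /psub /=; apply: cvgB.
  by apply: cvgM; [exact: cvg_cst|apply: cvgB; [exact: cvg_snd|exact: cvg_cst]].
by apply: cvgM; [exact: cvg_cst|apply: cvgB; [exact: cvg_fst|exact: cvg_cst]].
Qed.

(* [d |-> a - 2 <a, d> / <d, d> d] sends a direction to the second point of the circle on the
   line through [a]; the arc is the image of a half-plane sector of directions. *)
Lemma arc_reach a b z (e : R) : circ a -> circ b -> a <> b -> arc a b z -> 0 < e ->
  reach (arc a b) e z b.
Proof.
move=> Ca Cb ab [Cz Lz] e0.
pose ev := psub b a.
pose second (d : pt) : pt := (a.1 - 2 * (dot a d / dot d d) * d.1, a.2 - 2 * (dot a d / dot d d) * d.2).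
have aev : dot a ev < 0.
  have := circ_dot_lt1 Ca Cb ab; rewrite -[1]Ca /dot /ev /psub /=; lra.
have second_circ d : dot d d != 0 -> circ (second d).
  move=> d0; rewrite /circ /second /=.
  set k := dot a d / dot d d.
  have kd : k * dot d d = dot a d by rewrite divfK.
  have -> : (a.1 - 2 * k * d.1) ^+ 2 + (a.2 - 2 * k * d.2) ^+ 2 =
    (a.1 ^+ 2 + a.2 ^+ 2) - 4 * k * (dot a d - k * dot d d) by rewrite /dot; ring.
  by rewrite kd subrr mulr0 subr0.
have second_arc d : dot d d != 0 -> 0 < dot d d -> dot a d <= 0 -> 0 <= det ev d -> arc a b (second d).
  move=> d0 dp ad evd; split; first exact: second_circ.
  rewrite /= -/ev.
  have -> : det ev (psub (second d) a) = - (2 * (dot a d / dot d d)) * det ev d.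
    by rewrite /det /second /psub /=; ring.
  rewrite mulr_ge0// oppr_ge0 pmulr_rle0//.
  by rewrite pmulr_lle0 ?invr_gt0.
have second_psub w : circ w -> dot (psub w a) (psub w a) != 0 -> second (psub w a) = w.
  move=> Cw w0.
  have E : dot a (psub w a) / dot (psub w a) (psub w a) = - (1 / 2).
    apply: (mulIf w0); rewrite divfK//.
    have : dot (psub w a) (psub w a) = (w.1 ^+ 2 + w.2 ^+ 2) - (a.1 ^+ 2 + a.2 ^+ 2) - 2 * dot a (psub w a).
      by rewrite /dot /psub /=; ring.
    by rewrite Cw Ca => ->; field.
  by rewrite [RHS]ptE /second E /psub /=; congr pair; field.
(* For [z] different from [a] the direction is [z - a]; for [z = a] it is the tangent, oriented
   towards the arc. *)
have [d [d0 da dev dz]] : exists d, [/\ 0 < dot d d, dot a d <= 0, 0 <= det ev d & second d = z].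
  have [za|za] := pselect (z = a).
    have ortho s : s ^+ 2 = 1 -> 0 <= s * det ev (- a.2, a.1) ->
        exists d, [/\ 0 < dot d d, dot a d <= 0, 0 <= det ev d & second d = z].
      move=> s1 sdet; exists (s * - a.2, s * a.1).
      have ad : dot a (s * - a.2, s * a.1) = 0 by rewrite /dot /=; ring.
      have dd : dot (s * - a.2, s * a.1) (s * - a.2, s * a.1) = s ^+ 2 * (a.1 ^+ 2 + a.2 ^+ 2).
        by rewrite /dot /=; ring.
      split.
      - by rewrite dd s1 Ca mulr1.
      - by rewrite ad.
      - by move: sdet; rewrite /det /=; lra.
      - by rewrite /second ad za [RHS]ptE; congr pair; ring.
    have [h|h] := leP 0 (det ev (- a.2, a.1)).
      by apply: (ortho 1); rewrite ?expr1n ?mul1r.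
    by apply: (ortho (-1)); rewrite ?sqrrN ?expr1n// mulN1r oppr_ge0 ltW.
  have dd : dot (psub z a) (psub z a) = 2 - 2 * dot a z.
    have -> : dot (psub z a) (psub z a) = (z.1 ^+ 2 + z.2 ^+ 2) + (a.1 ^+ 2 + a.2 ^+ 2) - 2 * dot a z.
      by rewrite /dot /psub /=; ring.
    by rewrite Cz Ca.
  have az : dot a z < 1 by apply: circ_dot_lt1 => // /esym.
  have dp : 0 < dot (psub z a) (psub z a) by rewrite dd; lra.
  exists (psub z a); split => //; last by apply: second_psub => //; rewrite gt_eqF.
  have -> : dot a (psub z a) = dot a z - (a.1 ^+ 2 + a.2 ^+ 2) by rewrite /dot /psub /=; ring.
  by rewrite Ca; lra.
have evev : 0 < dot ev ev.
  rewrite lt_def; apply/andP; split; last by rewrite /dot -!expr2 addr_ge0 ?sqr_ge0.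
  apply/eqP => E; suff [e1 e2] : ev.1 = 0 /\ ev.2 = 0 by move: aev; rewrite /dot e1 e2; lra.
  have s1 := sqr_ge0 ev.1; have s2 := sqr_ge0 ev.2; rewrite /dot -!expr2 in E.
  by split; apply/eqP; rewrite -sqrf_eq0 eq_le ?s1 ?s2 andbT; lra.
(* The segment from [d] to [ev] stays in the sector and avoids the origin, because [dot a] is
   negative on it for [t > 0] and [d] is nonzero. *)
pose D (t : R) : pt := (d.1 + t * (ev.1 - d.1), d.2 + t * (ev.2 - d.2)).
have aD t : dot a (D t) = (1 - t) * dot a d + t * dot a ev by rewrite /dot /=; ring.
have Dpos t : 0 <= t <= 1 -> 0 < dot (D t) (D t).
  move=> /andP[t0 t1]; rewrite lt_def; apply/andP; split; last by rewrite /dot -!expr2 addr_ge0 ?sqr_ge0.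
  apply/eqP => E.
  have [e1 e2] : (D t).1 = 0 /\ (D t).2 = 0.
    have s1 := sqr_ge0 (D t).1; have s2 := sqr_ge0 (D t).2; rewrite /dot -!expr2 in E.
    by split; apply/eqP; rewrite -sqrf_eq0 eq_le ?s1 ?s2 andbT; lra.
  have : dot a (D t) = 0 by rewrite /dot e1 e2; ring.
  rewrite aD; have [t00|tn0] := eqVneq t 0.
    by move: e1 e2 d0; rewrite /D t00 /= !mul0r !addr0 /dot => -> ->; rewrite !mul0r addr0 ltxx.
  have tp : 0 < t by rewrite lt_def tn0.
  have : (1 - t) * dot a d <= 0 by rewrite mulr_ge0_le0// subr_ge0.
  have : t * dot a ev < 0 by rewrite pmulr_rlt0.
  lra.
have := @path_reach (arc a b) (second \o D) e e0.
have -> : (second \o D) 0 = z.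
  by rewrite /= -dz; congr second; rewrite /D !mul0r !addr0 -ptE.
have -> : (second \o D) 1 = b.
  have -> : (second \o D) 1 = second (psub b a).
    by rewrite /=; congr second; rewrite /D !mul1r [RHS]ptE; congr pair; rewrite addrC subrK.
  by apply: second_psub => //; rewrite gt_eqF.
apply.
  move=> t t01.
  have c1 : (fun s => (D s).1) @ t --> (D t).1 by exact: affine_cvg.
  have c2 : (fun s => (D s).2) @ t --> (D t).2 by exact: affine_cvg.
  have cq : (fun s => 2 * (dot a (D s) / dot (D s) (D s))) @ t --> 2 * (dot a (D t) / dot (D t) (D t)).
    apply: cvgM; first exact: cvg_cst.
    apply: cvgM; first by apply: cvgD; apply: cvgM => //; exact: cvg_cst.
    apply: cvgV; first by rewrite gt_eqF// Dpos.
    by apply: cvgD; apply: cvgM.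
  by apply: cvg_pt; apply: cvgB; [exact: cvg_cst|apply: cvgM|exact: cvg_cst|apply: cvgM].
move=> t t01; have Dp := Dpos _ t01; have /andP[t0 t1] := t01.
apply: second_arc => //; first by rewrite gt_eqF.
  have : (1 - t) * dot a d <= 0 by rewrite mulr_ge0_le0// subr_ge0.
  have : t * dot a ev <= 0 by rewrite mulr_ge0_le0// ltW.
  rewrite aD; lra.
have -> : det ev (D t) = (1 - t) * det ev d by rewrite /det /=; ring.
by rewrite mulr_ge0// subr_ge0.
Qed.

Lemma arc_econn a b (e : R) : circ a -> circ b -> a <> b -> 0 < e -> econn e (arc a b).
Proof.
move=> Ca Cb ab e0 z w Az Aw; apply: (@reach_trans _ _ _ _ _ b).
  exact: arc_reach.
by apply: reach_sym; exact: arc_reach.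
Qed.

Lemma det_swap a b (z : pt) : det (psub a b) (psub z b) = - det (psub b a) (psub z a).
Proof. by rewrite /det /psub /=; ring. Qed.

(** [m / n] is the position of [c] on the line, with [a] at 0 and [b] at 1. The equation of the
    circle is quadratic in it, with exactly these roots. *)
Lemma circ_line (a b c : pt) : circ a -> circ b -> circ c -> a <> b ->
  det (psub b a) (psub c a) = 0 -> c = a \/ c = b.
Proof.
move=> Ca Cb Cc ab d0.
set u := psub c a in d0; set e := psub b a in d0.
set n := dot e e; set m := dot u e.
have n0 : n != 0.
  have -> : n = 2 * (1 - dot a b).
    have -> : n = (a.1 ^+ 2 + a.2 ^+ 2) + (b.1 ^+ 2 + b.2 ^+ 2) - 2 * dot a b.
      by rewrite /n /e /dot /psub /=; ring.
    by rewrite Ca Cb; ring.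
  by rewrite mulf_neq0// gt_eqF// subr_gt0 circ_dot_lt1.
have E1 : n * u.1 = m * e.1.
  have -> : n * u.1 = m * e.1 - det e u * e.2 by rewrite /n /m /det /dot; ring.
  by rewrite d0 mul0r subr0.
have E2 : n * u.2 = m * e.2.
  have -> : n * u.2 = m * e.2 + det e u * e.1 by rewrite /n /m /det /dot; ring.
  by rewrite d0 mul0r addr0.
have ae : 2 * dot a e = - n.
  have -> : 2 * dot a e = (b.1 ^+ 2 + b.2 ^+ 2) - (a.1 ^+ 2 + a.2 ^+ 2) - n.
    by rewrite /n /e /dot /psub /=; ring.
  by rewrite Ca Cb; ring.
have cu : 2 * dot a u + dot u u = 0.
  have -> : 2 * dot a u + dot u u = (c.1 ^+ 2 + c.2 ^+ 2) - (a.1 ^+ 2 + a.2 ^+ 2).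
    by rewrite /u /dot /psub /=; ring.
  by rewrite Ca Cc subrr.
have : n ^+ 2 * (m * (m - n)) = 0.
  have -> : n ^+ 2 * (m * (m - n)) = n * (n * m * (2 * dot a e) + m ^+ 2 * n) by rewrite ae; ring.
  have -> : n * m * (2 * dot a e) + m ^+ 2 * n =
      2 * n * (a.1 * (m * e.1) + a.2 * (m * e.2)) + ((m * e.1) ^+ 2 + (m * e.2) ^+ 2).
    by rewrite /n /dot; ring.
  rewrite -E1 -E2.
  have -> : 2 * n * (a.1 * (n * u.1) + a.2 * (n * u.2)) + ((n * u.1) ^+ 2 + (n * u.2) ^+ 2) =
      n ^+ 2 * (2 * dot a u + dot u u) by rewrite /dot; ring.
  by rewrite cu !mulr0.
move/eqP; rewrite !mulf_eq0 !(negPf n0) /= => /orP[/eqP m0|].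
  left; have /eqP := E1; have /eqP := E2; rewrite m0 !mul0r !mulf_eq0 (negPf n0) /=.
  rewrite /u /psub /= !subr_eq0 => /eqP e2 /eqP e1.
  by rewrite [LHS]ptE e1 e2 -ptE.
rewrite subr_eq0 => /eqP mn; right.
have /(mulfI n0) := etrans E1 (congr1 ( *%R^~ _) mn).
have /(mulfI n0) := etrans E2 (congr1 ( *%R^~ _) mn).
rewrite /u /e /psub /= => /addIr e2 /addIr e1.
by rewrite [LHS]ptE e1 e2 -ptE.
Qed.

Section decomposition.
Variable sim : pt -> pt -> Prop.
Hypothesis sim_disc : forall z w, sim z w -> disc z.
Hypothesis sim_refl : forall z, disc z -> sim z z.
Hypothesis sim_sym : forall z w, sim z w -> sim w z.
Hypothesis sim_trans : forall z w u, sim z w -> sim w u -> sim z u.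
Hypothesis sim_closed : closed_rel sim.
Hypothesis sim_conn : forall z e, disc z -> 0 < e -> econn e (sim z).
Hypothesis sim_circ : forall z, disc z -> exists2 c, circ c & sim z c.

Let class_closed z : closed (sim z).
Proof.
apply: closed_ucvg => a w aw aW.
by apply: (sim_closed (@cvg_cst _ z _ _ _) aW); exact: nearW.
Qed.

Let class_compact z : compact (sim z).
Proof.
apply: (@subclosed_compact _ (sim z) (@disc R)) => [||w zw]; [exact: class_closed|exact: compact_disc|].
exact: sim_disc (sim_sym zw).
Qed.

Let saturation (A : set pt) : set pt := [set z | exists2 w, A w & sim w z].

Let saturation_closed (A : set pt) : compact A -> closed (saturation A).
Proof.
move=> cA; apply: closed_ucvg => a z aA az.
have ex k : exists w, A w /\ sim w (a k) by have [w Aw wa] := aA k; exists w.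
have [b bA] := choice ex.
have [w Aw bw] : exists2 w, A w & b @ omega --> w.
  by apply: ucvg_ex cA _; apply: nearW => k; have [] := bA k.
exists w => //; apply: (sim_closed bw az).
by apply: nearW => k; have [] := bA k.
Qed.

Let saturation_econn (A : set pt) (e : R) : 0 < e -> A `<=` (@disc R) -> econn e A ->
  econn e (saturation A).
Proof.
move=> e0 AD kA z z' [w Aw wz] [w' Aw' wz'].
have sub u : A u -> sim u `<=` saturation A by move=> Au v uv; exists u.
apply: (@reach_trans _ _ _ _ _ w).
  by apply: (reach_sub (sub _ Aw) (lexx e)); apply: sim_conn => //; [exact: AD|exact/sim_refl/AD].
apply: (@reach_trans _ _ _ _ _ w').
  apply: (reach_sub _ (lexx e) (kA _ _ Aw Aw')) => u Au; exists u => //.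
  exact/sim_refl/AD.
by apply: (reach_sub (sub _ Aw') (lexx e)); apply: sim_conn => //; [exact: AD|exact/sim_refl/AD].
Qed.

(** Otherwise the saturations of the two arcs between [a] and [b], which are closed, chain-connected
    and cover the disc, would meet only in the classes of [x] and [y], contradicting
    unicoherence. *)
Let third_class x y a b : circ a -> circ b -> sim x a -> sim y b -> ~ sim x y ->
  exists t c d, [/\ ~ sim x t, ~ sim y t, arc a b c, arc b a d & sim t c /\ sim t d].
Proof.
move=> Ca Cb xa yb nxy; apply: contrapT => nex.
have ab : a <> b by move=> E; apply: nxy; apply: sim_trans xa _; rewrite E; exact: sim_sym.
have arcD c d : arc c d `<=` (@disc R) by move=> z [/circ_disc].
have arcK c d : compact (arc c d).
  by apply: (@subclosed_compact _ _ (@disc R)); [exact: closed_arc|exact: compact_disc|exact: arcD].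
have arcl c d : circ c -> arc c d c.
  by move=> Cc; split => //=; rewrite /det /psub /= !subrr !mulr0 subrr.
have arcr c d : circ d -> arc c d d.
  by move=> Cd; split => //=; rewrite /det /psub /= mulrC subrr.
apply: (@disc_unicoherent R (saturation (arc a b)) (saturation (arc b a)) (sim x) (sim y) x y).
- apply/seteqP; split => [z [[w _ wz]|[w _ wz]]|z Dz]; try exact: sim_disc (sim_sym wz).
  have [c Cc zc] := sim_circ Dz.
  have [h|h] := leP 0 (det (psub b a) (psub c a)); first by left; exists c => //; exact: sim_sym.
  right; exists c; last exact: sim_sym.
  by split => //=; rewrite det_swap oppr_ge0 ltW.
- exact: saturation_closed.
- exact: saturation_closed.
- exact: class_closed.
- exact: class_closed.
- apply/seteqP; split => // z [xz yz]; apply: nxy; exact: sim_trans xz (sim_sym yz).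
- move=> z [[c ac cz] [d ad dz]].
  have [xz|nxz] := pselect (sim x z); first by left.
  right; apply: contrapT => nyz; apply: nex; exists z, c, d.
  by do !split => //; exact: sim_sym.
- exact/sim_refl/(sim_disc xa).
- exact/sim_refl/(sim_disc yb).
- by exists a; [exact: arcl|exact: sim_sym].
- by exists a; [exact: arcr|exact: sim_sym].
- by exists b; [exact: arcr|exact: sim_sym].
- by exists b; [exact: arcl|exact: sim_sym].
- by move=> e e0; apply: saturation_econn => //; exact: arc_econn.
- by move=> e e0; apply: saturation_econn => //; apply: arc_econn => // /esym.
Qed.

Let away (K : set pt) (s : R) : set pt := @disc R `&` [set w | forall k, K k -> ~ ball k s w].

Let away_class x t : disc x -> disc t -> ~ sim x t ->
  exists2 s, 0 < s & sim x `<=` away (sim t) s.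
Proof.
move=> Dx Dt nxt.
have [|s s0 sP] := compact_apart (@pt_hausdorff R) (@class_compact t) (@class_compact x).
  apply/seteqP; split => // z [tz xz]; apply: nxt; exact: sim_trans xz (sim_sym tz).
exists s => // z xz; split; first exact: sim_disc (sim_sym xz).
by move=> k tk; exact: sP.
Qed.

Let away_sub K s s' : s <= s' -> away K s' `<=` away K s.
Proof.
move=> ss z [Dz zK]; split => // k Kk kz; apply: (zK _ Kk).
exact: le_ball kz.
Qed.

Let seg_reach K s z w (e : R) : 0 < s -> 0 < e -> disc z -> disc w ->
  away K (2 * s) z -> ball z s w -> reach (away K s) e z w.
Proof.
move=> s0 e0 Dz Dw [_ zK] /pball[zw1 zw2].
have seg0 : seg 0 z w = z by rewrite /seg [RHS]ptE; congr pair; ring.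
have seg1 : seg 1 z w = w by rewrite /seg [RHS]ptE; congr pair; ring.
have := @path_reach (away K s) (fun t => seg t z w) e e0; rewrite seg0 seg1; apply.
  move=> t _; apply: cvg_pt => /=; apply: cvgD;
    (apply: cvgM; last exact: cvg_cst) => //; apply: cvgB => //; exact: cvg_cst.
move=> t t01; split; first exact: seg_disc.
move=> k Kk kt; apply: (zK k Kk).
have -> : 2 * s = s + s by ring.
apply: ball_triangle kt _; apply/pball; have /andP[t0 t1] := t01.
have aux (a b : R) : `|a - b| < s -> `|(1 - t) * a + t * b - a| < s.
  move=> ab; have -> : (1 - t) * a + t * b - a = - (t * (a - b)) by ring.
  rewrite normrN normrM (ger0_norm t0); apply: le_lt_trans ab.
  by rewrite ler_piMl.
by split; exact: aux.
Qed.

(** The third class has points of the circle strictly on both sides of the chord joining the classes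
    of [x] and [y]. By [crossing], chains that avoid this class cannot lead from one to the
    other. *)
Lemma disc_separation x y : disc x -> disc y -> ~ sim x y ->
  exists t (G G' : set pt), [/\ disc t, @disc R = G `|` sim t `|` G', G x, G' y &
   [/\ closed (G `|` sim t), closed (G' `|` sim t), G `&` G' = set0, G `&` sim t = set0 &
   G' `&` sim t = set0]].
Proof.
move=> Dx Dy nxy.
have [a1 Ca1 xa1] := sim_circ Dx; have [b1 Cb1 yb1] := sim_circ Dy.
have [t [a [b [nxt nyt [Ca La] [Cb Lb] [ta tb]]]]] := third_class Ca1 Cb1 xa1 yb1 nxy.
have Dt : disc t := sim_disc ta.
have ab1 : a1 <> b1 by move=> E; apply: nxy; apply: sim_trans xa1 _; rewrite E; exact: sim_sym.
have det0 c : circ c -> sim t c -> det (psub b1 a1) (psub c a1) != 0.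
  move=> Cc tc; apply/eqP => /(circ_line Ca1 Cb1 Cc ab1)[E|E]; subst c.
    by apply: nxt; apply: sim_trans xa1 (sim_sym tc).
  by apply: nyt; apply: sim_trans yb1 (sim_sym tc).
have la : 0 < det (psub b1 a1) (psub a a1) by rewrite lt_def det0.
have lb : det (psub b1 a1) (psub b a1) < 0.
  by move: Lb; rewrite /= det_swap oppr_ge0 lt_def eq_sym det0.
pose K : set pt := sim t.
(* The distance [s] from [K] is common to chains of all scales, because [crossing] chooses its scale
   only after the distance. *)
pose G : set pt := [set z | [/\ disc z, ~ K z & exists2 s, 0 < s &
  forall e, 0 < e -> reach (away K s) e a1 z]].
pose G' : set pt := [set z | [/\ disc z, ~ K z & ~ G z]].
(* Within a small ball away from [K], segments can be added to chains, so membership in [G] is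
   locally constant off [K]. This makes both sides closed once [K] is added. *)
have openG z w s : 0 < s -> disc z -> disc w -> ~ K z -> ~ K w -> away K (2 * s) z -> ball z s w ->
    G z <-> G w.
  move=> s0 Dz Dw nKz nKw zK zw; split => -[_ _ [s' s'0 H]]; split => //.
    exists (Num.min s s'); first by rewrite lt_min s0.
    move=> e e0; apply: (@reach_trans _ _ _ _ _ z).
      by apply: (reach_sub _ (lexx e) (H _ e0)); apply: away_sub; rewrite ge_min lexx orbT.
    apply: (reach_sub _ (lexx e) (seg_reach s0 e0 Dz Dw zK zw)).
    by apply: away_sub; rewrite ge_min lexx.
  exists (Num.min s s'); first by rewrite lt_min s0.
  move=> e e0; apply: (@reach_trans _ _ _ _ _ w).
    by apply: (reach_sub _ (lexx e) (H _ e0)); apply: away_sub; rewrite ge_min lexx orbT.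
  apply: reach_sym; apply: (reach_sub _ (lexx e) (seg_reach s0 e0 Dz Dw zK zw)).
  by apply: away_sub; rewrite ge_min lexx.
have awayK z : disc z -> ~ K z -> exists2 s, 0 < s & away K (2 * s) z.
  move=> Dz nKz; have [s s0 sP] := away_class Dz Dt (fun zt => nKz (sim_sym zt)).
  exists (s / 2); first by rewrite divr_gt0.
  by rewrite mulrC divfK//; apply: sP; exact: sim_refl.
have closedGK (H : set pt) : H `<=` @disc R `\` K ->
    (forall z w s, 0 < s -> disc z -> disc w -> ~ K z -> ~ K w -> away K (2 * s) z -> ball z s w ->
      H w -> H z) -> closed (H `|` K).
  move=> HD HP; apply: closed_ucvg => a' z aH az.
  have Dz : disc z.
    apply: (ucvg_closed (@closed_disc R) az); apply: nearW => k.
    by have [/HD[]//|Kk] := aH k; exact: sim_disc (sim_sym Kk).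
  have [Kz|nKz] := pselect (K z); [by right|left].
  have [s s0 sz] := awayK _ Dz nKz.
  have [k zk] := omega_ex (ucvg_ball s0 az).
  have nKk : ~ K (a' k).
    move=> Kk; have [_ /(_ _ Kk)] := sz; apply; apply: ball_sym; apply: le_ball zk; lra.
  have [Hk|//] := aH k; have [Dk _] := HD _ Hk.
  exact: (HP z (a' k) s).
have nKx : ~ K x by move=> tx; apply: nxt; exact: sim_sym.
have nKy : ~ K y by move=> ty; apply: nyt; exact: sim_sym.
exists t, G, G'; split => //.
- apply/seteqP; split => [z Dz|z [[[]//|tz]|[]//]]; last exact: sim_disc (sim_sym tz).
  have [Kz|nKz] := pselect (K z); first by left; right.
  by have [Gz|nGz] := pselect (G z); [left; left|right].
- split => //; have [s s0 sP] := away_class Dx Dt nxt.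
  exists s => // e e0; apply: (reach_sub sP (lexx e)).
  by apply: sim_conn => //; exact: sim_refl.
- split => // -[_ _ [s s0 sP]].
  have [s' s'0 sP'] := away_class Dy Dt nyt.
  pose r := Num.min s s'.
  have r0 : 0 < r by rewrite lt_min s0.
  have [e e0 H] := crossing Ca Cb Ca1 Cb1 la lb r0.
  apply: (H K (away K r)).
  + by move=> z tz; exact: sim_disc (sim_sym tz).
  + by move=> z [].
  + by move=> z w Kz [_]; apply.
  + exact: sim_conn.
  + apply: (@reach_trans _ _ _ _ _ y).
      by apply: (reach_sub _ (lexx e) (sP _ e0)); apply: away_sub; rewrite ge_min lexx.
    apply: (@reach_sub _ _ (sim y) _ e) => //.
      by move=> z /sP'; apply: away_sub; rewrite ge_min lexx orbT.
    by apply: sim_conn => //; exact: sim_refl.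
- split.
  + apply: closedGK; first by move=> z [].
    by move=> z w s s0 Dz Dw nz nw zK zw; move/(openG z w s s0 Dz Dw nz nw zK zw).
  + apply: closedGK; first by move=> z [].
    move=> z w s s0 Dz Dw nz nw zK zw [_ _ nGw]; split => // Gz; apply: nGw.
    exact/(openG z w s s0 Dz Dw nz nw zK zw).
  + by apply/seteqP; split => // z [Gz [_ _]].
  + by apply/seteqP; split => // z [[_ nKz _]].
  + by apply/seteqP; split => // z [[_ nKz _]].
Qed.

End decomposition.
End separation.

(** * Discs in a surface *)

Section cells.
Variables (R : realType) (S : metricType R).
Notation pt := (R * R)%type.

Definition diam_le (c : R) (A : set S) := forall x y, A x -> A y -> mdist x y <= c.

Definition separates (D K : set S) (x y : S) := exists G G' : set S,
  [/\ D = G `|` K `|` G', G x, G' y &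
  [/\ closed (G `|` K), closed (G' `|` K), G `&` G' = set0, G `&` K = set0 & G' `&` K = set0]].

(* To be thought of as a closed disc [D] with boundary circle [B]. *)
Definition cell (D B : set S) :=
  [/\ compact D, connected D, open (D `\` B),
    exists2 y : nat -> S, injective y & forall i, D (y i) &
    forall sim : S -> S -> Prop,
      (forall z w, sim z w -> D z) -> (forall z, D z -> sim z z) ->
      (forall z w, sim z w -> sim w z) ->
      (forall z w u, sim z w -> sim w u -> sim z u) -> closed_rel sim ->
      (forall z, D z -> connected (sim z)) ->
      (forall z, D z -> exists2 b, B b & sim z b) ->
      forall x y, D x -> D y -> ~ sim x y -> exists2 t, D t & separates D (sim t) x y].

Definition planar_chart (D : set S) (phi : pt -> S) (psi : S -> pt) :=
  [/\ D = phi @` @disc R, forall u, disc u -> psi (phi u) = u,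
    forall u, disc u -> phi @ u --> phi u,
    forall z, D z -> psi @ z --> psi z &
    open (phi @` [set u | u.1 ^+ 2 + u.2 ^+ 2 < 1])].

Lemma disc_connected : connected (@disc R).
Proof.
have z0 : @disc R (0, 0) by rewrite /disc /= expr0n /= addr0.
have -> : @disc R = \bigcup_(z in @disc R) ((fun t : R => seg t (0, 0) z) @` `[0, 1]).
  apply/seteqP; split => [z Dz|z [w Dw [t + <-]]].
    exists z => //; exists 1; first by rewrite /= in_itv /= lexx ler01.
    by rewrite /seg [RHS]ptE /=; congr pair; ring.
  by rewrite /= in_itv /= => t01; apply: seg_disc.
apply: bigcup_connected.
  exists (0, 0) => z _; exists 0; first by rewrite /= in_itv /= lexx ler01.
  by rewrite /seg /=; congr pair; ring.
move=> z Dz; apply: connected_continuous_connected; first exact: segment_connected.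
apply: continuous_subspaceT => t; apply: cvg_pt => /=.
  by apply: cvgD; apply: cvgM; try exact: cvg_cst; [apply: cvgB; [exact: cvg_cst|]|]; exact: cvg_id.
by apply: cvgD; apply: cvgM; try exact: cvg_cst; [apply: cvgB; [exact: cvg_cst|]|]; exact: cvg_id.
Qed.

Lemma planar_chart_cell D phi psi : planar_chart D phi psi -> cell D (phi @` @circ R).
Proof.
move=> [DE psiK cphi cpsi oint].
have wphi : {within @disc R, continuous phi}.
  by apply: continuous_in_subspaceT => u; rewrite inE => /cphi.
have wpsi : {within D, continuous psi}.
  by apply: continuous_in_subspaceT => u; rewrite inE => /cpsi.
have Dphi u : disc u -> D (phi u) by move=> Du; rewrite DE; exists u.
have phi_inj u v : disc u -> disc v -> phi u = phi v -> u = v.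
  by move=> Du Dv E; rewrite -(psiK u)// E psiK.
split.
- by rewrite DE; apply: continuous_compact => //; exact: compact_disc.
- rewrite DE; apply: connected_continuous_connected => //; exact: disc_connected.
- suff -> : D `\` phi @` @circ R = phi @` [set u | u.1 ^+ 2 + u.2 ^+ 2 < 1] by [].
  apply/seteqP; split => [z [+ nC]|z [u + <-]].
    rewrite DE => -[u Du uz]; exists u => //=; rewrite lt_neqAle; apply/andP; split => //.
    by apply/eqP => Cu; apply: nC; exists u.
  move=> /= u1; have Du : disc u by rewrite /disc /= ltW.
  split; first exact: Dphi.
  move=> [v Cv E]; have := phi_inj _ _ (circ_disc Cv) Du E => vu.
  by move: u1; rewrite -vu Cv ltxx.
- pose v (i : nat) : pt := (i.+1%:R^-1, 0).
  have Dv i : disc (v i).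
    rewrite /disc /= expr0n /= addr0 expr_le1// ?invr_ge0//.
    by rewrite invf_le1// ler1n.
  exists (phi \o v) => [i j E|i]; last exact: Dphi.
  have := phi_inj _ _ (Dv i) (Dv j) E => -[] /invr_inj /eqP.
  by rewrite eqr_nat eqSS => /eqP.
move=> sim simD simr sims simt simc simk simB x y Dx Dy nxy.
have [u Du ux] : (phi @` @disc R) x by rewrite -DE.
have [v Dv vy] : (phi @` @disc R) y by rewrite -DE.
pose sim' (u v : pt) := [/\ disc u, disc v & sim (phi u) (phi v)].
have sim'E w : disc w -> sim' w = psi @` (sim (phi w)).
  move=> Dw; apply/seteqP; split => [w' [_ Dw' ww']|_ [z wz <-]].
    by exists (phi w') => //; rewrite psiK.
  have : D z by exact: simD (sims _ _ wz).
  by rewrite DE => -[w' Dw' E]; split => //; rewrite -E psiK// E.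
have [||||||||t [G [G' [Dt GE Gu G'v [cG cG' GG' GK G'K]]]]] := @disc_separation R sim' _ _ _ _ _ _ _ u v Du Dv.
- by move=> z w [].
- by move=> z Dz; split => //; exact/simr/Dphi.
- by move=> z w [Dz Dw /sims zw].
- by move=> z w r [Dz Dw zw] [_ Dr wr]; split => //; exact: simt zw wr.
- move=> a b p q ap bq ab.
  have Dp : disc p by apply: (ucvg_closed (@closed_disc R) ap); apply: filterS ab => k [].
  have Dq : disc q by apply: (ucvg_closed (@closed_disc R) bq); apply: filterS ab => k [].
  split => //; apply: (simc (phi \o a) (phi \o b)).
  + by apply: cvg_comp ap _; exact: cphi.
  + by apply: cvg_comp bq _; exact: cphi.
  + by apply: filterS ab => k [].
- move=> z e Dz e0; apply: connected_econn => //; rewrite sim'E//.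
  apply: connected_continuous_connected; first exact/simk/Dphi.
  by apply: continuous_subspaceW wpsi => w /sims; exact: simD.
- move=> z Dz; have [_ [c Cc <-] zc] := simB _ (Dphi _ Dz).
  by exists c => //; split => //; exact: circ_disc.
- by move=> [_ _]; rewrite ux vy.
have KE : sim (phi t) = phi @` (sim' t).
  apply/seteqP; split => [z tz|_ [w [_ Dw tw] <-]]//.
  have : D z by exact: simD (sims _ _ tz).
  by rewrite DE => -[w Dw wz]; exists w => //; split => //; rewrite wz.
have subD (A : set pt) : A `<=` @disc R -> closed A -> closed (phi @` A).
  move=> AD cA; apply: compact_closed; first exact: metric_hausdorff.
  apply: continuous_compact; first exact: continuous_subspaceW wphi.
  by apply: subclosed_compact cA _ AD; exact: compact_disc.
have GD : G `<=` @disc R by move=> z Gz; rewrite GE; left; left.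
have G'D : G' `<=` @disc R by move=> z Gz; rewrite GE; right.
have KD : sim' t `<=` @disc R by move=> z [].
have disj (A B : set pt) : A `<=` @disc R -> B `<=` @disc R -> A `&` B = set0 ->
    phi @` A `&` phi @` B = set0.
  move=> AD BD AB; apply/seteqP; split => // _ [[a Aa <-] [b Bb E]].
  have ba := phi_inj _ _ (BD _ Bb) (AD _ Aa) E.
  by have : (A `&` B) a; [split; rewrite -?ba// ba|rewrite AB].
exists (phi t); first exact: Dphi.
exists (phi @` G), (phi @` G'); split.
- by rewrite KE -!image_setU -GE.
- by exists u.
- by exists v.
- rewrite KE -!image_setU; split; try exact: disj; apply: subD => //.
  + by move=> z [/GD|/KD].
  + by move=> z [/G'D|/KD].
Qed.

Lemma locally_planar_cell (x : S) (r : R) : locally_planar R S -> 0 < r ->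
  exists D B, [/\ cell D B, diam_le r D & (D `\` B) x].
Proof.
move=> lp r0; have [U [V [oU Ux oV [h [k [[hUV kVU hk kh] [ch ck]]]]]]] := lp x.
pose iota (u : pt) : 'rV[R]_2 := \row_j (if j == ord0 then u.1 else u.2).
have VU v : V v -> U (k v) by move=> Vv; exact: kVU.
pose v0 := h x; have Vv0 : V v0 by exact: hUV.
have kv0 : k v0 = x by rewrite hk// inE.
have ckV v : V v -> k @ v --> k v.
  by move=> Vv; move: ck; rewrite continuous_open_subspace// => /(_ v); apply; rewrite inE.
have chU z : U z -> h @ z --> h z.
  by move=> Uz; move: ch; rewrite continuous_open_subspace// => /(_ z); apply; rewrite inE.
have r20 : 0 < r / 2 by rewrite divr_gt0.
have [e e0 eP] : exists2 e : R, 0 < e & forall v, ball v0 e v -> V v /\ ball x (r / 2) (k v).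
  have nV : nbhs v0 V by exact: open_nbhs_nbhs.
  have nk : nbhs v0 (k @^-1` ball x (r / 2)).
    by apply: (ckV v0 Vv0); rewrite kv0; exact: nbhsx_ballx.
  have /nbhs_ballP[e /= e0 eP] : nbhs v0 (V `&` k @^-1` ball x (r / 2)) by exact: filterI.
  by exists e => // v /eP[].
(* Coordinates in the disc are at most 1 in absolute value, so the rescaled disc stays in the ball
   of radius [e] around [v0], where the chart is defined and its values are near [x]. *)
pose s := e / 2; have s0 : 0 < s by rewrite divr_gt0.
have sn0 : s != 0 by rewrite gt_eqF.
pose aff (u : pt) := v0 + s *: iota u.
have affE u j : aff u 0 j = v0 0 j + s * (if j == ord0 then u.1 else u.2).
  by rewrite /aff !mxE.
have aff_ball u : disc u -> ball v0 e (aff u).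
  move=> /disc_coord[a1 a2 b1 b2]; split=> // i j; rewrite /ball /= [i]ord1 affE.
  rewrite opprD addNKr normrN normrM (gtr0_norm s0).
  have : `|if j == ord0 then u.1 else u.2| <= 1.
    by rewrite ler_norml; case: ifP => _; apply/andP.
  by move=> H; apply: (@le_lt_trans _ _ (s * 1)); [rewrite ler_wpM2l// ltW|rewrite mulr1 /s; lra].
have caff u : aff @ u --> aff u.
  move=> B HB; have /nbhs_ballP[d /= d0 dB] : nbhs (aff u) B := HB.
  have ds0 : 0 < d / s by rewrite divr_gt0.
  apply/nbhs_ballP; exists (d / s) => //= w /pball[w1 w2]; apply: dB; split=> // i j.
  rewrite /ball /= [i]ord1 !affE opprD addrACA subrr add0r -mulrBr normrM (gtr0_norm s0).
  by rewrite mulrC -ltr_pdivlMr//; case: ifP.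
pose phi u := k (aff u).
pose psi z : pt := ((h z 0 ord0 - v0 0 ord0) / s, (h z 0 (lift ord0 ord0) - v0 0 (lift ord0 ord0)) / s).
have phiU u : disc u -> U (phi u) by move=> /aff_ball/eP[/VU].
have psiK u : disc u -> psi (phi u) = u.
  move=> Du; have [Vu _] := eP _ (aff_ball _ Du).
  have -> : psi (phi u) = ((aff u 0 ord0 - v0 0 ord0) / s, (aff u 0 (lift ord0 ord0) - v0 0 (lift ord0 ord0)) / s).
    by rewrite /psi /phi kh// inE.
  by rewrite !affE /= [RHS]ptE; congr pair; rewrite addrAC subrr add0r mulrC mulKf.
have cpsi z : U z -> psi @ z --> psi z.
  move=> Uz; apply: cvg_pt => /=; (apply: cvgM; last exact: cvg_cst);
    (apply: cvgB; last exact: cvg_cst).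
    apply: (@cvg_comp _ _ _ h (fun M : 'rV[R]_2 => M 0 ord0) _ _ _ (chU z Uz)).
    exact: coord_continuous.
  apply: (@cvg_comp _ _ _ h (fun M : 'rV[R]_2 => M 0 (lift ord0 ord0)) _ _ _ (chU z Uz)).
  exact: coord_continuous.
have affpsi z : aff (psi z) = h z.
  apply/rowP => j; rewrite affE /psi /=.
  have -> : (if j == ord0 then (h z 0 ord0 - v0 0 ord0) / s
     else (h z 0 (lift ord0 ord0) - v0 0 (lift ord0 ord0)) / s) = (h z 0 j - v0 0 j) / s.
    case: ifP => [/eqP-> //|j0].
    suff -> : j = lift ord0 ord0 by [].
    by case: j j0 => -[|[|]]// ? ?; exact: val_inj.
  by rewrite mulrC divfK// addrC subrK.
have phipsi z : U z -> phi (psi z) = z by move=> Uz; rewrite /phi affpsi hk// inE.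
have chart : planar_chart (phi @` @disc R) phi psi.
  split => //.
  - move=> u Du; apply: cvg_comp (caff u) _; apply: ckV.
    by have [] := eP _ (aff_ball _ Du).
  - by move=> _ [u Du <-]; apply: cpsi; exact: phiU.
  - have -> : phi @` [set u | u.1 ^+ 2 + u.2 ^+ 2 < 1] =
        U `&` psi @^-1` [set u | u.1 ^+ 2 + u.2 ^+ 2 < 1].
      apply/seteqP; split => [_ [u /= u1 <-]|z [Uz /= z1]].
        have Du : disc u by rewrite /disc /= ltW.
        split; first exact: phiU.
        suff : [set u : pt | u.1 ^+ 2 + u.2 ^+ 2 < 1] (psi (phi u)) by [].
        by rewrite psiK.
      by exists (psi z) => //; exact: phipsi.
    rewrite openE => z [Uz pz]; apply: filterI; first exact: open_nbhs_nbhs.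
    apply: (cpsi z Uz); apply: open_nbhs_nbhs; split => //.
    have -> : [set u : pt | u.1 ^+ 2 + u.2 ^+ 2 < 1] =
      (fun z : pt => z.1 ^+ 2 + z.2 ^+ 2) @^-1` [set x | x < 1] by [].
    by apply: open_comp; [move=> ? _; exact: sqnorm_continuous|exact: open_lt].
exists (phi @` @disc R), (phi @` @circ R); split.
- exact: planar_chart_cell chart.
- move=> _ _ [u Du <-] [v Dv <-].
  have [_ /= xu] := eP _ (aff_ball _ Du); have [_ /= xv] := eP _ (aff_ball _ Dv).
  rewrite !mballE in xu xv; apply: ltW; rewrite (splitr r).
  apply: le_lt_trans (mdist_tri _ x _) _; rewrite mdist_sym.
  exact: ltrD.
- have psix : psi x = (0, 0) by rewrite /psi -/v0 !subrr !mul0r.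
  have D0 : @disc R (0, 0) by rewrite /disc /= expr0n /= addr0.
  have x0 : phi (0, 0) = x by rewrite -psix; exact: phipsi.
  split; first by exists (0, 0).
  move=> [u Cu]; rewrite -x0 => E.
  have := psiK _ (circ_disc Cu); rewrite E psiK// => u0.
  by move: Cu; rewrite -u0 /circ /= expr0n /= addr0 => /esym/eqP; rewrite oner_eq0.
Qed.

End cells.

(** * Stable sets *)

Section dynamics.
Variables (R : realType) (S : metricType R).
Hypothesis cS : compact [set: S].
Implicit Types (A B C D : set S) (x y z : S) (g h : S -> S).

(** A Lebesgue number: counterexamples for the radii [k.+1%:R^-1] would converge to a point, whose
    own cell contains small balls around all points near it. *)
Lemma small_cells : locally_planar R S -> forall r : R, 0 < r -> exists2 l : R, 0 < l &
  forall x, exists D B, [/\ cell D B, diam_le r D & ball x l `<=` D].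
Proof.
move=> lp r r0; apply: contrapT => nex.
have ex (k : nat) : exists x, ~ exists D B, [/\ cell D B, diam_le r D & ball x k.+1%:R^-1 `<=` D].
  apply: contrapT => nk; apply: nex; exists k.+1%:R^-1; first by rewrite invr_gt0.
  by move=> x; apply: contrapT => nx; apply: nk; exists x.
have [a aH] := choice ex; have [z az] := ucvgT_ex cS a.
have [D [B [cD rD Dz]]] := locally_planar_cell z lp r0.
have [_ _ oD _ _] := cD.
have /nbhs_ballP[e /= e0 eD] : nbhs z (D `\` B) by exact: open_nbhs_nbhs.
have e20 : 0 < e / 2 by rewrite divr_gt0.
have [k [zk ke]] := omega_ex (filterI (ucvg_ball e20 az) (omega_small e20)).
apply: (aH k); exists D, B; split => // w kw.
suff zw : ball z e w by have [] := eD _ zw.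
rewrite (splitr e); apply: ball_triangle zk _.
by apply: le_ball kw; exact: ltW.
Qed.

Section iterates.
Variable g : S -> S.
Hypothesis cg : continuous g.

Lemma unif_cont (e : R) : 0 < e -> exists2 d, 0 < d &
  forall x y, mdist x y < d -> mdist (g x) (g y) < e.
Proof.
move=> e0; apply: contrapT => nex.
have ex (k : nat) : exists w : S * S, mdist w.1 w.2 < k.+1%:R^-1 /\ e <= mdist (g w.1) (g w.2).
  apply: contrapT => nk; apply: nex; exists k.+1%:R^-1; first by rewrite invr_gt0.
  by move=> x y xy; rewrite ltNge; apply/negP => H; apply: nk; exists (x, y).
have [c cH] := choice ex; have [z cz] := ucvgT_ex cS (fst \o c).
have cz2 : (snd \o c) @ omega --> z.
  by apply: ucvg_close cz _; apply: nearW => k; have [] := cH k.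
have : e <= mdist (g z) (g z).
  apply: (@ucvg_mdist_ge _ _ (g \o (fst \o c)) (g \o (snd \o c))).
  - by apply: cvg_comp cz _; exact: cg.
  - by apply: cvg_comp cz2 _; exact: cg.
  - by apply: nearW => k; have [] := cH k.
by rewrite mdistxx leNgt e0.
Qed.

Lemma iter_continuous n : continuous (iter n g).
Proof.
elim: n => [|n IH] x; first exact: cvg_id.
by rewrite /=; apply: cvg_comp (IH x) _; exact: cg.
Qed.

Lemma iter_unif_cont N (e : R) : 0 < e -> exists2 d, 0 < d &
  forall n x y, (n <= N)%N -> mdist x y < d -> mdist (iter n g x) (iter n g y) < e.
Proof.
move=> e0; elim: N => [|N [d d0 dP]].
  by exists e => // n x y; rewrite leqn0 => /eqP->.
have [d' d'0 d'P] : exists2 d, 0 < d &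
    forall x y, mdist x y < d -> mdist (iter N.+1 g x) (iter N.+1 g y) < e.
  elim: N.+1 (e) e0 => [|m IH] e' e'0; first by exists e'.
  by have [d1 /IH[d2 d20 d2P] d1P] := unif_cont e'0; exists d2 => // x y /d2P/d1P.
exists (Num.min d d'); first by rewrite lt_min d0.
move=> n x y; rewrite leq_eqVlt ltnS => /orP[/eqP->|nN]; rewrite lt_min => /andP[xd xd'].
  exact: d'P.
exact: dP.
Qed.

Definition bnd (c : R) n A := forall x y, A x -> A y -> mdist (iter n g x) (iter n g y) <= c.

Definition stable (c : R) A := forall n, bnd c n A.

Lemma bnd_sub c n A B : A `<=` B -> bnd c n B -> bnd c n A.
Proof. by move=> AB H x y /AB Bx /AB By; exact: H. Qed.

Lemma stable_sub c A B : A `<=` B -> stable c B -> stable c A.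
Proof. by move=> AB H n; exact: bnd_sub (H n). Qed.

Lemma stable_le c c' A : c <= c' -> stable c A -> stable c' A.
Proof. by move=> cc H n x y Ax Ay; exact: le_trans (H n x y Ax Ay) cc. Qed.

Lemma iter_image_continuum n A : continuum A -> continuum (iter n g @` A).
Proof.
move=> [cA kA]; have cn := @continuous_subspaceT _ _ A _ (@iter_continuous n).
by split; [exact: continuous_compact|exact: connected_continuous_connected].
Qed.

Lemma ulimset_stable (c : R) (A : nat -> set S) :
  (forall n, \forall k \near omega, bnd c n (A k)) -> stable c (ulimset A).
Proof.
move=> H n x y Lx Ly; apply/ler_addgt0Pr => e e0.
have e20 : 0 < e / 2 by rewrite divr_gt0.
have [d d0 dP] := iter_unif_cont n e20.
have [k [[Hk [a Aa xa]] [b Ab yb]]] := omega_ex (filterI (filterI (H n) (Lx d d0)) (Ly d d0)).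
rewrite !mballE in xa yb.
have H1 := dP n _ _ (leqnn n) xa; have H2 := dP n _ _ (leqnn n) yb; have H3 := Hk _ _ Aa Ab.
have := mdist_tri (iter n g x) (iter n g a) (iter n g y).
have := mdist_tri (iter n g a) (iter n g b) (iter n g y).
rewrite (mdist_sym (iter n g b)); lra.
Qed.

Lemma ulimset_continuum (A : nat -> set S) :
  (forall e : R, 0 < e -> \forall k \near omega, econn e (A k)) -> continuum (ulimset A).
Proof.
move=> H; split; first by apply: closedT_compact => //; exact: ulimset_closed.
by apply: ulimset_connected => //; exact: metric_hausdorff.
Qed.

Lemma ulimset_const (A : nat -> set S) x : (forall k, A k x) -> ulimset A x.
Proof. by move=> H e e0; apply: nearW => k; exists x => //; exact: ballxx. Qed.

Lemma stable_continuum_lim (c : R) (A : nat -> set S) :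
  (forall k, connected (A k)) -> (forall k n, (n <= k)%N -> bnd c n (A k)) ->
  continuum (ulimset A) /\ stable c (ulimset A).
Proof.
move=> kA bA; split.
  by apply: ulimset_continuum => e e0; apply: nearW => k; exact: connected_econn.
by apply: ulimset_stable => n; apply: filterS (omega_ge n) => k; exact: bA.
Qed.

Lemma orbit_ball_open x n (e : R) : open (\bigcap_(j in [set j | (j <= n)%N])
  [set y | mdist (iter j g x) (iter j g y) < e]).
Proof.
rewrite openE => y Oy; rewrite /interior.
have nj j : (j <= n)%N -> nbhs y [set y | mdist (iter j g x) (iter j g y) < e].
  move=> jn; have /= xy := Oy j jn.
  have e0 : 0 < e - mdist (iter j g x) (iter j g y) by rewrite subr_gt0.
  have nn : nbhs y [set z | ball (iter j g y) (e - mdist (iter j g x) (iter j g y)) (iter j g z)].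
    by apply: (@iter_continuous j y); exact: nbhsx_ballx.
  apply: filterS nn => z; rewrite /= mballE => yz.
  by apply: le_lt_trans (mdist_tri _ (iter j g y) _) _; rewrite addrC -ltrBrDr.
elim: n nj {Oy} => [|n IH] nj.
  by apply: filterS (nj 0%N (leqnn _)) => z xz j /=; rewrite leqn0 => /eqP->.
have nIH := IH (fun j jn => nj j (leqW jn)).
apply: filterS (filterI nIH (nj n.+1 (leqnn _))) => z [zn zn1] j /=.
by rewrite leq_eqVlt => /orP[/eqP->//|]; rewrite ltnS => /zn.
Qed.

End iterates.

Lemma iter_cancel g h n m x : cancel g h -> (m <= n)%N -> iter m h (iter n g x) = iter (n - m) g x.
Proof.
move=> gh; elim: m => [|m IH] mn; first by rewrite subn0.
rewrite iterS IH ?(ltnW mn)//.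
have -> : (n - m = (n - m.+1).+1)%N by lia.
by rewrite iterS gh.
Qed.

(** The map and its inverse are separate arguments, so that statements about stable sets yield those
    about unstable sets by exchanging [g] and [h]. *)
Definition cw1 g h (c : R) := forall A B, continuum A -> continuum B -> stable g c A ->
  stable h c B -> forall x y, A x -> A y -> B x -> B y -> x = y.

Lemma cw1_sym g h c : cw1 g h c -> cw1 h g c.
Proof. by move=> H A B cA cB sA sB x y Ax Ay Bx By; exact: (H B A). Qed.

Section cw1.
Variables (g h : S -> S) (c : R).
Hypotheses (cg : continuous g) (ch : continuous h) (gh : cancel g h) (hg : cancel h g).
Hypothesis cw : cw1 g h c.

(** Limits of counterexamples would be a stable and an unstable continuum with two common points.
    The version for sets that are only chain-connected is the one that applies to iterates of sets
    connected modulo [stably_related]. *)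
Lemma cw1_uniform (e : R) : 0 < e -> exists N : nat, forall A B x y,
  econn N.+1%:R^-1 A -> econn N.+1%:R^-1 B ->
  (forall i, (i <= N)%N -> bnd g c i A) -> (forall i, (i <= N)%N -> bnd h c i B) ->
  A x -> A y -> B x -> B y -> mdist x y < e.
Proof.
move=> e0; apply: contrapT => nex.
have ex (k : nat) : exists w : (set S * set S) * (S * S), [/\
    econn k.+1%:R^-1 w.1.1 /\ econn k.+1%:R^-1 w.1.2,
    forall i, (i <= k)%N -> bnd g c i w.1.1, forall i, (i <= k)%N -> bnd h c i w.1.2 &
    [/\ w.1.1 w.2.1, w.1.1 w.2.2, w.1.2 w.2.1, w.1.2 w.2.2 & e <= mdist w.2.1 w.2.2]].
  apply: contrapT => nk; apply: nex; exists k => A B x y kA kB bA bB Ax Ay Bx By.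
  rewrite ltNge; apply/negP => H; apply: nk; exists ((A, B), (x, y)).
  by do !split.
have [w wH] := choice ex.
have [x wx] := ucvgT_ex cS (fun k => (w k).2.1).
have [y wy] := ucvgT_ex cS (fun k => (w k).2.2).
pose A k := (w k).1.1; pose B k := (w k).1.2.
have sub (E : nat -> set S) : (forall k, econn k.+1%:R^-1 (E k)) -> continuum (ulimset E).
  move=> kE; apply: ulimset_continuum => d d0; apply: filterS (omega_small d0) => k kd z z' Ez Ez'.
  by apply: (@reach_sub _ _ (E k) _ k.+1%:R^-1) => //; [exact: ltW|exact: kE].
have cA : continuum (ulimset A) by apply: sub => k; have [[]] := wH k.
have cB : continuum (ulimset B) by apply: sub => k; have [[]] := wH k.
have sA : stable g c (ulimset A).
  apply: ulimset_stable => // n; apply: filterS (omega_ge n) => k nk.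
  by have [_ H _ _] := wH k; exact: H.
have sB : stable h c (ulimset B).
  apply: ulimset_stable => // n; apply: filterS (omega_ge n) => k nk.
  by have [_ _ H _] := wH k; exact: H.
have xy : x = y.
  apply: (cw cA cB sA sB).
  - by apply: ulimset_seq wx; apply: nearW => k; have [_ _ _ []] := wH k.
  - by apply: ulimset_seq wy; apply: nearW => k; have [_ _ _ []] := wH k.
  - by apply: ulimset_seq wx; apply: nearW => k; have [_ _ _ []] := wH k.
  - by apply: ulimset_seq wy; apply: nearW => k; have [_ _ _ []] := wH k.
have : e <= mdist x y.
  by apply: (ucvg_mdist_ge wx wy); apply: nearW => k; have [_ _ _ []] := wH k.
by rewrite xy mdistxx leNgt e0.
Qed.

(** At a time [j] far from both ends, the iterate of [C] has [N] bounded images in each direction,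
    so it can play both roles in [cw1_uniform]. *)
Lemma window (e : R) : 0 < e -> exists N : nat, forall C n j x y, connected C ->
  (forall i, (i <= n)%N -> bnd g c i C) -> (N <= j)%N -> (j + N <= n)%N ->
  C x -> C y -> mdist (iter j g x) (iter j g y) < e.
Proof.
move=> e0; have [N NP] := cw1_uniform e0; exists N => C n j x y kC bC Nj jn Cx Cy.
have kgC : connected (iter j g @` C).
  apply: connected_continuous_connected => //.
  by apply: continuous_subspaceT; exact: iter_continuous.
have N0 : 0 < N.+1%:R^-1 :> R by rewrite invr_gt0.
apply: (NP (iter j g @` C) (iter j g @` C)).
- exact: connected_econn.
- exact: connected_econn.
- by move=> i iN _ _ [z Cz <-] [w Cw <-]; rewrite -!iterD; apply: bC => //; lia.
- move=> i iN _ _ [z Cz <-] [w Cw <-].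
  by rewrite !(iter_cancel _ gh); [apply: bC => //|..]; lia.
- by exists x.
- by exists y.
- by exists x.
- by exists y.
Qed.

Lemma contraction (e : R) : 0 < e -> exists N : nat, forall C n x y, connected C ->
  stable g c C -> (N <= n)%N -> C x -> C y -> mdist (iter n g x) (iter n g y) < e.
Proof.
move=> /window[N NP]; exists N => C n x y kC sC Nn.
by apply: (NP C (n + N)%N n).
Qed.

(** Uniform continuity handles the first [N] iterates and [window] the later ones, up to [n - N].
    The last [N] times have too short a bounded future to be covered. *)
Lemma small_stays_small (e : R) : 0 < e -> exists (N : nat) (d : R), 0 < d /\
  forall C n j x y, connected C ->
  (forall i, (i <= n)%N -> bnd g c i C) -> (j + N <= n)%N -> diam_le d C ->
  C x -> C y -> mdist (iter j g x) (iter j g y) < e.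
Proof.
move=> e0; have [N NP] := window e0; have [d d0 dP] := iter_unif_cont cg N e0.
exists N, (d / 2); split; first by rewrite divr_gt0.
move=> C n j x y kC bC jn dC Cx Cy.
have [Nj|jN] := leqP N j; first exact: (NP C n j).
apply: dP; first exact: ltnW.
by apply: le_lt_trans (dC x y Cx Cy) _; lra.
Qed.

Lemma small_stable (e : R) : 0 < e -> exists2 d, 0 < d &
  forall C, connected C -> stable g c C -> diam_le d C -> stable g e C.
Proof.
move=> /small_stays_small[N [d [d0 dP]]]; exists d => // C kC sC dC n x y Cx Cy.
by apply/ltW/(dP C (n + N)%N n).
Qed.

End cw1.
End dynamics.

(** * Stable continua of a definite size through every point *)

Section stable_continua.
Variables (R : realType) (S : metricType R).
Hypotheses (cS : compact [set: S]) (lp : locally_planar R S).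
Variables (g h : S -> S) (c : R).
Hypotheses (cg : continuous g) (ch : continuous h) (gh : cancel g h) (hg : cancel h g).
Hypotheses (c0 : 0 < c) (cw : cw1 g h c).
Implicit Types (A B C D : set S) (x y z : S).

Let hausS := @metric_hausdorff R S.

(* Given [x], pull back to [x] a small neighbourhood of [g^n x]; if it grows too much on the
   way, a subcontinuum of the right size survives as [n] tends to infinity.  Otherwise a
   neighbourhood of a limit point of [g^n x] is contracted by [h], and then the forward orbits
   of infinitely many points are eventually pairwise separated by a fixed distance, which
   compactness forbids. *)
Lemma stable_continuum_exists : exists2 d0 : R, 0 < d0 & forall x, exists A,
  [/\ continuum A, A x, stable g (c / 2) A & ~ diam_le d0 A].
Proof.
pose d1 := c / 8; have d10 : 0 < d1 by rewrite divr_gt0.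
have d1c : 2 * d1 <= c / 2 by move: (c0); rewrite /d1; lra.
have cc : 2 * d1 <= c by move: (c0); rewrite /d1; lra.
have [N [d [dp dP]]] := small_stays_small cS cg ch gh cw d10.
have [rho rho0 rhoP] := iter_unif_cont cS ch N d10.
have rho20 : 0 < rho / 2 by rewrite divr_gt0.
have [r r0 /choice[Nb NbP]] := small_cells cS lp rho20.
have NbC z : continuum (Nb z) by have [B [[]]] := NbP z.
have Nbd z : diam_le (rho / 2) (Nb z) by have [B []] := NbP z.
have Nbz z : ball z r `<=` Nb z by have [B []] := NbP z.
have Nbzz z : Nb z z by apply: Nbz; exact: ballxx.
pose good x n := exists C, [/\ continuum C, C x, forall j, (j <= n)%N -> bnd g (2 * d1) j C & ~ diam_le d C].
pose bad x n := forall y i, Nb (iter n g x) y -> (i <= n)%N -> mdist (iter i h (iter n g x)) (iter i h y) < d1.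
have dich x n : good x n \/ bad x n.
  pose O : set S := \bigcap_(j in [set j | (j <= n)%N]) [set y | mdist (iter j g x) (iter j g y) < d1].
  pose E := iter n h @` Nb (iter n g x).
  have EC : continuum E by exact: iter_image_continuum.
  have hng : iter n h (iter n g x) = x by rewrite (iter_cancel _ gh)// subnn.
  have Ex : E x by exists (iter n g x).
  have Ox : O x by move=> j _ /=; rewrite mdistxx.
  have oO : open O by exact: orbit_ball_open.
  have [EO|nEO] := pselect (E `<=` O).
    right => y i Ny ni.
    have := EO (iter n h y) (ex_intro2 _ _ y Ny erefl) (n - i)%N (leq_subr _ _) => /=.
    have e1 : iter (n - i) g x = iter i h (iter n g x) by rewrite (iter_cancel _ gh).
    have e2 : iter (n - i) g (iter n h y) = iter i h y.
      by rewrite (iter_cancel _ hg) ?leq_subr// subKn.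
    by rewrite e1 e2.
  left; have [C [cC kC CE Cx nCO]] := boundary_bumping cS EC.1 EC.2 oO Ex Ox nEO.
  have CO y j : (j <= n)%N -> C y -> mdist (iter j g x) (iter j g y) <= d1.
    move=> jn /CE[_ Oy]; apply/ler_addgt0Pr => e e0.
    have [w [Ow yw]] := Oy _ (@iter_continuous _ _ _ cg j y _ (nbhsx_ballx (iter j g y) e e0)).
    have := Ow j jn => /= xw; rewrite /= mballE mdist_sym in yw.
    by apply: le_trans (mdist_tri _ (iter j g w) _) _; apply: lerD; exact: ltW.
  have bC j : (j <= n)%N -> bnd g (2 * d1) j C.
    move=> jn y z Cy Cz; have := CO y j jn Cy; have := CO z j jn Cz.
    by have := mdist_tri (iter j g y) (iter j g x) (iter j g z); rewrite (mdist_sym _ (iter j g x)); lra.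
  exists C; split => // dC.
  (* [C] reaches distance [d1] from the orbit of [x] at some time [j]. If [C] were [d]-small,
     [small_stays_small] would exclude [j <= n - N]; for later [j], the iterate is the image of a
     part of [Nb] under at most [N] steps of [h], which is too small by the choice of [rho]. *)
  have [y Cy [j jn xy]] : exists2 y, C y & exists2 j, (j <= n)%N & d1 <= mdist (iter j g x) (iter j g y).
    apply: contrapT => nex; apply: nCO => y Cy j jn /=; rewrite ltNge; apply/negP => H.
    by apply: nex; exists y => //; exists j.
  suff : mdist (iter j g x) (iter j g y) < d1 by rewrite ltNge xy.
  have [jN|jN] := leqP (j + N) n.
    by apply: (dP C n) => // i ni z w Cz Cw; exact: le_trans (bC i ni z w Cz Cw) cc.
  have [[w Nw wy] _] := CE _ Cy.
  have -> : iter j g x = iter (n - j) h (iter n g x) by rewrite (iter_cancel _ gh) ?leq_subr// subKn.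
  have -> : iter j g y = iter (n - j) h w.
    by rewrite -wy (iter_cancel _ hg).
  apply: rhoP; first by rewrite leq_subLR ltnW.
  by apply: le_lt_trans (Nbd _ _ _ (Nbzz _) Nw) _; lra.
(* The limit of sets of diameter above [d] is only known to have diameter at least [d]; halving
   restores a strict inequality. *)
exists (d / 2); first by rewrite divr_gt0.
have good_stable x : (forall n, good x n) -> exists A, [/\ continuum A, A x, stable g (c / 2) A & ~ diam_le (d / 2) A].
  move=> /choice[C CP].
  have [||cA sA] := @stable_continuum_lim _ _ cS _ cg (2 * d1) C.
  - by move=> k; have [[]] := CP k.
  - by move=> k n nk; have [_ _ H _] := CP k; exact: H.
  exists (ulimset C); split => //.
  - by apply: ulimset_const => k; have [] := CP k.
  - exact: stable_le sA.
  - move=> dC.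
    have ex k : exists w : S * S, [/\ C k w.1, C k w.2 & d < mdist w.1 w.2].
      have [_ _ _ nd] := CP k; apply: contrapT => nex; apply: nd => y z Cy Cz.
      by rewrite leNgt; apply/negP => H; apply: nex; exists (y, z).
    have [w wP] := choice ex.
    have [y wy] := ucvgT_ex cS (fst \o w); have [z wz] := ucvgT_ex cS (snd \o w).
    have : d <= mdist y z.
      by apply: (ucvg_mdist_ge wy wz); apply: nearW => k; have [_ _ /ltW] := wP k.
    have : mdist y z <= d / 2.
      apply: dC.
        by apply: ulimset_seq wy; apply: nearW => k; have [] := wP k.
      by apply: ulimset_seq wz; apply: nearW => k; have [] := wP k.
    lra.
move=> x; have [/good_stable//|ngood] := pselect (forall n, good x n); exfalso.
have evbad y : ~ (forall n, good y n) -> exists n1, forall n, (n1 <= n)%N -> bad y n.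
  move=> /existsNP[n1 ng]; exists n1 => n n1n; have [[C [? ? H ?]]|//] := dich y n.
  by exfalso; apply: ng; exists C; split => // j jn1; apply: H; exact: leq_trans n1n.
have [n1 n1P] := evbad _ ngood.
have [z xz] := ucvgT_ex cS (fun n => iter n g x).
have r20 : 0 < r / 2 by rewrite divr_gt0.
have r40 : 0 < r / 4 by rewrite divr_gt0.
have [l l0 lP] := small_cells cS lp r40.
have [D [B [[cD kD _ _ _] rD lD]]] := lP z.
have Dz : D z by apply: lD; exact: ballxx.
(* For every [i], some late iterate of [x] is so close to [z] that its neighbourhood [Nb] contains
   [D]; badness then controls the [i]-th backward image. So [D] is an unstable continuum with
   interior. *)
have sD : stable h (2 * d1) D.
  move=> i y y' Dy Dy'.
  have [n [[zn n1n] ni]] := omega_ex (filterI (filterI (ucvg_mdist r20 xz) (omega_ge n1)) (omega_ge i)).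
  have sub w : D w -> Nb (iter n g x) w.
    move=> Dw; apply: Nbz; rewrite mballE; apply: le_lt_trans (mdist_tri _ z _) _.
    by have := rD _ _ Dz Dw; rewrite (mdist_sym _ z); lra.
  have := n1P n n1n y i (sub _ Dy) ni; have := n1P n n1n y' i (sub _ Dy') ni.
  have := mdist_tri (iter i h y) (iter i h (iter n g x)) (iter i h y').
  by rewrite (mdist_sym (iter i h y) (iter i h (iter n g x))); lra.
have l20 : 0 < l / 2 by rewrite divr_gt0.
have [m m0 mP] := small_cells cS lp l20.
have [D' [B' [[_ _ _ [p pinj pD'] _] lD' mD']]] := mP z.
have D'z : D' z by apply: mD'; exact: ballxx.
have D'l y : D' y -> ball z l y.
  by move=> D'y; rewrite mballE; have := lD' _ _ D'z D'y; lra.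
have D'D y : D' y -> D y by move=> /D'l/lD.
(* A stable continuum through [y] meets the unstable [D] only in [y]. As [D] is a neighbourhood of
   [y], the singleton is open and closed in that continuum, which is therefore a point, against its
   size. *)
have D'bad y : D' y -> exists n1, forall n, (n1 <= n)%N -> bad y n.
  move=> D'y; apply: evbad => /good_stable[A [[cA kA] Ay sA nA]].
  have Ay1 w : A w -> D w -> w = y.
    move=> Aw Dw; apply: (cw (conj cA kA) (conj cD kD)) => //.
    - by apply: stable_le sA; lra.
    - exact: stable_le sD.
    - exact: D'D.
  apply: nA; suff <- : [set y] = A by move=> _ _ -> ->; rewrite mdistxx ltW// divr_gt0.
  apply: kA; first by exists y.
    exists (ball z l)°; first exact: open_interior.
    apply/seteqP; split => [w ->|w [Aw /interior_subset/lD Dw]]; last exact: Ay1.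
    split => //; apply/nbhs_ballP; exists (l - mdist z y).
      by rewrite /= subr_gt0; have := D'l _ D'y; rewrite mballE.
    move=> v; rewrite !mballE => yv.
    by apply: le_lt_trans (mdist_tri _ y _) _; lra.
  exists [set y]; first by apply: compact_closed; [exact: hausS|exact: compact_set1].
  by apply/seteqP; split => [w ->|w []//].
(* If the orbits came [r]-close at arbitrarily late times, pulling back [Nb] from those times would
   give in the limit a stable continuum through both points, which also lie in the unstable [D]. *)
have sep y y' : D' y -> D' y' -> y <> y' -> exists n2, forall n, (n2 <= n)%N ->
    r <= mdist (iter n g y) (iter n g y').
  move=> D'y D'y' yy'; apply: contrapT => nex; apply: yy'.
  have [k1 k1P] := D'bad _ D'y.
  have ex m' : exists C, [/\ connected C, C y, C y' & forall j, (j <= m')%N -> bnd g (2 * d1) j C].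
    have [n nm close] : exists2 n, (maxn k1 m' <= n)%N & mdist (iter n g y) (iter n g y') < r.
      apply: contrapT => nn; apply: nex; exists (maxn k1 m') => n nn'.
      by rewrite leNgt; apply/negP => H; apply: nn; exists n.
    rewrite geq_max in nm; have /andP[k1n m'n] := nm.
    exists (iter n h @` Nb (iter n g y)); split.
    - by have [] := @iter_image_continuum _ _ _ ch n _ (NbC (iter n g y)).
    - by exists (iter n g y) => //; rewrite (iter_cancel _ gh)// subnn.
    - exists (iter n g y'); last by rewrite (iter_cancel _ gh)// subnn.
      by apply: Nbz; rewrite mballE.
    - move=> j jm _ _ [u Nu <-] [v Nv <-].
      have jn : (j <= n)%N by exact: leq_trans m'n.
      rewrite !(iter_cancel _ hg)//.
      have := k1P n k1n u (n - j)%N Nu (leq_subr _ _); have := k1P n k1n v (n - j)%N Nv (leq_subr _ _).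
      have := mdist_tri (iter (n - j) h u) (iter (n - j) h (iter n g y)) (iter (n - j) h v).
      by rewrite (mdist_sym (iter (n - j) h u) (iter (n - j) h (iter n g y))); lra.
  have [C CP] := choice ex.
  have [||cA sA] := @stable_continuum_lim _ _ cS _ cg (2 * d1) C.
  - by move=> k; have [] := CP k.
  - by move=> k n nk; have [_ _ _ H] := CP k; exact: H.
  apply: (cw cA (conj cD kD)).
  - exact: stable_le sA.
  - exact: stable_le sD.
  - by apply: ulimset_const => k; have [] := CP k.
  - by apply: ulimset_const => k; have [] := CP k.
  - exact: D'D.
  - exact: D'D.
(* The limits of the forward orbits of the infinitely many points [p i] are pairwise [r] apart. *)
have [w wP] := choice (fun i => ucvgT_ex cS (fun n => iter n g (p i))).
have wr i j : i <> j -> r <= mdist (w i) (w j).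
  move=> ij; have [|n2 n2P] := sep (p i) (p j) (pD' i) (pD' j); first by move/pinj.
  by apply: (ucvg_mdist_ge (wP i) (wP j)); apply: filterS (omega_ge n2).
have [u wu] := ucvgT_ex cS w.
have [i ui] := omega_ex (ucvg_mdist r20 wu).
have [j [uj ij]] := omega_ex (filterI (ucvg_mdist r20 wu) (omega_ge i.+1)).
have := wr i j (fun E => ltac:(by move: ij; rewrite E ltnn)).
have := mdist_tri (w i) u (w j); rewrite (mdist_sym (w i) u); lra.
Qed.

End stable_continua.

(** * Stable classes in small discs *)

Section stable_classes.
Variables (R : realType) (S : metricType R).
Hypotheses (cS : compact [set: S]) (lp : locally_planar R S).
Variables (g h : S -> S) (c : R).
Hypotheses (cg : continuous g) (ch : continuous h) (gh : cancel g h) (hg : cancel h g).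
Hypotheses (c0 : 0 < c) (cw : cw1 g h c).
Implicit Types (A B C D K : set S) (x y z w : S).

Let hausS := @metric_hausdorff R S.

(** The bound is [c / 2] so that the union of two such continua is still [c]-stable; in a small [D],
    [small_stable] then brings the bound back to [c / 2], which gives transitivity. *)
Definition joined D z w := exists A, [/\ continuum A, A `<=` D, stable g (c / 2) A, A z & A w].

Lemma stableU (e : R) A B z : A z -> B z -> stable g e A -> stable g e B ->
  0 <= e -> stable g (e + e) (A `|` B).
Proof.
move=> Az Bz sA sB e0 n x y.
have H x' y' : A x' -> B y' -> mdist (iter n g x') (iter n g y') <= e + e.
  move=> Ax By; apply: le_trans (mdist_tri _ (iter n g z) _) _.
  by apply: lerD; [exact: sA|exact: sB].
move=> [Ax|Bx] [Ay|By].
- by apply: le_trans (sA n _ _ Ax Ay) _; lra.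
- exact: H.
- by rewrite mdist_sym; exact: H.
- by apply: le_trans (sB n _ _ Bx By) _; lra.
Qed.

Lemma continuum1 x : continuum [set x].
Proof. by split; [exact: compact_set1|exact: connected1]. Qed.

Lemma stable1 (e : R) x : 0 <= e -> stable g e [set x].
Proof. by move=> e0 n _ _ -> ->; rewrite mdistxx. Qed.

Lemma stable_separation : exists2 r : R, 0 < r & forall D B, cell D B -> diam_le r D ->
  forall z w, D z -> D w -> ~ joined D z w -> exists K, [/\ continuum K, stable g c K, K `<=` D,
    (forall A u, continuum A -> A `<=` D -> stable g (c / 2) A -> A u -> K u -> A `<=` K) &
    separates D K z w].
Proof.
have c20 : 0 < c / 2 by rewrite divr_gt0.
have c2c : c / 2 + c / 2 = c by rewrite -splitr.
have [d d0 dP] := small_stable cS cg ch gh cw c20.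
have [d' d'0 d'P] := stable_continuum_exists cS lp cg ch gh hg c0 cw.
(* Size [d] gives transitivity. Size [d'] is too small to contain the stable continua of
   [stable_continuum_exists], so boundary bumping makes every class reach [B]. *)
exists (Num.min d d'); first by rewrite lt_min d0.
move=> D B cellD rD.
have [cD kD oD _ sepD] := cellD.
have clD : closed D by exact: compact_closed.
have simD z w : joined D z w -> D z by move=> [A [_ AD _ Az _]]; exact: AD.
have simr z : D z -> joined D z z.
  by move=> Dz; exists [set z]; split => //; [exact: continuum1|move=> _ ->|apply: stable1; exact: ltW].
have sims z w : joined D z w -> joined D w z by move=> [A [? ? ? ? ?]]; exists A.
have simt z w u : joined D z w -> joined D w u -> joined D z u.
  move=> [A [[cA kA] AD sA Az Aw]] [A' [[cA' kA'] AD' sA' Aw' Au']].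
  have UD : A `|` A' `<=` D by move=> v [/AD|/AD'].
  have kU : connected (A `|` A') by apply: connectedU => //; exists w.
  exists (A `|` A'); split => //; [by split => //; exact: compactU| |by left|by right].
  apply: dP => //; first by rewrite -c2c; apply: (stableU Aw) => //; exact: ltW.
  move=> x y /UD Dx /UD Dy; apply: le_trans (rD x y Dx Dy) _.
  by rewrite ge_min lexx.
have simc : closed_rel (joined D).
  move=> a b p q ap bq ab.
  have ex k : exists A, joined D (a k) (b k) ->
      [/\ continuum A, A `<=` D, stable g (c / 2) A, A (a k) & A (b k)].
    have [[A AH]|n] := pselect (joined D (a k) (b k)); first by exists A.
    by exists set0.
  have [A AH] := choice ex.
  exists (ulimset A); split.
  - apply: ulimset_continuum => // e e0; apply: filterS ab => k /AH[[_ kA] _ _ _ _].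
    exact: connected_econn.
  - move=> z Lz; apply: clD => V /nbhs_ballP[e /= e0 eV].
    have [k [[y Ay zy] /AH[_ AD _ _ _]]] := omega_ex (filterI (Lz e e0) ab).
    by exists y; split; [exact: AD|exact: eV].
  - apply: ulimset_stable => // n; apply: filterS ab => k /AH[_ _ sA _ _].
    exact: sA.
  - by apply: ulimset_seq ap; apply: filterS ab => k /AH[].
  - by apply: ulimset_seq bq; apply: filterS ab => k /AH[].
have simk z : D z -> connected (joined D z).
  move=> Dz; have -> : joined D z =
      \bigcup_(A in [set A | [/\ continuum A, A `<=` D, stable g (c / 2) A & A z]]) A.
    apply/seteqP; split => [w [A [cA AD sA Az Aw]]|w [A [cA AD sA Az] Aw]]; exists A => //.
  by apply: bigcup_connected; [exists z => A []|move=> A [[]]].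
have simB z : D z -> exists2 b, B b & joined D z b.
  move=> Dz; have [Bz|nBz] := pselect (B z); first by exists z => //; exact: simr.
  have [A [[cA kA] Az sA nA]] := d'P z.
  have nAD : ~ A `<=` D `\` B.
    move=> AD; apply: nA => x y /AD[Dx _] /AD[Dy _]; apply: le_trans (rD x y Dx Dy) _.
    by rewrite ge_min lexx orbT.
  have [C [cC kC CA Cz nCD]] := boundary_bumping cS cA kA oD Az (conj Dz nBz) nAD.
  have CD : C `<=` D.
    move=> u /CA[_]; move: u; apply: (subset_trans (closureS (@subDsetl _ D B))).
    exact: clD.
  have [b Cb Bb] : exists2 b, C b & B b.
    apply: contrapT => nex; apply: nCD => u Cu; split; first exact: CD.
    by move=> Bu; apply: nex; exists u.
  exists b => //; exists C; split => //.
  by apply: stable_sub sA => u /CA[].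
move=> z w Dz Dw nzw.
have [t Dt sep] := sepD _ simD simr sims simt simc simk simB z w Dz Dw nzw.
exists (joined D t); split => //.
- split; last exact: simk.
  apply: closedT_compact => //; apply: closed_ucvg => a u ta au.
  by apply: (simc _ _ _ _ (@cvg_cst _ t _ _ _) au); exact: nearW.
- move=> n x y tx ty; have [A [_ _ sA Ax Ay]] := simt _ _ _ (sims _ _ tx) ty.
  by apply: le_trans (sA n x y Ax Ay) _; lra.
- by move=> u tu; exact: simD (sims _ _ tu).
- by move=> A u cA AD sA Au tu v Av; apply: simt tu _; exists A.
Qed.

Lemma ucvg_not_closed (E : set S) (a : nat -> S) z : closed E -> a @ omega --> z ->
  ~ E z -> \forall k \near omega, ~ E (a k).
Proof.
move=> cE az nEz.
by apply: (az (~` E)); apply: open_nbhs_nbhs; split => //; exact: closed_openC.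
Qed.

(* Otherwise, in the limit, a stable class would separate the two ends of a nearly closed
   irreducible unstable continuum from its middle, and meet it only once. *)
Lemma short_join : exists2 l : R, 0 < l & forall d : R, 0 < d -> exists2 e : R, 0 < e &
  forall A x y, continuum A -> stable h c A -> diam_le l A -> A x -> A y -> mdist x y < e ->
  exists B, [/\ continuum B, B `<=` A, B x, B y & diam_le d B].
Proof.
have [r r0 sep] := stable_separation.
have [l l0 lP] := small_cells cS lp r0.
have l20 : 0 < l / 2 by rewrite divr_gt0.
exists (l / 2) => // d d0; apply: contrapT => nex.
have ex (k : nat) : exists w : set S * (S * S), [/\ [/\ continuum w.1, stable h c w.1, diam_le (l / 2) w.1 &
    ~ diam_le d w.1], w.1 w.2.1, w.1 w.2.2, mdist w.2.1 w.2.2 < k.+1%:R^-1 &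
    forall B, closed B -> B `<=` w.1 -> B w.2.1 -> B w.2.2 -> rconn eq B -> w.1 `<=` B].
  apply: contrapT => nk; apply: nex; exists k.+1%:R^-1; first by rewrite invr_gt0.
  move=> A x y [cA kA] sA lA Ax Ay xy.
  have [M [[cM kM MA Mx My] mM]] := continuum_minimal cS cA kA Ax Ay.
  have [dM|ndM] := pselect (diam_le d M); first by exists M.
  exfalso; apply: nk; exists (M, (x, y)); split => //; split => //.
    exact: stable_sub sA.
  by move=> u v /MA Au /MA Av; exact: lA.
have [W WP] := choice ex.
pose M k := (W k).1; pose x k := (W k).2.1; pose y k := (W k).2.2.
have [p xp] := ucvgT_ex cS x.
have yp : y @ omega --> p.
  by apply: ucvg_close xp _; apply: nearW => k; have [] := WP k.
have exuv k : exists uv : S * S, [/\ M k uv.1, M k uv.2 & d < mdist uv.1 uv.2].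
  have [[_ _ _ nd] _ _ _ _] := WP k; apply: contrapT => nuv; apply: nd => u v Mu Mv.
  by rewrite leNgt; apply/negP => H; apply: nuv; exists (u, v).
have [uv uvP] := choice exuv.
have [u uvu] := ucvgT_ex cS (fst \o uv); have [v uvv] := ucvgT_ex cS (snd \o uv).
have uv_d : d <= mdist u v.
  by apply: (ucvg_mdist_ge uvu uvv); apply: nearW => k; have [_ _ /ltW] := uvP k.
(* The limits [u] and [v] are at least [d] apart, so one of them differs from the common limit [p]
   of the ends. *)
have [t [q [tM tq qp]]] : exists t q, [/\ forall k, M k (t k), t @ omega --> q & q <> p].
  have [up|np] := pselect (u = p); last by exists (fst \o uv), u; split => // k; have [] := uvP k.
  exists (snd \o uv), v; split => //; first by move=> k; have [] := uvP k.
  by move=> vp; move: uv_d; rewrite up vp mdistxx leNgt d0.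
have cM : continuum (ulimset M).
  apply: ulimset_continuum => // e e0; apply: nearW => k; apply: connected_econn => //.
  by have [[[]]] := WP k.
have sM : stable h c (ulimset M).
  by apply: ulimset_stable => // n; apply: nearW => k; have [[_ sM _ _] _ _ _ _] := WP k; exact: sM.
have Lp : ulimset M p by apply: ulimset_seq xp; apply: nearW => k; have [] := WP k.
have Lq : ulimset M q by apply: ulimset_seq tq; exact: nearW.
have [D [B [cellD rD lD]]] := lP p.
have Dp : D p by apply: lD; exact: ballxx.
have pq_l : mdist p q <= l / 2.
  apply: (ucvg_mdist_le xp tq); apply: nearW => k.
  by have [[_ _ H _] Mx _ _ _] := WP k; exact: (H _ _ Mx (tM k)).
have Dq : D q by apply: lD; rewrite mballE; lra.
have npq : ~ joined D p q.
  move=> [A [cA AD sA Ap Aq]]; apply: qp; apply: (cw cA cM) => //.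
  by apply: stable_le sA; move: (c0); lra.
have [K [cK sK KD _ [G [G' [DE Gp G'q [cG cG' GG' GK G'K]]]]]] := sep D B cellD rD p q Dp Dq npq.
have nG'p : ~ (G' `|` K) p.
  move=> [G'p|Kp]; first by have : (G `&` G') p by []; rewrite GG'.
  by have : (G `&` K) p by []; rewrite GK.
have nGq : ~ (G `|` K) q.
  move=> [G'p|Kp]; first by have : (G `&` G') q by []; rewrite GG'.
  by have : (G' `&` K) q by []; rewrite G'K.
have [k [[[H1 H2] H3] H4]] := omega_ex (filterI (filterI (filterI (ucvg_mdist l20 xp)
  (ucvg_not_closed cG' xp nG'p)) (ucvg_not_closed cG' yp nG'p)) (ucvg_not_closed cG tq nGq)).
have [[[cMk kMk] sMk lMk _] Mx My _ mM] := WP k.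
have MD : M k `<=` D.
  move=> z Mz; apply: lD; rewrite mballE; apply: le_lt_trans (mdist_tri _ (x k) _) _.
  by have := lMk _ _ Mx Mz; move: H1; rewrite /x; lra.
have inG z : D z -> ~ (G' `|` K) z -> (G `|` K) z.
  by rewrite DE => -[[Gz|Kz]|G'z] n; [left|right|exfalso; apply: n; left].
have bothK z : (G `|` K) z -> (G' `|` K) z -> K z.
  move=> [Gz|Kz] [G'z|Kz']//.
  by have : (G `&` G') z by []; rewrite GG'.
apply: H4.
have clM : closed (M k) by exact: compact_closed.
suff MGK : M k `<=` M k `&` (G `|` K) by have [] := MGK _ (tM k).
(* The two pieces of [M k] meet inside [K], hence in at most one point, since [K] is stable and
   [M k] unstable. So [M k] would lie on the side of its ends, although [t k] does not. *)
apply: (@rconn_cut R S eq (M k) _ (M k `&` (G' `|` K)) (x k) (y k)) => //.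
- exact: connected_rconn.
- exact: closedI.
- exact: closedI.
- rewrite -setIUr; apply/seteqP; split => [z Mz|z []//]; split => //.
  by have := MD z Mz; rewrite DE => -[[Gz|Kz]|G'z]; [left; left|left; right|right; left].
- by split => //; apply: inG => //; exact: MD.
- by split => //; apply: inG => //; exact: MD.
- move=> z w [Mz GKz] [_ GKz'] [Mw GKw] [_ GKw'].
  by apply: (cw cK (conj cMk kMk)) => //; exact: bothK.
- by move=> z w _ ? ->.
Qed.

End stable_classes.

(** * Pulling back stable continua, and connectedness modulo small ones *)

Section expansivity.
Variables (R : realType) (S : metricType R).
Hypotheses (cS : compact [set: S]) (lp : locally_planar R S).
Variables (g h : S -> S) (c : R).
Hypotheses (cg : continuous g) (ch : continuous h) (gh : cancel g h) (hg : cancel h g).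
Hypotheses (c0 : 0 < c) (cw : cw1 g h c).
Implicit Types (A B C D E J K T : set S) (x y z w : S).

Let hausS := @metric_hausdorff R S.

Let iter_cancel_ge n m z : (m <= n)%N -> iter n g (iter m h z) = iter (n - m) g z.
Proof.
move=> mn; rewrite -{1}(subnK mn) iterD (iter_cancel _ hg)// subnn.
by [].
Qed.

(* Each iterate of an irreducible [J] is irreducible as well, so it equals the short
   continuum that [short_join] finds in it. *)
Lemma pull_back : exists2 l : R, 0 < l & forall d : R, 0 < d -> exists2 e : R, 0 < e &
  forall E x y, continuum E -> stable g c E -> diam_le l E -> E x -> E y -> mdist x y < e ->
  exists J, [/\ continuum J, J `<=` E, J x, J y & forall n,
    (forall j A, (j <= n)%N -> continuum A -> stable g c A -> A (iter j h x) -> A (iter j h y) ->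
      mdist (iter j h x) (iter j h y) < e) ->
    forall j, (j <= n)%N -> bnd h d j J].
Proof.
have [l' l'0 lP] := short_join cS lp ch cg hg gh c0 (cw1_sym cw).
pose l := Num.min l' c; have l0 : 0 < l by rewrite lt_min l'0.
have ll' : l <= l' by rewrite ge_min lexx.
have lc : l <= c by rewrite ge_min lexx orbT.
have [b b0 bP] := unif_cont cS ch l0.
exists l => // d0 d00.
(* With [d < b], one more application of [h] gives a set of size at most [l], still admissible for
   [short_join]; irreducibility then brings the size back to [d]. *)
pose d := Num.min (Num.min d0 l) (b / 2).
have dp : 0 < d.
  by rewrite lt_min; apply/andP; split; [rewrite lt_min d00; exact: l0|rewrite divr_gt0].
have dd0 : d <= d0 by rewrite /d ge_min ge_min lexx.
have dl : d <= l by rewrite /d ge_min (ge_min l) lexx orbT.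
have db : d < b.
  by apply: (@le_lt_trans _ _ (b / 2)); [rewrite ge_min lexx orbT|move: (b0); lra].
have [e e0 eP] := lP d dp; exists e => // E x y cE sE lE Ex Ey xy.
have lE' : diam_le l' E by move=> z w Ez Ew; exact: le_trans (lE z w Ez Ew) ll'.
have [F [[cF kF] FE Fx Fy dF]] := eP E x y cE sE lE' Ex Ey xy.
have [J [[cJ kJ JF Jx Jy] mJ]] := continuum_minimal cS cF kF Fx Fy.
have JE : J `<=` E by move=> z /JF/FE.
have sJ : stable g c J by exact: stable_sub sE.
exists J; split => // n close.
have H : forall j, (j <= n)%N -> forall i, (i <= j)%N -> bnd h d i J.
  elim=> [_ i|j IH jn i].
    by rewrite leqn0 => /eqP-> z w /JF Fz /JF Fw; exact: dF.
  rewrite leq_eqVlt => /orP[/eqP-> {i}|]; last by rewrite ltnS; exact/IH/ltnW.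
  have {}IH := IH (ltnW jn).
  pose J' := iter j.+1 h @` J.
  have cJ' : continuum J' by exact: iter_image_continuum.
  have bl : bnd h l j.+1 J.
    by move=> z w Jz Jw /=; apply/ltW/bP; apply: le_lt_trans (IH j (leqnn _) z w Jz Jw) db.
  have sJ' : stable g c J'.
    move=> m _ _ [z Jz <-] [w Jw <-].
    have [jm|mj] := leqP j.+1 m; first by rewrite !iter_cancel_ge//; exact: sJ.
    rewrite !(iter_cancel _ hg) ?(ltnW mj)//.
    have [m0|m0] := posnP m; first by rewrite m0 subn0; exact: le_trans (bl z w Jz Jw) lc.
    apply: le_trans (IH _ _ z w Jz Jw) (le_trans dl lc).
    by lia.
  have xJ' : J' (iter j.+1 h x) by exists x.
  have yJ' : J' (iter j.+1 h y) by exists y.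
  have lJ' : diam_le l' J'.
    by move=> _ _ [z Jz <-] [w Jw <-]; exact: le_trans (bl z w Jz Jw) ll'.
  (* [J'] itself is the stable continuum on which the closeness of the two points at time [j.+1] is
     conditional. In the main argument closeness is deduced from the presence of such a
     continuum. *)
  have [B [cB BJ' Bx By dB]] :=
    eP J' _ _ cJ' sJ' lJ' xJ' yJ' (close j.+1 J' jn cJ' sJ' xJ' yJ').
  have JgB : J `<=` iter j.+1 g @` B.
    have cgB := iter_image_continuum cg j.+1 cB.
    apply: mJ.
    - by apply: compact_closed; [exact: hausS|exact: cgB.1].
    - move=> _ [z /BJ'[w Jw <-] <-].
      by rewrite iter_cancel_ge// subnn.
    - by exists (iter j.+1 h x) => //; rewrite iter_cancel_ge// subnn.
    - by exists (iter j.+1 h y) => //; rewrite iter_cancel_ge// subnn.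
    - by apply: connected_rconn => //; exact: cgB.2.
  move=> z w /JgB[z' Bz' <-] /JgB[w' Bw' <-].
  by rewrite !(iter_cancel _ gh)// subnn; exact: dB.
by move=> j jn z w Jz Jw; exact: le_trans (H j jn j (leqnn _) z w Jz Jw) dd0.
Qed.

(** With bound [c], [pull_back] yields a continuum through both points that is at once stable and
    unstable. *)
Lemma same_class_eq : exists l e : R, [/\ 0 < l, 0 < e & forall E x y, continuum E ->
  stable g c E -> diam_le l E -> E x -> E y ->
  (forall n, mdist (iter n h x) (iter n h y) < e) -> x = y].
Proof.
have [l l0 lP] := pull_back; have [e e0 eP] := lP c c0.
exists l, e; split => // E x y cE sE lE Ex Ey xy.
have [J [cJ JE Jx Jy JP]] := eP E x y cE sE lE Ex Ey (xy 0%N).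
apply: (cw cJ cJ) => //; first exact: stable_sub sE.
by move=> n; apply: (JP n).
Qed.

Section small_relation.
Variable d : R.
Hypothesis d0 : 0 < d.

(** In contrast with [joined], no disc confines the continua and transitivity is not claimed: the
    bound may double under unions. *)
Definition stably_related z w := exists J, [/\ continuum J, stable g d J, J z & J w].

Lemma stably_related_refl z : stably_related z z.
Proof. by exists [set z]; split => //; [exact: continuum1|apply: stable1; exact: ltW]. Qed.

Lemma stably_related_sym z w : stably_related z w -> stably_related w z.
Proof. by move=> [J [? ? ? ?]]; exists J. Qed.

Lemma stably_related_closed : closed_rel stably_related.
Proof.
move=> a b p q ap bq ab.
have ex k : exists A, stably_related (a k) (b k) ->
    [/\ continuum A, stable g d A, A (a k) & A (b k)].
  have [[A AH]|n] := pselect (stably_related (a k) (b k)); first by exists A.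
  by exists set0.
have [A AH] := choice ex.
exists (ulimset A); split.
- apply: ulimset_continuum => // e e0; apply: filterS ab => k /AH[[_ kA] _ _ _].
  exact: connected_econn.
- apply: ulimset_stable => // n; apply: filterS ab => k /AH[_ sA _ _].
  exact: sA.
- by apply: ulimset_seq ap; apply: filterS ab => k /AH[].
- by apply: ulimset_seq bq; apply: filterS ab => k /AH[].
Qed.

Lemma stably_related_bnd z w n : stably_related z w -> mdist (iter n g z) (iter n g w) <= d.
Proof. by move=> [J [_ sJ Jz Jw]]; exact: sJ. Qed.

(** The points of [T] whose images can be reached by [e]-chains form a closed set with closed
    complement in [T]. A related pair across this splitting would be one more admissible step of the
    chain. *)
Lemma rconn_econn T n (e : R) : closed T -> rconn stably_related T -> 0 < e ->
  (forall z w, stably_related z w -> mdist (iter n g z) (iter n g w) < e) ->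
  econn e (iter n g @` T).
Proof.
move=> cT kT e0 H _ _ [z Tz <-] [w Tw <-].
pose rch v := reach (iter n g @` T) e (iter n g z) (iter n g v).
have img v : T v -> (iter n g @` T) (iter n g v) by move=> Tv; exists v.
have near_limit (a : nat -> S) v : a @ omega --> v -> exists k, mdist (iter n g v) (iter n g (a k)) < e.
  move=> av; apply: omega_ex; apply: (@ucvg_mdist _ _ (fun k => iter n g (a k))) => //.
  by apply: cvg_comp av _; exact: iter_continuous.
apply: contrapT => nw.
have [|||||p [q [[Tp rp] [Tq nq] /H pq]]] := kT (T `&` rch) (T `\` rch).
- apply: closed_ucvg => a v aH av.
  have Tv : T v by apply: (ucvg_closed cT av); apply: nearW => k; have [] := aH k.
  split => //; have [k vk] := near_limit _ _ av; have [_ rk] := aH k.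
  by apply: reachS rk (img _ Tv) _; apply: ball_sym; rewrite mballE.
- apply: closed_ucvg => a v aH av.
  have Tv : T v by apply: (ucvg_closed cT av); apply: nearW => k; have [] := aH k.
  split => // rv; have [k vk] := near_limit _ _ av; have [Tk nk] := aH k.
  by apply: nk; apply: reachS rv (img _ Tk) _; rewrite mballE.
- apply/seteqP; split => [v Tv|v [[]|[]]]//.
  by have [rv|nv] := pselect (rch v); [left|right].
- by exists z; split => //; apply: reach0; exact: img.
- by exists w.
- by apply: nq; apply: reachS rp (img _ Tq) _; rewrite mballE.
Qed.

End small_relation.
End expansivity.

(** * Expansivity *)

Section main.
Variables (R : realType) (S : metricType R).
Hypotheses (cS : compact [set: S]) (lp : locally_planar R S).
Variables (g h : S -> S) (c : R).
Hypotheses (cg : continuous g) (ch : continuous h) (gh : cancel g h) (hg : cancel h g).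
Hypotheses (c0 : 0 < c) (cw : cw1 g h c).
Implicit Types (A B C D E J K T : set S) (x y z w : S).

Let hausS := @metric_hausdorff R S.

(** Adding to [T] all small stable continua that meet it produces an honest continuum: each of them
    lies on one side of any splitting, so the splitting restricts to [T] without related pairs
    across it. *)
Lemma related_thickening (d e : R) T : 0 < d -> closed T -> rconn (stably_related g d) T ->
  stable g e T -> exists E, [/\ continuum E, T `<=` E & stable g (d + e + d) E].
Proof.
move=> d0 cT kT sT; pose E : set S := [set w | exists2 z, T z & stably_related g d z w].
have TE : T `<=` E by move=> z Tz; exists z => //; exact: stably_related_refl.
have cE : closed E.
  apply: closed_ucvg => a w aE aw.
  have ex k : exists z, T z /\ stably_related g d z (a k) by have [z Tz za] := aE k; exists z.
  have [b bP] := choice ex; have [z bz] := ucvgT_ex cS b.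
  exists z; first by apply: (ucvg_closed cT bz); apply: nearW => k; have [] := bP k.
  by apply: (@stably_related_closed _ _ cS _ cg d _ _ _ _ bz aw); apply: nearW => k; have [] := bP k.
exists E; split => //; last first.
  move=> n w w' [z Tz zw] [z' Tz' zw'].
  apply: le_trans (mdist_tri _ (iter n g z') _) _; apply: lerD; last exact: stably_related_bnd.
  apply: le_trans (mdist_tri _ (iter n g z) _) _; apply: lerD; last exact: sT.
  by rewrite mdist_sym; exact: stably_related_bnd.
split; first exact: closedT_compact.
apply: rconn_connected => // P Q cP cQ EPQ [p Pp] [q Qq]; apply: contrapT => nPQ.
have PQ0 z : P z -> Q z -> False by move=> Pz Qz; apply: nPQ; exists z, z.
have TPQ z : T z -> P z \/ Q z by move=> /TE; rewrite EPQ.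
have across z w : T z -> stably_related g d z w -> ~ (P z /\ Q w \/ Q z /\ P w).
  move=> Tz [J [[cJ kJ] sJ Jz Jw]] PQ.
  have JE : J `<=` E by move=> v Jv; exists z => //; exists J.
  have [||||| v [v' [[Jv Pv] [_ Qv'] vv']]] :=
    @connected_rconn _ _ eq J (fun z => erefl z) kJ (J `&` P) (J `&` Q).
  - by apply: closedI => //; exact: compact_closed.
  - by apply: closedI => //; exact: compact_closed.
  - rewrite -setIUr -EPQ; apply/seteqP; split => [v Jv|v []//]; split => //; exact: JE.
  - by case: PQ => -[? ?]; [exists z|exists w].
  - by case: PQ => -[? ?]; [exists w|exists z].
  - by apply: (PQ0 v) => //; rewrite vv'.
have TP : (T `&` P) !=set0.
  have : E p by rewrite EPQ; left.
  move=> [z Tz zp]; exists z; split => //.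
  by have [//|Qz] := TPQ z Tz; exfalso; apply: (across _ _ Tz zp); right.
have TQ : (T `&` Q) !=set0.
  have : E q by rewrite EPQ; right.
  move=> [z Tz zq]; exists z; split => //.
  by have [Pz|//] := TPQ z Tz; exfalso; apply: (across _ _ Tz zq); left.
have [|||z [w [[Tz Pz] [_ Qw] zw]]] := kT (T `&` P) (T `&` Q) _ _ _ TP TQ.
- exact: closedI.
- exact: closedI.
- by rewrite -setIUr -EPQ; apply/seteqP; split => [v Tv|v []//]; split => //; exact: TE.
- by apply: (across z w Tz zw); left.
Qed.

(* Suppose that [x_k <> y_k] have orbits staying [1/k]-close.  Join them by a set [T_k] of
   diameter at most [1/k] that is irreducible modulo short stable continua, and iterate until
   it first becomes large.  The limit [A] of the iterates [g^n T_k] is an unstable continuum in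
   which [x_k] and [y_k] have merged to [p]; a stable class [K] separates [p] from some [q] in
   [A].  Pulled back, [K] meets [T_k] in a single class of the relation, so [T_k] could be cut
   along it, contradicting irreducibility. *)
Theorem cw1_orbits_eq : exists2 e : R, 0 < e & forall x y,
  (forall n, mdist (iter n g x) (iter n g y) < e) ->
  (forall n, mdist (iter n h x) (iter n h y) < e) -> x = y.
Proof.
have [l1 l10 PB] := pull_back cS lp cg ch gh hg c0 cw.
have [l0 [e0 [l00 e00 same]]] := same_class_eq cS lp cg ch gh hg c0 cw.
have [r r0 sep] := stable_separation cS lp cg ch gh hg c0 cw.
have r20 : 0 < Num.min r l1 by rewrite lt_min r0.
have [l2 l20 cells] := small_cells cS lp r20.
pose u := Num.min (Num.min c l0) l2.
have u0 : 0 < u by rewrite !lt_min c0 l00.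
have uc : u <= c by rewrite /u ge_min ge_min lexx.
have ul0 : u <= l0 by rewrite /u ge_min (ge_min l0) lexx orbT.
have ul2 : u <= l2 by rewrite /u ge_min lexx orbT.
(* [d2] bounds the continua of the relation and the iterates of [T k] up to time [n k]. The factor 8
   leaves room for [d2 + s + d2 <= u] and for [l2 / 2 + d2 + d2 < l2]. *)
pose d2 := u / 8; have d20 : 0 < d2 by rewrite divr_gt0.
have d2u : 8 * d2 = u by rewrite mulrC divfK.
have [b b0 bP] := unif_cont cS cg d20.
(* [s] is the size that counts as large. Since [s < b], the iterate at the first time this size is
   exceeded still has size at most [d2]. *)
pose s := Num.min d2 (b / 2).
have s0 : 0 < s by rewrite lt_min d20 divr_gt0.
have sd2 : s <= d2 by rewrite ge_min lexx.
have sb : s < b by apply: (@le_lt_trans _ _ (b / 2)); [rewrite ge_min lexx orbT|move: (b0); lra].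
have [d1 d10 d1P] := small_stable cS cg ch gh cw d20.
(* A stable continuum whose backward images are [d]-small is [d2]-small at all forward times as
   well, so its backward images qualify for the relation. *)
pose d := Num.min d1 d2.
have d0 : 0 < d by rewrite lt_min d10.
have dd1 : d <= d1 by rewrite ge_min lexx.
have dd2 : d <= d2 by rewrite ge_min lexx orbT.
have [e1 e10 PBe] := PB d d0.
have [N NP] := cw1_uniform cS cg ch cw e10.
have N0 : 0 < N.+1%:R^-1 :> R by rewrite invr_gt0.
have d2c : d2 <= c by lra.
have contr (e : R) : 0 < e -> exists N', forall n z w, (N' <= n)%N -> stably_related g d2 z w ->
    mdist (iter n g z) (iter n g w) < e.
  move=> /(contraction cS cg ch gh cw)[N' N'P]; exists N' => n z w N'n [J [[cJ kJ] sJ Jz Jw]].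
  by apply: (N'P J) => //; exact: stable_le sJ.
have [N' N'P] := contr _ N0.
pose NN := maxn N N'.
have e1s : 0 < Num.min e1 s by rewrite lt_min e10.
have [t t0 tP] := iter_unif_cont cS cg NN e1s.
apply: contrapT => nexp.
have ex (k : nat) : exists w : (S * S) * set S, [/\ w.1.1 <> w.1.2,
    forall n, mdist (iter n g w.1.1) (iter n g w.1.2) < k.+1%:R^-1 /\
      mdist (iter n h w.1.1) (iter n h w.1.2) < e0,
    [/\ closed w.2, w.2 w.1.1, w.2 w.1.2 & rconn (stably_related g d2) w.2],
    forall B, closed B -> B `<=` w.2 -> B w.1.1 -> B w.1.2 -> rconn (stably_related g d2) B -> w.2 `<=` B &
    diam_le k.+1%:R^-1 w.2].
  have k0 : 0 < k.+1%:R^-1 :> R by rewrite invr_gt0.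
  have [l l'0 lP] := small_cells cS lp k0.
  have m0 : 0 < Num.min (Num.min l k.+1%:R^-1) e0 by rewrite !lt_min l'0 k0.
  have [x [y [gxy hxy xy]]] : exists x y, [/\
      forall n, mdist (iter n g x) (iter n g y) < Num.min (Num.min l k.+1%:R^-1) e0,
      forall n, mdist (iter n h x) (iter n h y) < Num.min (Num.min l k.+1%:R^-1) e0 & x <> y].
    apply: contrapT => n'; apply: nexp; exists (Num.min (Num.min l k.+1%:R^-1) e0) => // x y gxy hxy.
    by apply: contrapT => xy; apply: n'; exists x, y.
  have [D [B [[cD kD _ _ _] kDd lD]]] := lP x.
  have Dx : D x by apply: lD; exact: ballxx.
  have Dy : D y.
    by apply: lD; rewrite mballE; have := gxy 0%N; rewrite !lt_min => /andP[/andP[]].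
  have [T [[cT TD Tx Ty kT] mT]] := rconn_minimal cS (@stably_related_refl _ _ g _ d20)
    (@stably_related_closed _ _ cS _ cg d2) (compact_closed hausS cD)
    (connected_rconn (@stably_related_refl _ _ g _ d20) kD) Dx Dy.
  exists ((x, y), T); split => //.
  - move=> n; have := gxy n; have := hxy n.
    by rewrite !lt_min => /andP[_ H1] /andP[/andP[_ H2] _].
  - by move=> z w /TD Dz /TD Dw; exact: kDd.
have [W WP] := choice ex.
pose x k := (W k).1.1; pose y k := (W k).1.2; pose T k := (W k).2.
have exn k : exists n, ~ bnd g s n (T k) /\ forall m, (m < n)%N -> bnd g s m (T k).
  have [xy close [cT Tx Ty kT] mT _] := WP k.
  (* If [T k] never became large, its thickening would be a small stable continuum through [x k] and
     [y k], and [same_class_eq] would identify them. *)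
  have exg : exists n, `[< ~ bnd g s n (T k) >].
    apply: contrapT => nn; apply: xy.
    have sT : stable g s (T k).
      by move=> n; apply: contrapT => nb; apply: nn; exists n; apply/asboolP.
    have [E [cE TE sE]] := related_thickening d20 cT kT sT.
    have sd : d2 + s + d2 <= u by lra.
    apply: (same E) => //.
    - by apply: stable_le sE; exact: le_trans uc.
    - by move=> z w Ez Ew; apply: le_trans (sE 0%N z w Ez Ew) (le_trans sd ul0).
    - exact: TE.
    - exact: TE.
    - by move=> n; have [] := close n.
  exists (ex_minn exg); case: ex_minnP => n /asboolP nb mn; split => // m mn'.
  by apply: contrapT => /asboolP /mn; rewrite leqNgt mn'.
have [n nP] := choice exn.
have ngt M : \forall k \near omega, (M < n k)%N.
  have [t' t'0 t'P] := iter_unif_cont cS cg M s0.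
  apply: filterS (omega_small t'0) => k kt'; rewrite ltnNge; apply/negP => nM.
  have [nb _] := nP k; apply: nb => z w Tz Tw; apply/ltW/t'P => //.
  by have [_ _ _ _ dT] := WP k; exact: le_lt_trans (dT z w Tz Tw) kt'.
have bn k m : (m <= n k)%N -> (0 < n k)%N -> bnd g d2 m (T k).
  move=> mn n0; have [_ nb] := nP k.
  have [mn'|] := ltnP m (n k).
    by move=> z w Tz Tw; exact: le_trans (nb m mn' z w Tz Tw) sd2.
  move=> nm; have -> : m = n k by apply/eqP; rewrite eqn_leq mn.
  case: (n k) n0 nb {mn nm} => // n' _ nb z w Tz Tw /=.
  by apply/ltW/bP; apply: le_lt_trans (nb n' (leqnn _) z w Tz Tw) sb.
pose A k := iter (n k) g @` T k.
have xA k : A k (iter (n k) g (x k)) by have [_ _ [_ Tx _ _] _ _] := WP k; exists (x k).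
have [p xp] := ucvgT_ex cS (fun k => iter (n k) g (x k)).
have yp : (fun k => iter (n k) g (y k)) @ omega --> p.
  by apply: ucvg_close xp _; apply: nearW => k; have [_ H _ _ _] := WP k; have [] := H (n k).
have exv k : exists v : S * S, [/\ T k v.1, T k v.2 &
    s < mdist (iter (n k) g v.1) (iter (n k) g v.2)].
  have [nb _] := nP k; apply: contrapT => nv; apply: nb => z w Tz Tw.
  by rewrite leNgt; apply/negP => H; apply: nv; exists (z, w).
have [v vP] := choice exv.
have [v1 v1P] := ucvgT_ex cS (fun k => iter (n k) g (v k).1).
have [v2 v2P] := ucvgT_ex cS (fun k => iter (n k) g (v k).2).
have v12 : s <= mdist v1 v2.
  by apply: (ucvg_mdist_ge v1P v2P); apply: nearW => k; have [_ _ /ltW] := vP k.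
have [a [q [aT aq qp]]] : exists a q, [/\ forall k, T k (a k),
    (fun k => iter (n k) g (a k)) @ omega --> q & q <> p].
  have [vp|nvp] := pselect (v1 = p); last by exists (fun k => (v k).1), v1; split => // k; have [] := vP k.
  exists (fun k => (v k).2), v2; split => //; first by move=> k; have [] := vP k.
  by move=> vp2; move: v12; rewrite vp vp2 mdistxx leNgt s0.
have econnT k m (e : R) : 0 < e -> (forall z w, stably_related g d2 z w ->
    mdist (iter m g z) (iter m g w) < e) -> econn e (iter m g @` T k).
  move=> e'0 H; have [_ _ [cT _ _ kT] _ _] := WP k.
  exact: (rconn_econn cg cT kT e'0 H).
(* [T k] is connected only modulo the relation, but [n k] tends to infinity and related points are
   contracted uniformly, so the iterates are chain-connected at every fixed scale for [omega]-almost
   all [k]. *)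
have cA : continuum (ulimset A).
  apply: ulimset_continuum => // e e'0; have [M MP] := contr e e'0.
  apply: filterS (ngt M) => k Mk; apply: econnT => // z w.
  by apply: MP; exact: ltnW.
have sA : stable h c (ulimset A).
  apply: ulimset_stable => // j; apply: filterS (ngt j) => k jn _ _ [z Tz <-] [w Tw <-].
  rewrite !(iter_cancel _ gh) ?(ltnW jn)//.
  apply: le_trans d2c.
  exact: (bn k _ (leq_subr _ _) (leq_ltn_trans (leq0n j) jn) _ _ Tz Tw).
have Lp : ulimset A p by apply: ulimset_seq xp; exact: nearW.
have Lq : ulimset A q by apply: ulimset_seq aq; apply: nearW => k; exists (a k).
have [D [B [cellD rD lD]]] := cells p.
have rDr : diam_le r D.
  by move=> z w Dz Dw; apply: le_trans (rD z w Dz Dw) _; rewrite ge_min lexx.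
have rDl : diam_le l1 D.
  by move=> z w Dz Dw; apply: le_trans (rD z w Dz Dw) _; rewrite ge_min lexx orbT.
have Dp : D p by apply: lD; exact: ballxx.
have pq : mdist p q <= d2.
  apply: (ucvg_mdist_le xp aq); apply: filterS (ngt 0%N) => k n0.
  by have [_ _ [_ Tx _ _] _ _] := WP k; exact: (bn k (n k) (leqnn _) n0 _ _ Tx (aT k)).
have Dq : D q by apply: lD; rewrite mballE; lra.
have npq : ~ joined g c D p q.
  move=> [E [cE ED sE Ep Eq]]; apply: qp; apply: (cw cE cA) => //.
  by apply: stable_le sE; move: (c0); lra.
have [K [cK sK KD satK [G [G' [DE Gp G'q [cG cG' GG' GK G'K]]]]]] := sep D B cellD rDr p q Dp Dq npq.
have nG'p : ~ (G' `|` K) p.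
  move=> [G'p|Kp]; first by have : (G `&` G') p by []; rewrite GG'.
  by have : (G `&` K) p by []; rewrite GK.
have nGq : ~ (G `|` K) q.
  move=> [G'p|Kp]; first by have : (G `&` G') q by []; rewrite GG'.
  by have : (G' `&` K) q by []; rewrite G'K.
have l220 : 0 < l2 / 2 by rewrite divr_gt0.
have [k [[[[[H1 H2] H3] H4] H5] H6]] := omega_ex (filterI (filterI (filterI (filterI (filterI
  (ucvg_mdist l220 xp) (ucvg_not_closed cG' xp nG'p)) (ucvg_not_closed cG' yp nG'p))
  (ucvg_not_closed cG aq nGq)) (ngt NN)) (omega_small t0)).
have [_ _ [clT Tx Ty kT] mT dT] := WP k.
have nk0 : (0 < n k)%N by exact: leq_ltn_trans H5.
apply: H4.
have near_p z : T k z -> mdist p (iter (n k) g z) < l2 / 2 + d2.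
  move=> Tz; apply: le_lt_trans (mdist_tri _ (iter (n k) g (x k)) _) _; apply: ltr_leD => //.
  exact: (bn k (n k) (leqnn _) nk0 _ _ Tx Tz).
have TD z : T k z -> D (iter (n k) g z).
  by move=> /near_p H; apply: lD; rewrite mballE; lra.
have inG z : D z -> ~ (G' `|` K) z -> (G `|` K) z.
  by rewrite DE => -[[Gz|Kz]|G'z] nz; [left|right|exfalso; apply: nz; left].
have bothK z : (G `|` K) z -> (G' `|` K) z -> K z.
  move=> [Gz|Kz] [G'z|Kz']//.
  by have : (G `&` G') z by []; rewrite GG'.
have preim (E : set S) : closed E -> closed [set z | E (iter (n k) g z)].
  move=> cE; have -> : [set z | E (iter (n k) g z)] = iter (n k) g @^-1` E by [].
  by apply: preimage_closed => // z _; exact: iter_continuous.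
suff TGK : T k `<=` T k `&` [set z | (G `|` K) (iter (n k) g z)] by have [] := TGK _ (aT k).
apply: (@rconn_cut R S (stably_related g d2) (T k) _
  (T k `&` [set z | (G' `|` K) (iter (n k) g z)]) (x k) (y k)) => //.
- exact: stably_related_refl.
- by move=> z w; exact: stably_related_sym.
- by apply: closedI => //; exact: preim.
- by apply: closedI => //; exact: preim.
- rewrite -setIUr; apply/seteqP; split => [z Tz|z []//]; split => //.
  by have := TD z Tz; rewrite DE => -[[Gz|Kz]|G'z]; [left; left|left; right|right; left].
- by split => //; apply: inG => //; exact: TD.
- by split => //; apply: inG => //; exact: TD.
(* Two points of [T k] with images in [K] must be related. [pull_back] joins the images inside [K]
   by a continuum with small backward iterates, which is then carried back by [h] for [n k]
   steps. *)
- move=> z w [Tz /= GKz] [_ /= GKz'] [Tw /= GKw] [_ /= GKw'].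
  have Kz := bothK _ GKz GKz'; have Kw := bothK _ GKw GKw'.
  have close j E : (j <= n k)%N -> continuum E -> stable g c E ->
      E (iter j h (iter (n k) g z)) -> E (iter j h (iter (n k) g w)) ->
      mdist (iter j h (iter (n k) g z)) (iter j h (iter (n k) g w)) < e1.
    move=> jn [cE kE] sE; rewrite !(iter_cancel _ gh)// => Ez Ew.
    (* Near the initial time, closeness follows from the tiny diameter of [T k]. At other times
       [cw1_uniform] compares the stable [E] with an iterate of [T k], which has enough small
       backward images and is chain-connected because related points have already been
       contracted. *)
    have [iN|iN] := leqP (n k - j) NN.
      have := tP _ z w iN (le_lt_trans (dT z w Tz Tw) H6).
      by rewrite lt_min => /andP[].
    apply: (NP E (iter (n k - j) g @` T k)) => //.
    - exact: connected_econn.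
    - apply: econnT => // z' w'; apply: N'P.
      by apply: leq_trans (leq_maxr N N') (ltnW iN).
    - move=> i iN' _ _ [z' Tz' <-] [w' Tw' <-].
      have iN2 : (i <= n k - j)%N.
        by apply: leq_trans iN' (leq_trans (leq_maxl N N') (ltnW iN)).
      rewrite !(iter_cancel _ gh)//; apply: le_trans d2c.
      exact: (bn k _ (leq_trans (leq_subr _ _) (leq_subr _ _)) nk0 _ _ Tz' Tw').
  have dK : diam_le l1 K by move=> z' w' /KD Dz /KD Dw; exact: rDl.
  have close0 : mdist (iter (n k) g z) (iter (n k) g w) < e1 by exact: (close 0%N K (leq0n _) cK sK Kz Kw).
  have [J [cJ JK Jz Jw JP]] := PBe K _ _ cK sK dK Kz Kw close0.
  have {}JP := JP (n k) close.
  have sJ : stable g d2 J.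
    apply: d1P; first exact: cJ.2.
      exact: stable_sub sK.
    by move=> z' w' Jz' Jw'; apply: le_trans (JP 0%N isT z' w' Jz' Jw') dd1.
  exists (iter (n k) h @` J); split.
  + exact: iter_image_continuum.
  + move=> m _ _ [z' Jz' <-] [w' Jw' <-].
    (* Before time [n k] the iterates are backward images of [J], controlled by [JP]; from then on
       they are forward images, controlled by [sJ]. *)
    have [nm|mn] := leqP (n k) m.
      have E z1 : iter m g (iter (n k) h z1) = iter (m - n k) g z1.
        by rewrite -{1}(subnK nm) iterD (iter_cancel _ hg)// subnn.
      by rewrite !E; exact: sJ.
    rewrite !(iter_cancel _ hg) ?(ltnW mn)//.
    by apply: le_trans dd2; apply: JP => //; exact: leq_subr.
  + by exists (iter (n k) g z) => //; rewrite (iter_cancel _ gh)// subnn.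
  + by exists (iter (n k) g w) => //; rewrite (iter_cancel _ gh)// subnn.
(* A small stable continuum passing from one piece to the other has an image in [D] that meets [K]
   by connectedness. As [K] is saturated, it contains the whole image, in particular that of [w]. *)
- move=> z w [Tz /= GKz] [Tw /= GKw] [J [[cJ kJ] sJ Jz Jw]]; split => //=; right.
  pose J' := iter (n k) g @` J.
  have [cJ' kJ'] := iter_image_continuum cg (n k) (conj cJ kJ).
  have J'D : J' `<=` D.
    move=> _ [z' Jz' <-]; apply: lD; rewrite mballE.
    apply: le_lt_trans (mdist_tri _ (iter (n k) g z) _) _.
    have := near_p _ Tz; have := sJ (n k) _ _ Jz Jz'; lra.
  have sJ' : stable g (c / 2) J'.
    move=> m _ _ [z' Jz' <-] [w' Jw' <-]; rewrite -!iterD.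
    by apply: le_trans (sJ _ _ _ Jz' Jw') _; lra.
  have J'z : J' (iter (n k) g z) by exists z.
  have J'w : J' (iter (n k) g w) by exists w.
  have [|||||z' [w' [[J'z' GKz'] [_ GKw'] zw']]] := @connected_rconn _ _ eq J' (fun z => erefl z) kJ'
    (J' `&` (G `|` K)) (J' `&` (G' `|` K)).
  + by apply: closedI => //; exact: compact_closed.
  + by apply: closedI => //; exact: compact_closed.
  + rewrite -setIUr; apply/seteqP; split => [z' Jz'|z' []//]; split => //.
    by have := J'D z' Jz'; rewrite DE => -[[Gz|Kz]|G'z]; [left; left|left; right|right; left].
  + by exists (iter (n k) g z).
  + by exists (iter (n k) g w).
  + rewrite -zw' in GKw'.
    exact: (satK J' z' (conj cJ' kJ') J'D sJ' J'z' (bothK _ GKz' GKw')).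
Qed.

End main.

Theorem theorem6p8p5 (R : realType) (S : metricType R)
    (f : {splitbij [set: S] >-> [set: S]}) :
  compact_surface S -> homeomorphism f -> cw1_expansive f -> expansive f.
Proof.
move=> [cS lp] [cf cf'] [d d0 dP].
have fK : cancel f f^-1%FUN by move=> x; rewrite funK// inE.
have f'K : cancel f^-1%FUN f by move=> x; rewrite invK// inE.
have diamP (n : int) (A : set S) :
    (forall x y, A x -> A y -> mdist (iterz f n x) (iterz f n y) <= d) ->
    (diam (iterz f n @` A) <= d%:E)%E.
  move=> H; apply: ub_ereal_sup => _ [_ [x Ax <-] [_ [y Ay <-] <-]].
  by rewrite lee_fin; exact: H.
have cw : cw1 f f^-1%FUN d.
  move=> A B cA cB sA sB x y Ax Ay Bx By; apply: (dP A B cA cB) => //.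
    by move=> [n|n] // _; apply: diamP; exact: sA.
  by move=> [[|n]|n] // _; apply: diamP; [exact: (sB 0%N)|exact: (sB n.+1)].
have [e e0 eP] := cw1_orbits_eq cS lp cf cf' fK f'K d0 cw.
exists e => // x y xy; apply: eP => n; first exact: (xy n%:Z).
by case: n => [|n]; [exact: (xy 0)|exact: (xy (Negz n))].
Qed.
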